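(* Let $d\ge 2$, let $f=f_c$, $f_c(z)=\bar z^{\,d}+c$ with $c\in\mathbb{C}$, be a unicritical anti-polynomial of degree $d$, and let $\mathcal{O}=\{z_1,\dots,z_p\}$ be a periodic orbit of $f$ of period $p$ (with $f(z_j)=z_{j+1}$, indices mod $p$) such that at least one dynamical ray at a rational angle lands at some $z_j$. Assume that the associated orbit portrait $\mathcal{P}=\{\mathcal{A}_1,\dots,\mathcal{A}_p\}$ is non-trivial. Then: (1) Each $\mathcal{A}_j$ is a finite non-empty subset of $\mathbb{Q}/\mathbb{Z}$. (2) For each $j$, the map $\theta\mapsto -d\theta$ maps $\mathcal{A}_j$ bijectively onto $\mathcal{A}_{j+1}$ and reverses the cyclic order. (3) For each $j$, $\mathcal{A}_j$ is contained in some arc of length less than $1/d$ in $\mathbb{R}/\mathbb{Z}$. (4) For every $\mathcal{A}_i$, the translated sets $\mathcal{A}_{i,j}:=\mathcal{A}_i+j/d$ $(j=0,1,\dots,d-1)$ are unlinked from each other and from all other $\mathcal{A}_m$ ($m\ne i$). (5) Each $\theta\in\mathcal{A}_j$ is periodic under $\theta\mapsto -d\theta$, and there are four possibilities for the periods: (a) if $p$ is even, then all angles in $\mathcal{P}$ have the same period $rp$ for some $r\ge 1$; (b) if $p$ is odd, then one of the following three possibilities is realized: (i) $|\mathcal{A}_j|=2$ for each $j$ and both angles have period $p$; (ii) $|\mathcal{A}_j|=2$ for each $j$ and both angles have period $2p$; (iii) $|\mathcal{A}_j|=3$ for each $j$, one angle has period $p$ and the other two angles have period $2p$.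
   Context: Every unicritical anti-polynomial of degree $d\ge2$ is affinely conjugate to some $f_c(z)=\bar z^{\,d}+c$, and is taken in this form. The filled-in Julia set $K(f_c)$ is the set of points with bounded forward orbit; $J(f_c)=\partial K(f_c)$. There is a Böttcher map $\varphi_c$ near $\infty$ (conformal, with $\varphi_c(z)/z\to1$ as $z\to\infty$) conjugating $f_c$ to $z\mapsto\bar z^{\,d}$. For $t\in\mathbb{R}/\mathbb{Z}$ the dynamical ray $\mathcal{R}_t$ is the preimage of the radial line at angle $t$ under $\varphi_c$, extended by pull-back from near $\infty$ toward $J(f_c)$; one has $f_c(\mathcal{R}_t)=\mathcal{R}_{-dt}$. The ray $\mathcal{R}_t$ lands at $z\in J(f_c)$ if it is well defined all the way to the Julia set (it meets neither the critical point nor an iterated preimage of it) and converges to $z$. Angles are elements of $\mathbb{R}/\mathbb{Z}$, a circle of total length $1$; the period of an angle is its exact (least) period under $\theta\mapsto -d\theta$. Orbit portrait: if some dynamical ray at a rational angle lands at a point of the periodic orbit $\mathcal{O}=\{z_1,\dots,z_p\}$, let $\mathcal{A}_j$ be the set of angles of all dynamical rays landing at $z_j$; the collection $\mathcal{P}=\{\mathcal{A}_1,\dots,\mathcal{A}_p\}$ is the orbit portrait of $\mathcal{O}$. It is trivial if $|\mathcal{A}_j|=1$ for all $j$, and non-trivial otherwise. Two subsets of $\mathbb{R}/\mathbb{Z}$ are unlinked if they are contained in disjoint sub-intervals of $\mathbb{R}/\mathbb{Z}$. *)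

(* Defs.v *)
From HB Require Import structures.
From mathcomp Require Import all_boot all_order all_algebra.
From mathcomp Require Import complex.
From mathcomp Require Import all_classical all_reals all_analysis.
Set Implicit Arguments.
Unset Strict Implicit.
Unset Printing Implicit Defensive.
Import Order.TTheory GRing.Theory Num.Theory numFieldNormedType.Exports.
Local Open Scope classical_set_scope.
Local Open Scope card_scope.
Local Open Scope ring_scope.

(* The complex plane; the alias ^o carries the topology and normed module
   structure. *)
Notation Cplx R := ((R[i])^o).

(* The modulus with values in R (the library norm `|z| is R[i]-valued). *)
Definition modulus (R : realType) (z : Cplx R) : R := complex.Re `|z|.

Section Dynamics.
Variables (R : realType) (d : nat).
Implicit Types (c z w : Cplx R) (t r : R).

Definition antipoly c z : Cplx R := (z : R[i])^* ^+ d + c.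

Definition filled_julia c : set (Cplx R) :=
  [set z | exists M : R, forall n, modulus (iter n (antipoly c) z) <= M].

Definition julia c : set (Cplx R) :=
  closure (filled_julia c) `&` closure (~` filled_julia c).

(* phi is a Boettcher map on the neighbourhood |z| > rho of infinity.  The
   normalisation phi(z)/z --> 1 determines phi uniquely near infinity.  Note
   that antipoly 0 is the model map z |-> conj(z)^d. *)
Record is_boettcher c (rho : R) (phi : Cplx R -> Cplx R) : Prop := {
  boettcher_rho : 0 < rho ;
  boettcher_stable :
    forall z, rho < modulus z -> rho < modulus (antipoly c z) ;
  boettcher_holo : forall z, rho < modulus z -> derivable phi z 1 ;
  boettcher_inj : forall z w, rho < modulus z -> rho < modulus w ->
    phi z = phi w -> z = w ;
  boettcher_norm : forall e : R, 0 < e -> exists M : R, forall z,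
    M < modulus z -> modulus (phi z / z - 1) < e ;
  boettcher_conj : forall z, rho < modulus z ->
    phi (antipoly c z) = antipoly 0 (phi z) }.

(* The point r * exp(2 i pi t) of the radial line at angle t. *)
Definition radial t r : Cplx R :=
  Complex (r * cos (2 * pi * t)) (r * sin (2 * pi * t)).

(* gamma r, for r > 1, is the point "phi^-1 (r exp(2 i pi t))" of the
   dynamical ray at angle t.  Near infinity this is literally so
   (ray_infty); further in, gamma is the continuous pull-back: a high enough
   iterate of the map sends gamma r into the domain of phi, onto the point
   given by the corresponding iterate of the model map (ray_pullback).  Since
   gamma avoids the critical point 0 and its iterated preimages (ray_crit),
   these conditions determine gamma on ]1, +oo[. *)
Record is_full_ray c (rho : R) (phi : Cplx R -> Cplx R) t
    (gamma : R -> Cplx R) : Prop := {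
  ray_cont : forall r, 1 < r -> {for r, continuous gamma} ;
  ray_infty : exists r0 : R, forall r, r0 < r ->
    rho < modulus (gamma r) /\ phi (gamma r) = radial t r ;
  ray_pullback : forall r, 1 < r -> exists n,
    rho < modulus (iter n (antipoly c) (gamma r)) /\
    phi (iter n (antipoly c) (gamma r)) = iter n (antipoly 0) (radial t r) ;
  ray_crit : forall r n, 1 < r -> iter n (antipoly c) (gamma r) <> 0 }.

(* The choice of phi is immaterial, by its uniqueness near infinity. *)
Definition ray_lands c t z : Prop :=
  julia c z /\
  exists rho phi gamma,
    [/\ is_boettcher c rho phi, is_full_ray c rho phi t gamma &
        gamma r @[r --> 1^'+] --> z].

End Dynamics.

(* R/Z is represented by its fundamental domain [0, 1[, and mod1 is the
   projection of the reals onto it. *)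
Section Circle.
Variables (R : realType).
Implicit Types (s t : R) (A B : set R).

Definition mod1 s : R := s - (Num.floor s)%:~R.

(* theta |-> - d theta *)
Definition angle_map (d : nat) t : R := mod1 (- (d%:R * t)).

Definition translate s A : set R := [set mod1 (t + s) | t in A].

(* Images of intervals of the real line. *)
Definition circle_interval A : Prop :=
  exists I : set R, is_interval I /\ A = mod1 @` I.

Definition unlinked A B : Prop :=
  exists I J, [/\ circle_interval I, circle_interval J, I `&` J = set0,
                  A `<=` I & B `<=` J].

(* The arc of length l starting at s. *)
Definition circle_arc s l : set R := mod1 @` `[s, s + l].

(* a, b, c are distinct and met in this order when moving counterclockwise. *)
Definition cyclic (a b c : R) : bool :=
  [|| a < b < c, b < c < a | c < a < b].

Definition reverses_cyclic_order (g : R -> R) A : Prop :=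
  forall a b c, A a -> A b -> A c -> cyclic a b c -> cyclic (g c) (g b) (g a).

Definition has_period (d : nat) t (n : nat) : Prop :=
  [/\ (0 < n)%N, iter n (angle_map d) t = t &
      forall k, (0 < k < n)%N -> iter k (angle_map d) t <> t].

End Circle.

Definition landing_angles (R : realType) (d : nat) (c z : Cplx R) : set R :=
  [set t | 0 <= t < 1 /\ ray_lands d c t z].

(* z_0, ..., z_{p-1} is a periodic orbit of exact period p. *)
Definition periodic_orbit (R : realType) (d : nat) (c : Cplx R) (p : nat)
    (z : 'I_p -> Cplx R) : Prop :=
  [/\ (0 < p)%N, injective z & forall j, antipoly d c (z j) = z (ordS j)].

Definition orbit_portrait (R : realType) (d : nat) (c : Cplx R) (p : nat)
    (z : 'I_p -> Cplx R) : 'I_p -> set R :=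
  fun j => landing_angles d c (z j).

Definition trivial_portrait (R : realType) (p : nat) (A : 'I_p -> set R) :
  Prop := forall j, A j #= `I_1.

(* Main.v *)
(* Rays landing at distinct points do not cross: two curves made of two rays and
   their common landing point, with alternating asymptotic directions, can be
   prolonged by half-lines through the intersection of two chords of the circle
   so that the Poincare-Miranda theorem forces them to meet, whereas two rays
   meet only if their angles agree modulo 1.
   The rotation by exp(2 i pi j/d) maps rays to rays, and the orbit does not
   contain the critical point 0. Hence A_i + j/d is disjoint from and unlinked
   with A_m unless j = 0 and m = i; this is (4), and it confines A_i to an arc of
   length less than 1/d, on which t |-> -d t is injective and reverses the cyclic
   order. An even iterate that fixes one angle of A_i fixes all of them, because it
   preserves the cyclic order and expands; as some angle is rational, all angles
   are periodic.
   For p odd, the p-th iterate acts on each A_i as a reflection, hence has order at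
   most 2. The shortest complementary arc of the portrait contains the critical
   value; say it belongs to A_m. Following any complementary arc of A_m backward
   until a critical arc is met shows that it is in the orbit of the shortest arc, or
   that it is longer than all other arcs of A_m. So A_m has at most three angles. *)

Require Import Defs.
From HB Require Import structures.
From mathcomp Require Import all_boot all_order all_algebra.
From mathcomp Require Import complex.
From mathcomp Require Import all_classical all_reals all_analysis.
From mathcomp Require Import ring lra zify.
Set Implicit Arguments.
Unset Strict Implicit.
Unset Printing Implicit Defensive.
Import Order.TTheory GRing.Theory Num.Theory numFieldNormedType.Exports.
Local Open Scope classical_set_scope.
Local Open Scope card_scope.
Local Open Scope ring_scope.

(** * Crossing curves in the plane *)

(** The definitions control a ray only weakly. Towards infinity it follows its direction up to an
    error o(r), not up to a bounded one, so two rays cannot simply be joined at infinity. Each curve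
    is cut at a large parameter X and continued by a half-line of direction P - O, where O is the
    common point of the two chords. Up to o(X) these half-lines lie on rays issuing from the single
    point X O; hence they are disjoint, and a crossing on a large square must involve the original
    curves. Further in, [ray_pullback] describes a point only after a number of iterates that
    depends on r. Two things have to be recovered: a level that works uniformly for all large
    potentials, and the angle, which an equation after n iterates leaves undetermined up to a root
    of unity. In the combinatorial half the sets of angles are not known to be finite at the outset.
    Finiteness follows from periodicity, periodicity from preservation of cyclic order, and this
    must therefore be obtained from statements about two or three angles at a time. *)

Section PlaneCrossing.
Variable R : realType.
Implicit Types (a b e x y : R).

(** [del] is the least distance between two points of the segment whose values differ by at least
    [e]. The set of such pairs is compact, so the minimum is attained, and it is positive because
    [e] is. *)
Lemma segment_uniformly_continuous (f : R -> R) a b e : continuous f -> 0 < e ->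
  exists2 del, 0 < del & forall x y, a <= x <= b -> a <= y <= b ->
    `|x - y| < del -> `|f x - f y| < e.
Proof.
move=> cf e0.
pose g (q : R * R) := `|f q.1 - f q.2|.
pose k (q : R * R) := `|q.1 - q.2|.
have c1 : continuous (fst : R * R -> R) by move=> q; exact: cvg_fst.
have c2 : continuous (snd : R * R -> R) by move=> q; exact: cvg_snd.
have cg : continuous g.
  move=> q; apply: cvg_norm; apply: cvgB.
    by apply: (continuous_comp (f := fst)); [exact: c1 | exact: cf].
  by apply: (continuous_comp (f := snd)); [exact: c2 | exact: cf].
have ck : continuous k.
  by move=> q; apply: cvg_norm; apply: cvgB; [exact: c1 | exact: c2].
pose K := (`[a, b]%classic `*` `[a, b]%classic) `&` (g @^-1` [set r | e <= r]).
have cK : compact K.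
  apply: compact_closedI; first by apply: compact_setX; exact: segment_compact.
  by apply: closed_comp => [q _|]; [exact: cg | exact: closed_ge].
have [K0|/set0P/negP] := pselect (K !=set0); last first.
  rewrite negbK => /eqP K0; exists 1 => // x y hx hy _.
  rewrite ltNge; apply/negP => h.
  have : K (x, y) by split => //=; rewrite !in_itv.
  by rewrite K0.
have [q /set_mem [_ qe] qmin] := compact_EVT_min K0 cK (continuous_subspaceT ck).
exists (k q).
  rewrite /k normr_gt0 subr_eq0; apply/eqP => q12.
  by move: qe; rewrite /= /g q12 subrr normr0 leNgt e0.
move=> x y hx hy; rewrite ltNge; apply: contraNT; rewrite -leNgt => h.
by apply: (qmin (x, y)); apply/mem_set; split => //=; rewrite !in_itv.
Qed.

(* Signed count of the crossings of the positive horizontal half-axis along the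
   edge from u to v. *)
Definition axis_crossing (u v : R * R) : int :=
  if 0 < u.1 then ((0 <= v.2)%R : nat)%:Z - ((0 <= u.2)%R : nat)%:Z else 0.

Definition close_points m (u v : R * R) : bool :=
  (`|u.1 - v.1| < m) && (`|u.2 - v.2| < m).

(** Discrete form of winding number 0 around a small cell. If the second coordinate changes sign
    among the corners, closeness makes it smaller than [m] everywhere, so the first coordinate is at
    least [m] in absolute value and keeps its sign. The four counts then all vanish or telescope. *)
Lemma axis_crossing_cell m (a b c d : R * R) :
  (forall u, u \in [:: a; b; c; d] -> (m <= `|u.1|) || (m <= `|u.2|)) ->
  {in [:: a; b; c; d] &, forall u v, close_points m u v} ->
  axis_crossing a b + axis_crossing b c - axis_crossing d c - axis_crossing a d = 0.
Proof.
move=> hm hc.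
have sgn u v : u \in [:: a; b; c; d] -> v \in [:: a; b; c; d] ->
    (0 <= u.2) != (0 <= v.2) -> forall w, w \in [:: a; b; c; d] ->
    m <= `|w.1|.
  move=> hu hv uv w hw.
  have {}uv : exists2 v', v' \in [:: a; b; c; d] & (0 <= w.2) != (0 <= v'.2).
    have [e|e] := eqVneq (0 <= w.2) (0 <= u.2); last by exists u.
    by exists v => //; rewrite e.
  case: uv => v' hv' wv'; move: (hm _ hw) => /orP[//|h].
  move: (hc _ _ hw hv') => /andP[_ h2]; exfalso.
  move: wv' h h2; case: (leP 0 w.2) => w0; case: (leP 0 v'.2) => v0 //= _.
    by rewrite ger0_norm // ltr_norml => h /andP[]; lra.
  by rewrite ltr0_norm // ltr_norml => h /andP[]; lra.
have same u v : u \in [:: a; b; c; d] -> v \in [:: a; b; c; d] ->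
    m <= `|u.1| -> m <= `|v.1| -> (0 < u.1) = (0 < v.1).
  move=> hu hv; move: (hc _ _ hu hv) => /andP[h2 _]; move: h2.
  rewrite ltr_norml => /andP[h3 h4].
  case: (ltP 0 u.1) => u0; case: (ltP 0 v.1) => v0 //.
    rewrite gtr0_norm // ler0_norm //; lra.
  rewrite ler0_norm // gtr0_norm //; lra.
have ia : a \in [:: a; b; c; d] by rewrite !inE eqxx.
have ib : b \in [:: a; b; c; d] by rewrite !inE eqxx ?orbT.
have ic : c \in [:: a; b; c; d] by rewrite !inE eqxx ?orbT.
have id : d \in [:: a; b; c; d] by rewrite !inE eqxx ?orbT.
rewrite /axis_crossing.
have [e|e] := boolP [&& (0 <= a.2) == (0 <= b.2), (0 <= a.2) == (0 <= c.2) &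
                       (0 <= a.2) == (0 <= d.2)].
  case/and3P: e => /eqP <- /eqP <- /eqP <-; rewrite !subrr.
  by do !case: ifP => _.
have hw : forall w, w \in [:: a; b; c; d] -> m <= `|w.1|.
  by case/nandP: e => [e|/nandP[e|e]]; apply: sgn e.
rewrite -(same _ _ ia ib) -?(same _ _ ia id) ?hw //.
by case: ifP => _; lia.
Qed.

(** [B j] counts the crossings along row [j]. Summing the cells between two rows leaves only the two
    sides: the left one lies in the left half-plane and contributes nothing, the right one
    telescopes to a total change of -1. But the first and the last row never change sign vertically,
    so both counts are 0. *)
Lemma poincare_miranda_grid m n (h : nat -> nat -> R * R) : (0 < n)%N ->
  (forall i j, (i <= n)%N -> (j <= n)%N -> (m <= `|(h i j).1|) || (m <= `|(h i j).2|)) ->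
  (forall i j i' j', (i < n)%N -> (j < n)%N -> (i <= i' <= i.+1)%N ->
     (j <= j' <= j.+1)%N -> forall k l, (i <= k <= i.+1)%N ->
     (j <= l <= j.+1)%N -> close_points m (h i' j') (h k l)) ->
  (forall j, (j <= n)%N -> (h 0%N j).1 < 0 < (h n j).1) ->
  (forall i, (i <= n)%N -> (h i n).2 < 0 < (h i 0%N).2) -> False.
Proof.
move=> n0 hm hc hx hy.
pose B j := \sum_(0 <= i < n) axis_crossing (h i j) (h i.+1 j).
have cell i j : (i < n)%N -> (j < n)%N ->
    axis_crossing (h i j) (h i.+1 j) + axis_crossing (h i.+1 j) (h i.+1 j.+1)
    - axis_crossing (h i j.+1) (h i.+1 j.+1) - axis_crossing (h i j) (h i j.+1) = 0.
  move=> hi hj; apply: (@axis_crossing_cell m).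
    by move=> u; rewrite !inE => /or4P[] /eqP ->; apply: hm; lia.
  by move=> u v; rewrite !inE => /or4P[] /eqP -> /or4P[] /eqP ->;
    apply: (hc i j); lia.
have step j : (j < n)%N -> B j - B j.+1 =
    axis_crossing (h 0%N j) (h 0%N j.+1) - axis_crossing (h n j) (h n j.+1).
  move=> hj; rewrite /B -sumrB.
  rewrite -[RHS]opprB -(@telescope_sumr _ 0 n (fun i => axis_crossing (h i j) (h i j.+1))) //.
  rewrite -sumrN; apply: eq_big_nat => i /andP[_ hi].
  by move: (cell i j hi hj); lia.
have stepE j : (j < n)%N -> B j.+1 = B j + (((0 <= (h n j.+1).2)%R : nat)%:Z - ((0 <= (h n j).2)%R : nat)%:Z).
  move=> hj; move: (step j hj).
  rewrite {1 2}/axis_crossing.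
  have /andP[l0 _] := hx j (ltnW hj).
  have /andP[_ r0] := hx j (ltnW hj).
  by rewrite r0 ltNge (ltW l0) /=; lia.
have all j : (j <= n)%N -> B j = B 0%N + (((0 <= (h n j).2)%R : nat)%:Z - ((0 <= (h n 0%N).2)%R : nat)%:Z).
  elim: j => [_|j IH hj]; first by rewrite subrr addr0.
  by rewrite stepE // IH 1?ltnW //; lia.
have Bc j : (forall i, (i <= n)%N -> (0 <= (h i j).2) = (0 <= (h 0%N j).2)) -> B j = 0.
  move=> hs; rewrite /B big_nat_cond big1 // => i /andP[/andP[_ hi] _].
  by rewrite /axis_crossing !hs ?subrr ?if_same // ltnW.
have := all n (leqnn n).
have /andP[t0 b0] := hy n (leqnn n).
rewrite (leNgt 0 (h n n).2) t0 /= (ltW b0).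
have hc0 i : (i <= n)%N -> (0 <= (h i n).2) = (0 <= (h 0%N n).2).
  move=> hi; have /andP[ti _] := hy i hi; have /andP[t1 _] := hy 0%N (leq0n n).
  by rewrite !leNgt ti t1.
have hc1 i : (i <= n)%N -> (0 <= (h i 0%N).2) = (0 <= (h 0%N 0%N).2).
  move=> hi; have /andP[_ bi] := hy i hi; have /andP[_ b1] := hy 0%N (leq0n n).
  by rewrite (ltW bi) (ltW b1).
by rewrite (Bc n hc0) (Bc 0%N hc1).
Qed.

Lemma ltr_dist_sub (a a' b b' m : R) :
  `|a - a'| < m / 2 -> `|b - b'| < m / 2 -> `|(a - b) - (a' - b')| < m.
Proof. by rewrite !ltr_norml => /andP[? ?] /andP[? ?]; apply/andP; split; lra. Qed.

(** If the curves were disjoint, their difference would map the square into the punctured plane with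
    the Poincare-Miranda signs on its sides. Compactness keeps it away from 0, and uniform
    continuity provides a grid fine enough for the discrete version. *)
Lemma crossing_curves (a1 a2 b1 b2 : R -> R) (T : R) :
  continuous a1 -> continuous a2 -> continuous b1 -> continuous b2 -> 0 < T ->
  (forall y, -T <= y <= T -> a1 (-T) < b1 y < a1 T) ->
  (forall x, -T <= x <= T -> b2 (-T) < a2 x < b2 T) ->
  exists x y, a1 x = b1 y /\ a2 x = b2 y.
Proof.
move=> ca1 ca2 cb1 cb2 T0 h1 h2; apply: contrapT => hne.
pose N (q : R * R) := `|a1 q.1 - b1 q.2| + `|a2 q.1 - b2 q.2|.
have c1 : continuous (fst : R * R -> R) by move=> q; exact: cvg_fst.
have c2 : continuous (snd : R * R -> R) by move=> q; exact: cvg_snd.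
have cN : continuous N.
  move=> q; apply: cvgD; apply: cvg_norm; apply: cvgB.
  - by apply: (continuous_comp (f := fst)); [exact: c1 | exact: ca1].
  - by apply: (continuous_comp (f := snd)); [exact: c2 | exact: cb1].
  - by apply: (continuous_comp (f := fst)); [exact: c1 | exact: ca2].
  - by apply: (continuous_comp (f := snd)); [exact: c2 | exact: cb2].
pose K := (`[-T, T]%classic `*` `[-T, T]%classic).
have cK : compact K by apply: compact_setX; exact: segment_compact.
have K0 : K !=set0 by exists (T, T); split => /=; rewrite in_itv /= lexx andbT; lra.
have [q _ qmin] := compact_EVT_min K0 cK (continuous_subspaceT cN).
have q0 : 0 < N q.
  rewrite /N lt_neqAle addr_ge0 // andbT eq_sym paddr_eq0 // !normr_eq0 !subr_eq0.
  by apply/negP => /andP[/eqP e1 /eqP e2]; apply: hne; exists q.1, q.2.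
(* A sum of absolute values at least 2m has a term at least m, as the grid lemma requires. *)
have [m m0 mE] : exists2 m, 0 < m & N q = m + m.
  by exists (N q / 2); [rewrite divr_gt0 | field].
have m20 : 0 < m / 2 by rewrite divr_gt0.
have [d1 d10 u1] := @segment_uniformly_continuous a1 (-T) T _ ca1 m20.
have [d2 d20 u2] := @segment_uniformly_continuous a2 (-T) T _ ca2 m20.
have [d3 d30 u3] := @segment_uniformly_continuous b1 (-T) T _ cb1 m20.
have [d4 d40 u4] := @segment_uniformly_continuous b2 (-T) T _ cb2 m20.
have [d d0 hd] : exists2 d, 0 < d & [/\ d <= d1, d <= d2, d <= d3 & d <= d4].
  exists (Num.min (Num.min d1 d2) (Num.min d3 d4)); first by rewrite !lt_min d10 d20 d30.
  by split; rewrite !ge_min lexx ?orbT.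
case: hd => hd1 hd2 hd3 hd4.
have [n hn] : exists n : nat, 2 * T / d < n.+1%:R.
  exists (Num.bound (2 * T / d)).
  apply: lt_trans (archi_boundP _) _; first by rewrite divr_ge0 // ?mulr_ge0 // ltW.
  by rewrite ltr_nat.
have nR0 : 0 < n.+1%:R :> R by rewrite ltr0n.
pose x (i : nat) := - T + 2 * T * (i%:R / n.+1%:R).
have xb i : (i <= n.+1)%N -> -T <= x i <= T.
  move=> hi; rewrite /x.
  have : 0 <= (i%:R / n.+1%:R : R) <= 1.
    by rewrite divr_ge0 ?ler0n //= ler_pdivrMr // mul1r ler_nat.
  by move: (i%:R / _) => r /andP[? ?]; apply/andP; split; nra.
have xS i : x i.+1 - x i = 2 * T / n.+1%:R.
  rewrite /x -(natr1 i); move: (lt0r_neq0 nR0); set N1 := n.+1%:R => hN1.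
  by field.
have xd i k l : (i <= k <= i.+1)%N -> (i <= l <= i.+1)%N -> `|x k - x l| < d.
  have hd0 : 2 * T / n.+1%:R < d by move: hn; rewrite !ltr_pdivrMr // (mulrC d).
  have hp : 0 < 2 * T / n.+1%:R by rewrite divr_gt0 // mulr_gt0.
  have dich k' : (i <= k' <= i.+1)%N -> k' = i \/ k' = i.+1.
    by clear => /andP[? ?]; lia.
  move=> /dich[] -> /dich[] ->; rewrite ?subrr ?normr0 //.
    by rewrite distrC xS gtr0_norm.
  by rewrite xS gtr0_norm.
pose h i j := (a1 (x i) - b1 (x j), a2 (x i) - b2 (x j)).
have x0 : x 0%N = - T by rewrite /x mul0r mulr0 addr0.
have xn : x n.+1 = T by rewrite /x divff ?lt0r_neq0 //; lra.
apply: (@poincare_miranda_grid m n.+1 h) => //.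
- move=> i j hi hj; have : N q <= N (x i, x j).
    by apply: qmin; apply/mem_set; split => /=; rewrite in_itv /= xb.
  rewrite mE /N /= => hN; rewrite -implyNb; apply/implyP; rewrite -ltNge => hh.
  by move: hN hh; clear; lra.
- move=> i j i' j' hi hj hi' hj' k l hk hl.
  have b1' : -T <= x i' <= T by apply: xb; clear -hi hi'; lia.
  have b2' : -T <= x j' <= T by apply: xb; clear -hj hj'; lia.
  have b3' : -T <= x k <= T by apply: xb; clear -hi hk; lia.
  have b4' : -T <= x l <= T by apply: xb; clear -hj hl; lia.
  have e1 := xd i i' k hi' hk.
  have e2 := xd j j' l hj' hl.
  rewrite /close_points /=; apply/andP; split; apply: ltr_dist_sub.
  - exact: u1 _ _ b1' b3' (lt_le_trans e1 hd1).
  - exact: u3 _ _ b2' b4' (lt_le_trans e2 hd3).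
  - exact: u2 _ _ b1' b3' (lt_le_trans e1 hd2).
  - exact: u4 _ _ b2' b4' (lt_le_trans e2 hd4).
- by move=> j hj; rewrite /= x0 xn subr_lt0 subr_gt0; exact: h1 (xb j hj).
- move=> i hi; rewrite /= x0 xn subr_lt0 subr_gt0 andbC; exact: h2 (xb i hi).
Qed.

End PlaneCrossing.

(** * Crossing of curves with two asymptotic ends *)

Section StarCrossing.
Variable R : realType.
Implicit Types (P Q O p q z w u v : R * R) (G K : R -> R * R).

Definition dot2 u v : R := u.1 * v.1 + u.2 * v.2.
Definition det2 u v : R := u.1 * v.2 - u.2 * v.1.

(** This is G x = x P + o(x). The constant [C] absorbs the initial part of the curve, so that no
    threshold on [x] is needed. *)
Definition asymptotic_ray G P := forall e : R, 0 < e -> exists2 C, 0 <= C &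
  forall x, 0 <= x ->
    `|(G x).1 - x * P.1| <= e * x + C /\ `|(G x).2 - x * P.2| <= e * x + C.

(* The curve G, followed by the half-line of direction p from the point G X. *)
Definition extend X p G (x : R) : R * R :=
  ((G (Num.min x X)).1 + Num.max (x - X) 0 * p.1,
   (G (Num.min x X)).2 + Num.max (x - X) 0 * p.2).

Lemma extend_le X p G x : x <= X -> extend X p G x = G x.
Proof.
move=> xX; rewrite /extend min_l // max_r ?subr_le0 // !mul0r !addr0.
by case: (G x).
Qed.

Lemma extend_ge X p G x : X <= x ->
  extend X p G x = ((G X).1 + (x - X) * p.1, (G X).2 + (x - X) * p.2).
Proof. by move=> xX; rewrite /extend min_r // max_l ?subr_ge0. Qed.

(* The supporting line of the unit circle at P separates the two sets. *)
Lemma extension_avoids_curve G K P Q O : dot2 P P = 1 -> dot2 O P < 1 ->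
  dot2 Q P < 1 -> asymptotic_ray G P -> asymptotic_ray K Q ->
  exists X0, forall X x y, X0 <= X -> X <= x -> 0 <= y <= X ->
    extend X (P.1 - O.1, P.2 - O.2) G x <> K y.
Proof.
move=> PP OP QP aG aK.
(* Truncation at 0 gives [y * dot2 Q P <= X * kap] for all [y] in [0, X], whatever the sign of
   [dot2 Q P]. *)
have [kap [k0 k1 kQ]] : exists kap, [/\ 0 <= kap, kap < 1 & dot2 Q P <= kap].
  by exists (Num.max 0 (dot2 Q P)); rewrite gt_max le_max lexx ltr01 QP le_max lexx orbT.
pose e := (1 - kap) / 16.
have e0 : 0 < e by rewrite divr_gt0 // subr_gt0.
have [C1 C10 hG] := aG _ e0.
have [C2 C20 hK] := aK _ e0.
have P1 : `|P.1| <= 1 by rewrite ler_norml; move: PP; rewrite /dot2; clear; nra.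
have P2 : `|P.2| <= 1 by rewrite ler_norml; move: PP; rewrite /dot2; clear; nra.
exists (8 * (C1 + C2) / (1 - kap) + 1) => X x y hX xX /andP[y0 yX] eq.
have X0 : 8 * (C1 + C2) < X * (1 - kap).
  by rewrite -ltr_pdivrMr ?subr_gt0 //; apply: lt_le_trans hX; rewrite ltrDl ltr01.
have Xp : 0 <= X := le_trans y0 yX.
have : dot2 (extend X (P.1 - O.1, P.2 - O.2) G x) P = dot2 (K y) P by rewrite eq.
rewrite extend_ge // /dot2 /=.
have [g1 g2] := hG X Xp; have [q1 q2] := hK y y0.
have bnd (r s t : R) : `|t| <= 1 -> `|r| <= s -> `|r * t| <= s.
  by move=> t1 rs; rewrite normrM; apply: le_trans rs; rewrite ler_piMr.
have := bnd _ _ _ P1 g1; have := bnd _ _ _ P2 g2.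
have := bnd _ _ _ P1 q1; have := bnd _ _ _ P2 q2.
rewrite !ler_norml => /andP[_ h1] /andP[_ h2] /andP[h3 _] /andP[h4 _].
have : 0 <= (x - X) * (1 - dot2 O P) by rewrite mulr_ge0 ?subr_ge0 // ltW.
have : y * dot2 Q P <= X * kap.
  by apply: le_trans (ler_wpM2l y0 kQ) _; apply: ler_wpM2r.
have : e * y <= e * X by rewrite ler_pM2l.
have -> : (x - X) * (1 - dot2 O P) = (x - X) * (dot2 P P - dot2 O P) by rewrite PP.
have : X * dot2 P P = X by rewrite PP mulr1.
have : e * X = X * (1 - kap) / 16 by rewrite /e; field.
rewrite /dot2; move: h1 h2 h3 h4 X0 C10 C20; move: (e * X) (e * y) => eX ey; clear.
lra.
Qed.

(** Since X P + (x - X)(P - O) = X O + x (P - O), the half-lines consist, up to o(X), of the points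
    X O + x p and X O + y q. A common point would give x det2 p q = o(X), against x >= X. *)
Lemma extensions_disjoint G K P Q O :
  det2 (P.1 - O.1, P.2 - O.2) (Q.1 - O.1, Q.2 - O.2) != 0 ->
  asymptotic_ray G P -> asymptotic_ray K Q ->
  exists2 X0, 0 < X0 & forall X x y, X0 <= X -> X <= x -> X <= y ->
    extend X (P.1 - O.1, P.2 - O.2) G x <> extend X (Q.1 - O.1, Q.2 - O.2) K y.
Proof.
set p := (P.1 - O.1, _); set q := (Q.1 - O.1, _) => D0 aG aK.
pose D := `|det2 p q|; have Dp : 0 < D by rewrite normr_gt0.
pose S := `|q.1| + `|q.2| + 1.
have S0 : 0 < S by rewrite /S; have := normr_ge0 q.1; have := normr_ge0 q.2; lra.
pose e := D / (8 * S).
have e0 : 0 < e by rewrite divr_gt0 // mulr_gt0.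
have [C1 C10 hG] := aG _ e0.
have [C2 C20 hK] := aK _ e0.
exists (4 * (C1 + C2) * S / D + 1).
  by rewrite ltr_wpDl // divr_ge0 ?mulr_ge0 ?addr_ge0 // ltW.
move=> X x y hX xX yX eq.
have X0 : 4 * (C1 + C2) * S < X * D.
  by rewrite -ltr_pdivrMr //; apply: lt_le_trans hX; rewrite ltrDl ltr01.
have Xp : 0 < X.
  apply: lt_le_trans hX; rewrite ltr_wpDl // divr_ge0 ?mulr_ge0 ?addr_ge0 //; exact: ltW.
have [g1 g2] := hG X (ltW Xp); have [q1 q2] := hK X (ltW Xp).
move: eq; rewrite !extend_ge // => -[e1 e2].
set r1 := _ - _ in g1; set r2 := _ - _ in g2; set r3 := _ - _ in q1; set r4 := _ - _ in q2.
have E : x * det2 p q = (r3 - r1) * q.2 - (r4 - r2) * q.1.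
  have f1 : (r3 - r1) = x * p.1 - y * q.1 by move: e1; rewrite /r3 /r1 /p /q /=; clear; lra.
  have f2 : (r4 - r2) = x * p.2 - y * q.2 by move: e2; rewrite /r4 /r2 /p /q /=; clear; lra.
  by rewrite f1 f2 /det2; ring.
have B1 : `|r3 - r1| <= 2 * (e * X) + (C1 + C2).
  by apply: le_trans (ler_normB _ _) _; move: g1 q1; clear; lra.
have B2 : `|r4 - r2| <= 2 * (e * X) + (C1 + C2).
  by apply: le_trans (ler_normB _ _) _; move: g2 q2; clear; lra.
have : X * D <= (2 * (e * X) + (C1 + C2)) * S.
  apply: (@le_trans _ _ (`|x * det2 p q|)).
    by rewrite normrM -/D ler_pM2r // ger0_norm // (le_trans (ltW Xp)).
  rewrite E; apply: le_trans (ler_normB _ _) _; rewrite !normrM /S.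
  have := normr_ge0 q.1; have := normr_ge0 q.2; have := normr_ge0 (r3 - r1).
  move: B1 B2; clear; nra.
have -> : (2 * (e * X) + (C1 + C2)) * S = X * D / 4 + (C1 + C2) * S.
  by rewrite /e; field; rewrite lt0r_neq0.
by move: X0 (mulr_gt0 Xp Dp); clear; lra.
Qed.

Lemma extended_rays_disjoint G K P Q O : dot2 P P = 1 -> dot2 Q Q = 1 ->
  dot2 O P < 1 -> dot2 O Q < 1 -> dot2 P Q < 1 ->
  det2 (P.1 - O.1, P.2 - O.2) (Q.1 - O.1, Q.2 - O.2) != 0 ->
  asymptotic_ray G P -> asymptotic_ray K Q ->
  (forall x y, 0 <= x -> 0 <= y -> G x <> K y) ->
  exists2 X0, 0 < X0 & forall X x y, X0 <= X -> 0 <= x -> 0 <= y ->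
    extend X (P.1 - O.1, P.2 - O.2) G x <> extend X (Q.1 - O.1, Q.2 - O.2) K y.
Proof.
move=> PP QQ OP OQ PQ D0 aG aK GK.
have QP : dot2 Q P < 1 by move: PQ; rewrite /dot2 mulrC (mulrC P.2).
have [X1 h1] := extension_avoids_curve PP OP QP aG aK.
have [X2 h2] := extension_avoids_curve QQ OQ PQ aK aG.
have [X3 X30 h3] := extensions_disjoint D0 aG aK.
exists (Num.max (Num.max X1 X2) X3); first by rewrite lt_max X30 orbT.
move=> X x y; rewrite !ge_max => /andP[/andP[hX1 hX2] hX3] x0 y0.
have [xX|Xx] := leP x X; have [yX|Xy] := leP y X.
- by rewrite !extend_le //; exact: GK.
- by rewrite extend_le // => /esym; apply: h2 => //; [exact: ltW | rewrite x0].
- by rewrite [X in _ <> X]extend_le //; apply: h1 => //; [exact: ltW | rewrite y0].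
- by apply: h3 => //; exact: ltW.
Qed.

Definition continuous2 G :=
  continuous (fun x : R => (G x).1) /\ continuous (fun x : R => (G x).2).

Lemma continuous_extend X p G : continuous2 G -> continuous2 (extend X p G).
Proof.
move=> [c1 c2].
have cm : continuous (fun x : R => Num.min x X).
  by move=> x; apply: continuous_min; [exact: cvg_id | exact: cvg_cst].
have cM : continuous (fun x : R => Num.max (x - X) 0).
  move=> x; apply: (@continuous_max _ _ (fun x => x - X) (cst 0)); last exact: cvg_cst.
  by apply: cvgB; [exact: cvg_id | exact: cvg_cst].
split => x; rewrite /extend /=; apply: cvgD.
- by apply: (continuous_comp (f := fun x : R => Num.min x X) (g := fun x => (G x).1)); [exact: cm | exact: c1].
- by apply: cvgM; [exact: cM | exact: cvg_cst].
- by apply: (continuous_comp (f := fun x : R => Num.min x X) (g := fun x => (G x).2)); [exact: cm | exact: c2].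
- by apply: cvgM; [exact: cM | exact: cvg_cst].
Qed.

(** Two half-curves issuing from [z], run through as one: [G1] backwards, then [G2]. At each
    parameter one of the two summands equals [z] and is cancelled, so that continuity follows from
    the formula without cases. *)
Definition glue z G1 G2 (x : R) : R * R :=
  ((G2 (Num.max x 0)).1 + (G1 (Num.max (- x) 0)).1 - z.1,
   (G2 (Num.max x 0)).2 + (G1 (Num.max (- x) 0)).2 - z.2).

Lemma glue_ge0 z G1 G2 x : G1 0 = z -> 0 <= x -> glue z G1 G2 x = G2 x.
Proof.
move=> <- x0; rewrite /glue max_l // max_r ?oppr_le0 // !addrK.
by case: (G2 x).
Qed.

Lemma glue_le0 z G1 G2 x : G2 0 = z -> x <= 0 -> glue z G1 G2 x = G1 (- x).
Proof.
move=> <- x0; rewrite /glue max_r // max_l ?oppr_ge0 //.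
by case: (G1 (- x)) => u v /=; congr pair; rewrite addrAC subrr add0r.
Qed.

Lemma continuous_glue z G1 G2 : continuous2 G1 -> continuous2 G2 ->
  continuous2 (glue z G1 G2).
Proof.
move=> [c11 c12] [c21 c22].
have cM : continuous (fun x : R => Num.max x 0).
  by move=> x; apply: (@continuous_max _ _ id (cst 0)); [exact: cvg_id | exact: cvg_cst].
have cm : continuous (fun x : R => Num.max (- x) 0).
  by move=> x; apply: (@continuous_max _ _ -%R (cst 0)); [exact: opp_continuous | exact: cvg_cst].
have H (a b : R -> R) (k : R) : continuous a -> continuous b ->
    continuous (fun x : R => a (Num.max x 0) + b (Num.max (- x) 0) - k).
  move=> ca cb x; apply: cvgB; last exact: cvg_cst; apply: cvgD.
    by apply: (continuous_comp (f := fun x : R => Num.max x 0)); [exact: cM | exact: ca].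
  by apply: (continuous_comp (f := fun x : R => Num.max (- x) 0)); [exact: cm | exact: cb].
by split; [exact: (H _ _ z.1 c21 c11) | exact: (H _ _ z.2 c22 c12)].
Qed.

Lemma continuous_det2l G u : continuous2 G -> continuous (fun x : R => det2 (G x) u).
Proof.
move=> [c1 c2] x; apply: cvgB; apply: cvgM; try exact: cvg_cst; [exact: c1 | exact: c2].
Qed.

(** The half-line is parallel to [u], so the functional [det2 _ u] takes on it only its value at
    [G X]; the rest of the curve is compact. *)
Lemma det2_extend_bounded X p G u : 0 <= X -> continuous2 G -> det2 p u = 0 ->
  exists B, forall x, 0 <= x -> `|det2 (extend X p G x) u| <= B.
Proof.
move=> X0 cG pu.
have cd : continuous (fun x : R => `|det2 (G x) u|).
  move=> x; apply: (continuous_comp (f := fun x : R => det2 (G x) u) (g := @Num.norm R R)).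
    exact: (continuous_det2l cG).
  exact: norm_continuous.
have [c _ hc] := EVT_max X0 (continuous_subspaceT cd).
exists (`|det2 (G c) u|) => x x0.
have -> : det2 (extend X p G x) u = det2 (G (Num.min x X)) u.
  have : det2 (extend X p G x) u =
      det2 (G (Num.min x X)) u + Num.max (x - X) 0 * det2 p u.
    by rewrite /det2 /=; ring.
  by rewrite pu mulr0 addr0.
by apply: hc; rewrite in_itv /= le_min x0 X0 ge_min lexx orbT.
Qed.

Lemma det2_separates p q u v : det2 p q != 0 ->
  det2 u p = det2 v p -> det2 u q = det2 v q -> u = v.
Proof.
case: p q u v => [p1 p2] [q1 q2] [u1 u2] [v1 v2]; rewrite /det2 /= => D0 h1 h2.
have e1 : (p1 * q2 - p2 * q1) * (u1 - v1) = 0.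
  have -> : (p1 * q2 - p2 * q1) * (u1 - v1) =
    p1 * ((u1 * q2 - u2 * q1) - (v1 * q2 - v2 * q1)) -
    q1 * ((u1 * p2 - u2 * p1) - (v1 * p2 - v2 * p1)) by ring.
  by rewrite h1 h2 !subrr !mulr0 subrr.
have e2 : (p1 * q2 - p2 * q1) * (u2 - v2) = 0.
  have -> : (p1 * q2 - p2 * q1) * (u2 - v2) =
    p2 * ((u1 * q2 - u2 * q1) - (v1 * q2 - v2 * q1)) -
    q2 * ((u1 * p2 - u2 * p1) - (v1 * p2 - v2 * p1)) by ring.
  by rewrite h1 h2 !subrr !mulr0 subrr.
move: e1 e2 => /eqP; rewrite mulf_eq0 (negbTE D0) subr_eq0 => /eqP ->.
by move=> /eqP; rewrite mulf_eq0 (negbTE D0) subr_eq0 => /eqP ->.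
Qed.

(** The two vector equations say that O lies on both chords. After extension each curve leaves in
    two opposite directions along its chord; in the coordinates dual to the chords it is bounded in
    one and runs from minus to plus infinity in the other. This is the situation of
    [crossing_curves] for large T, while disjoint original curves would have disjoint extensions. *)
Theorem star_crossing (G1 G2 K1 K2 : R -> R * R) P1 P2 Q1 Q2 O z w (s t : R) :
  continuous2 G1 -> continuous2 G2 -> continuous2 K1 -> continuous2 K2 ->
  asymptotic_ray G1 P1 -> asymptotic_ray G2 P2 ->
  asymptotic_ray K1 Q1 -> asymptotic_ray K2 Q2 ->
  G1 0 = z -> G2 0 = z -> K1 0 = w -> K2 0 = w ->
  {in [:: P1; P2; Q1; Q2], forall P, dot2 P P = 1 /\ dot2 O P < 1} ->
  {in [:: P1; P2] & [:: Q1; Q2], forall P Q, dot2 P Q < 1} ->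
  0 < s -> 0 < t ->
  (P1.1 - O.1, P1.2 - O.2) = (- s * (P2.1 - O.1), - s * (P2.2 - O.2)) ->
  (Q1.1 - O.1, Q1.2 - O.2) = (- t * (Q2.1 - O.1), - t * (Q2.2 - O.2)) ->
  det2 (P2.1 - O.1, P2.2 - O.2) (Q2.1 - O.1, Q2.2 - O.2) != 0 ->
  exists x y, [/\ 0 <= x, 0 <= y &
    [\/ G1 x = K1 y, G1 x = K2 y, G2 x = K1 y | G2 x = K2 y]].
Proof.
move=> cG1 cG2 cK1 cK2 aG1 aG2 aK1 aK2 G10 G20 K10 K20 unit PQ s0 t0.
set p1 := (P1.1 - O.1, _); set q1 := (Q1.1 - O.1, _).
set p2 := (P2.1 - O.1, _); set q2 := (Q2.1 - O.1, _) => Ep Eq D0.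
apply: contrapT => hne.
have D12 : det2 p1 q2 != 0.
  have -> : det2 p1 q2 = - s * det2 p2 q2 by rewrite Ep /det2 /=; ring.
  by rewrite mulf_neq0 // oppr_eq0 lt0r_neq0.
have D21 : det2 p2 q1 != 0.
  have -> : det2 p2 q1 = - t * det2 p2 q2 by rewrite Eq /det2 /=; ring.
  by rewrite mulf_neq0 // oppr_eq0 lt0r_neq0.
have D11 : det2 p1 q1 != 0.
  have -> : det2 p1 q1 = - s * det2 p2 q1 by rewrite Ep /det2 /=; ring.
  by rewrite mulf_neq0 // oppr_eq0 lt0r_neq0.
have iP1 : P1 \in [:: P1; P2; Q1; Q2] by rewrite !inE eqxx.
have iP2 : P2 \in [:: P1; P2; Q1; Q2] by rewrite !inE eqxx ?orbT.
have iQ1 : Q1 \in [:: P1; P2; Q1; Q2] by rewrite !inE eqxx ?orbT.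
have iQ2 : Q2 \in [:: P1; P2; Q1; Q2] by rewrite !inE eqxx ?orbT.
have jP1 : P1 \in [:: P1; P2] by rewrite !inE eqxx.
have jP2 : P2 \in [:: P1; P2] by rewrite !inE eqxx ?orbT.
have jQ1 : Q1 \in [:: Q1; Q2] by rewrite !inE eqxx.
have jQ2 : Q2 \in [:: Q1; Q2] by rewrite !inE eqxx ?orbT.
have [uP1 oP1] := unit _ iP1; have [uP2 oP2] := unit _ iP2.
have [uQ1 oQ1] := unit _ iQ1; have [uQ2 oQ2] := unit _ iQ2.
have [|X11 X110 h11] := extended_rays_disjoint uP1 uQ1 oP1 oQ1 (PQ _ _ jP1 jQ1) D11 aG1 aK1.
  by move=> x y x0 y0 e; apply: hne; exists x, y; split => //; constructor 1.
have [|X12 X120 h12] := extended_rays_disjoint uP1 uQ2 oP1 oQ2 (PQ _ _ jP1 jQ2) D12 aG1 aK2.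
  by move=> x y x0 y0 e; apply: hne; exists x, y; split => //; constructor 2.
have [|X21 X210 h21] := extended_rays_disjoint uP2 uQ1 oP2 oQ1 (PQ _ _ jP2 jQ1) D21 aG2 aK1.
  by move=> x y x0 y0 e; apply: hne; exists x, y; split => //; constructor 3.
have [|X22 X220 h22] := extended_rays_disjoint uP2 uQ2 oP2 oQ2 (PQ _ _ jP2 jQ2) D0 aG2 aK2.
  by move=> x y x0 y0 e; apply: hne; exists x, y; split => //; constructor 4.
have [X [hX1 hX2 hX3 hX4]] : exists X, [/\ X11 <= X, X12 <= X, X21 <= X & X22 <= X].
  exists (Num.max (Num.max X11 X12) (Num.max X21 X22)).
  by split; rewrite !le_max lexx ?orbT.
have X0 : 0 < X := lt_le_trans X110 hX1.
pose al := glue z (extend X p1 G1) (extend X p2 G2).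
pose be := glue w (extend X q1 K1) (extend X q2 K2).
have e0 p G : extend X p G 0 = G 0 by rewrite extend_le // ltW.
have cal : continuous2 al by apply: continuous_glue; exact: continuous_extend.
have cbe : continuous2 be by apply: continuous_glue; exact: continuous_extend.
pose D := det2 p2 q2.
(* The factors fix the orientation: [det2 p2 q] and [det2 q2 p] both equal D^2 > 0. *)
pose q := (D * q2.1, D * q2.2); pose p := (- D * p2.1, - D * p2.2).
have [B1 hB1] : exists B, forall y, `|det2 (be y) q| <= B.
  have [|B hB] := @det2_extend_bounded X q1 K1 q (ltW X0) cK1.
    by rewrite Eq /q /det2 /=; ring.
  have [|B' hB'] := @det2_extend_bounded X q2 K2 q (ltW X0) cK2.
    by rewrite /q /det2 /=; ring.
  exists (Num.max B B') => y; rewrite le_max /be.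
  have [y0|y0] := leP 0 y; first by rewrite glue_ge0 ?e0 // hB' ?orbT.
  by rewrite glue_le0 ?e0 ?hB // ?oppr_ge0 ltW.
have [B2 hB2] : exists B, forall y, `|det2 (al y) p| <= B.
  have [|B hB] := @det2_extend_bounded X p1 G1 p (ltW X0) cG1.
    by rewrite Ep /p /det2 /=; ring.
  have [|B' hB'] := @det2_extend_bounded X p2 G2 p (ltW X0) cG2.
    by rewrite /p /det2 /=; ring.
  exists (Num.max B B') => y; rewrite le_max /al.
  have [y0|y0] := leP 0 y; first by rewrite glue_ge0 ?e0 // hB' ?orbT.
  by rewrite glue_le0 ?e0 ?hB // ?oppr_ge0 ltW.
have DD : 0 < D * D by rewrite -expr2 lt0r sqrf_eq0 D0 sqr_ge0.
have big (a b : R) : 0 < a -> exists T0, forall T, T0 <= T -> b < T * a.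
  move=> a0; exists (b / a + 1) => T hT; rewrite -ltr_pdivrMr //.
  by apply: lt_le_trans hT; rewrite ltrDl.
have [T1 hT1] := big _ (B1 - det2 (G2 X) q + X * (D * D)) DD.
have [T2 hT2] := big _ (B1 + det2 (G1 X) q + X * (s * (D * D))) (mulr_gt0 s0 DD).
have [T3 hT3] := big _ (B2 - det2 (K2 X) p + X * (D * D)) DD.
have [T4 hT4] := big _ (B2 + det2 (K1 X) p + X * (t * (D * D))) (mulr_gt0 t0 DD).
have [T [XT Th1 Th2 Th3 Th4]] : exists T,
    [/\ X <= T, T1 <= T, T2 <= T, T3 <= T & T4 <= T].
  exists (Num.max X (Num.max (Num.max T1 T2) (Num.max T3 T4))).
  by split; rewrite !le_max lexx ?orbT.
have T0 : 0 < T := lt_le_trans X0 XT.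
have [||x [y [xy1 xy2]]] := crossing_curves (@continuous_det2l _ q cal) (@continuous_det2l _ p cal)
  (@continuous_det2l _ q cbe) (@continuous_det2l _ p cbe) T0.
- move=> y _; have := hB1 y; rewrite ler_norml => /andP[l1 l2].
  have -> : al T = extend X p2 G2 T by rewrite /al glue_ge0 ?e0 ?(ltW T0).
  have -> : al (- T) = extend X p1 G1 T.
    by rewrite /al glue_le0 ?e0 ?oppr_le0 ?(ltW T0) // opprK.
  rewrite !extend_ge //; apply/andP; split.
    apply: lt_le_trans l1; have := hT2 T Th2.
    have -> : det2 ((G1 X).1 + (T - X) * p1.1, (G1 X).2 + (T - X) * p1.2) q =
       det2 (G1 X) q - (T - X) * (s * (D * D)).
      by rewrite Ep /q /D /det2 /=; ring.
    by clear; lra.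
  apply: le_lt_trans l2 _; have := hT1 T Th1.
  have -> : det2 ((G2 X).1 + (T - X) * p2.1, (G2 X).2 + (T - X) * p2.2) q =
       det2 (G2 X) q + (T - X) * (D * D).
      by rewrite /q /D /det2 /=; ring.
    by clear; lra.
- move=> x _; have := hB2 x; rewrite ler_norml => /andP[l1 l2].
  have -> : be T = extend X q2 K2 T by rewrite /be glue_ge0 ?e0 ?(ltW T0).
  have -> : be (- T) = extend X q1 K1 T.
    by rewrite /be glue_le0 ?e0 ?oppr_le0 ?(ltW T0) // opprK.
  rewrite !extend_ge //; apply/andP; split.
    apply: lt_le_trans l1; have := hT4 T Th4.
    have -> : det2 ((K1 X).1 + (T - X) * q1.1, (K1 X).2 + (T - X) * q1.2) p =
       det2 (K1 X) p - (T - X) * (t * (D * D)).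
      by rewrite Eq /p /D /det2 /=; ring.
    by clear; lra.
  apply: le_lt_trans l2 _; have := hT3 T Th3.
  have -> : det2 ((K2 X).1 + (T - X) * q2.1, (K2 X).2 + (T - X) * q2.2) p =
       det2 (K2 X) p + (T - X) * (D * D).
      by rewrite /p /D /det2 /=; ring.
    by clear; lra.
have D4 : det2 p q != 0.
  have -> : det2 p q = - (D * D * det2 p2 q2) by rewrite /p /q /D /det2 /=; ring.
  by rewrite oppr_eq0 mulf_neq0 // gt_eqF.
have eab : al x = be y by exact: det2_separates D4 xy2 xy1.
move: eab; rewrite /al /be.
have [x0|/ltW x0] := leP 0 x; have [y0|/ltW y0] := leP 0 y.
- by rewrite !glue_ge0 ?e0 //; apply: h22.
- by rewrite glue_ge0 ?e0 // glue_le0 ?e0 //; apply: h21; rewrite ?oppr_ge0.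
- by rewrite glue_le0 ?e0 // glue_ge0 ?e0 //; apply: h12; rewrite ?oppr_ge0.
- by rewrite !glue_le0 ?e0 //; apply: h11; rewrite ?oppr_ge0.
Qed.
End StarCrossing.

(** * Intersecting chords of the unit circle *)

Section Chords.
Variable R : realType.
Implicit Types (P Q O w : R * R) (t u v : R).

(* Twice the signed area of the triangle P Q S. *)
Definition det3 P Q S : R := det2 P Q + det2 Q S + det2 S P.

Lemma unit_dot_lt1 P Q : dot2 P P = 1 -> dot2 Q Q = 1 -> P <> Q -> dot2 P Q < 1.
Proof.
case: P Q => [p1 p2] [q1 q2]; rewrite /dot2 /= => hp hq PQ.
have h : (p1 - q1) ^+ 2 + (p2 - q2) ^+ 2 = 2 * (1 - (p1 * q1 + p2 * q2)).
  transitivity (p1 * p1 + p2 * p2 + (q1 * q1 + q2 * q2) - 2 * (p1 * q1 + p2 * q2)).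
    by ring.
  by rewrite hp hq; ring.
rewrite -subr_gt0 -(pmulr_rgt0 _ (ltr0Sn R 1)) -h lt0r addr_ge0 ?sqr_ge0 // andbT.
rewrite paddr_eq0 ?sqr_ge0 // !sqrf_eq0 !subr_eq0.
by apply/negP => /andP[/eqP e1 /eqP e2]; apply: PQ; rewrite e1 e2.
Qed.

(** O is the intersection of the diagonals of the convex quadrilateral P1 Q1 P2 Q2. The areas of the
    triangles on either side of one diagonal are the barycentric weights of O on the other; [S1] is
    the total area computed in both ways. Being strictly between points of the circle, O satisfies
    [dot2 O P < 1]. *)
Lemma alternating_chords P1 P2 Q1 Q2 :
  {in [:: P1; P2; Q1; Q2], forall P, dot2 P P = 1} ->
  0 < det3 P1 Q1 P2 -> 0 < det3 P1 P2 Q2 -> 0 < det3 Q1 P2 Q2 ->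
  0 < det3 P1 Q1 Q2 ->
  exists O s t,
  [/\ {in [:: P1; P2; Q1; Q2], forall P, dot2 P P = 1 /\ dot2 O P < 1},
      {in [:: P1; P2] & [:: Q1; Q2], forall P Q, dot2 P Q < 1},
      0 < s /\ 0 < t,
      (P1.1 - O.1, P1.2 - O.2) = (- s * (P2.1 - O.1), - s * (P2.2 - O.2)) /\
      (Q1.1 - O.1, Q1.2 - O.2) = (- t * (Q2.1 - O.1), - t * (Q2.2 - O.2)) &
      det2 (P2.1 - O.1, P2.2 - O.2) (Q2.1 - O.1, Q2.2 - O.2) != 0].
Proof.
move=> unit.
set a := det3 P1 Q1 P2; set b := det3 P1 P2 Q2; set c := det3 Q1 P2 Q2.
set e := det3 P1 Q1 Q2 => a0 b0 c0 e0.
have Sab : 0 < a + b := addr_gt0 a0 b0.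
have Sce : 0 < c + e := addr_gt0 c0 e0.
have S0 : a + b != 0 by rewrite gt_eqF.
have S1 : c + e = a + b by rewrite /a /b /c /e /det3 /det2; ring.
have S2 : c + e != 0 by rewrite S1.
pose O := ((b * Q1.1 + a * Q2.1) / (a + b), (b * Q1.2 + a * Q2.2) / (a + b)).
have OE : O = ((c * P1.1 + e * P2.1) / (a + b), (c * P1.2 + e * P2.2) / (a + b)).
  by rewrite /O; congr (_ / _, _ / _); rewrite /a /b /c /e /det3 /det2; ring.
have uP1 : dot2 P1 P1 = 1 by apply: unit; rewrite !inE eqxx.
have uP2 : dot2 P2 P2 = 1 by apply: unit; rewrite !inE eqxx ?orbT.
have uQ1 : dot2 Q1 Q1 = 1 by apply: unit; rewrite !inE eqxx ?orbT.
have uQ2 : dot2 Q2 Q2 = 1 by apply: unit; rewrite !inE eqxx ?orbT.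
have PP : dot2 P1 P2 < 1.
  by apply: unit_dot_lt1 => // h; move: a0; rewrite /a h /det3 /det2; lra.
have QQ : dot2 Q1 Q2 < 1.
  by apply: unit_dot_lt1 => // h; move: c0; rewrite /c h /det3 /det2; lra.
have OP1 : dot2 O P1 < 1.
  have -> : dot2 O P1 = (c * dot2 P1 P1 + e * dot2 P1 P2) / (c + e).
    by rewrite OE -S1 /dot2 /=; field.
  by rewrite ltr_pdivrMr // mul1r uP1 mulr1 ltrD2l gtr_pMr.
have OP2 : dot2 O P2 < 1.
  have -> : dot2 O P2 = (c * dot2 P1 P2 + e * dot2 P2 P2) / (c + e).
    by rewrite OE -S1 /dot2 /=; field.
  by rewrite ltr_pdivrMr // mul1r uP2 mulr1 ltrD2r gtr_pMr.
have OQ1 : dot2 O Q1 < 1.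
  have -> : dot2 O Q1 = (b * dot2 Q1 Q1 + a * dot2 Q1 Q2) / (a + b).
    by rewrite /O /dot2 /=; field.
  by rewrite ltr_pdivrMr // mul1r uQ1 mulr1 addrC ltrD2r gtr_pMr.
have OQ2 : dot2 O Q2 < 1.
  have -> : dot2 O Q2 = (b * dot2 Q1 Q2 + a * dot2 Q2 Q2) / (a + b).
    by rewrite /O /dot2 /=; field.
  by rewrite ltr_pdivrMr // mul1r uQ2 mulr1 addrC ltrD2l gtr_pMr.
exists O, (e / c), (a / b); split.
- by move=> P; rewrite !inE => /or4P[] /eqP ->.
- move=> P Q; rewrite !inE => /orP[] /eqP -> /orP[] /eqP ->; apply: unit_dot_lt1 => // h.
  + by move: a0; rewrite /a h /det3 /det2; lra.
  + by move: e0; rewrite /e h /det3 /det2; lra.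
  + by move: a0; rewrite /a h /det3 /det2; lra.
  + by move: b0; rewrite /b h /det3 /det2; lra.
- by rewrite !divr_gt0.
- have c1 : c != 0 by rewrite gt_eqF.
  have b1 : b != 0 by rewrite gt_eqF.
  split; last by rewrite /O /=; congr pair; field; rewrite ?b1 ?S0.
  by rewrite OE -S1 /=; congr pair; field; rewrite ?c1 ?S2.
- have -> : (P2.1 - O.1, P2.2 - O.2) =
      (c * (P2.1 - P1.1) / (c + e), c * (P2.2 - P1.2) / (c + e)).
    by rewrite OE -S1 /=; congr pair; field.
  have -> : (Q2.1 - O.1, Q2.2 - O.2) =
      (b * (Q2.1 - Q1.1) / (a + b), b * (Q2.2 - Q1.2) / (a + b)).
    by rewrite /O /=; congr pair; field.
  rewrite -S1; set N := c + e.
  have -> : det2 (c * (P2.1 - P1.1) / N, c * (P2.2 - P1.2) / N)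
                 (b * (Q2.1 - Q1.1) / N, b * (Q2.2 - Q1.2) / N) = c * b * (a + b) / N ^+ 2.
    have -> : a + b = det2 (P2.1 - P1.1, P2.2 - P1.2) (Q2.1 - Q1.1, Q2.2 - Q1.2).
      by rewrite /a /b /det3 /det2 /=; ring.
    by rewrite /det2 /=; field.
  by rewrite gt_eqF // divr_gt0 ?exprn_gt0 // !mulr_gt0.
Qed.

Definition unit_vector (t : R) : R * R := (cos (2 * pi * t), sin (2 * pi * t)).

Lemma dot2_unit_vector t : dot2 (unit_vector t) (unit_vector t) = 1.
Proof. by rewrite /dot2 /= -!expr2 cos2Dsin2. Qed.

Lemma det3_unit_vector t u v :
  det3 (unit_vector t) (unit_vector u) (unit_vector v) =
  4 * sin (pi * (u - t)) * sin (pi * (v - t)) * sin (pi * (v - u)).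
Proof.
have dbl (x : R) : 2 * pi * x = pi * x + pi * x by ring.
rewrite /det3 /det2 /unit_vector /= !dbl !cosD !sinD !mulrBr !sinB.
have ht := cos2Dsin2 (pi * t); have hu := cos2Dsin2 (pi * u).
have hv := cos2Dsin2 (pi * v).
move: (cos (pi * t)) (sin (pi * t)) (cos (pi * u)) (sin (pi * u)) ht hu
  (cos (pi * v)) (sin (pi * v)) hv => c1 s1 c2 s2 ht hu c3 s3 hv.
(* Homogenisation: each determinant is multiplied by cos^2 + sin^2 of the third half-angle, after
   which the identity is polynomial. *)
rewrite -[X in X + _ + _]mulr1 -[X in _ + X + _]mulr1 -[X in _ + _ + X]mulr1.
by rewrite -{1}hv -{1}ht -{1}hu; ring.
Qed.

Lemma sin_pi_gt0 (x : R) : 0 < x < 1 -> 0 < sin (pi * x).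
Proof.
move=> /andP[x0 x1]; apply: sin_gt0_pi; apply/andP; split.
  by rewrite mulr_gt0 ?pi_gt0.
by rewrite gtr_pMr ?pi_gt0.
Qed.

Lemma det3_unit_vector_gt0 t u v : t < u < v -> v < t + 1 ->
  0 < det3 (unit_vector t) (unit_vector u) (unit_vector v).
Proof.
move=> /andP[tu uv] vt; rewrite det3_unit_vector.
by rewrite !mulr_gt0 ?sin_pi_gt0 //; apply/andP; split; lra.
Qed.

Theorem alternating_rays_meet (G1 G2 K1 K2 : R -> R * R) (z w : R * R) (t1 s1 t2 s2 : R) :
  continuous2 G1 -> continuous2 G2 -> continuous2 K1 -> continuous2 K2 ->
  t1 < s1 -> s1 < t2 -> t2 < s2 -> s2 < t1 + 1 ->
  asymptotic_ray G1 (unit_vector t1) -> asymptotic_ray G2 (unit_vector t2) ->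
  asymptotic_ray K1 (unit_vector s1) -> asymptotic_ray K2 (unit_vector s2) ->
  G1 0 = z -> G2 0 = z -> K1 0 = w -> K2 0 = w ->
  exists x y, [/\ 0 <= x, 0 <= y &
    [\/ G1 x = K1 y, G1 x = K2 y, G2 x = K1 y | G2 x = K2 y]].
Proof.
move=> cG1 cG2 cK1 cK2 h1 h2 h3 h4 aG1 aG2 aK1 aK2 G10 G20 K10 K20.
have [|||||O [s [t [hO hPQ [s0 t0] [eP eQ] D0]]]] :=
  @alternating_chords (unit_vector t1) (unit_vector t2) (unit_vector s1) (unit_vector s2).
- by move=> P; rewrite !inE => /or4P[] /eqP ->; exact: dot2_unit_vector.
- by apply: det3_unit_vector_gt0; [rewrite h1 | lra].
- by apply: det3_unit_vector_gt0; [rewrite h3 andbT; lra | ].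
- by apply: det3_unit_vector_gt0; [rewrite h2 | lra].
- by apply: det3_unit_vector_gt0; [rewrite h1 /=; lra | ].
exact: (star_crossing cG1 cG2 cK1 cK2 aG1 aG2 aK1 aK2 G10 G20 K10 K20 hO hPQ s0 t0 eP eQ D0).
Qed.
End Chords.

(** * Escape to infinity and the Boettcher map *)

Section Modulus.
Variable R : realType.
Implicit Types (z w : Cplx R) (x y e : R).

Lemma modulusE z : modulus z = Normc.normc z.
Proof. by []. Qed.

Lemma norm_modulus z : `|z : R[i]| = (modulus z)%:C%C.
Proof. by []. Qed.

Lemma modulus_ge0 z : 0 <= modulus z.
Proof. by rewrite modulusE; case: z => a b /=; exact: sqrtr_ge0. Qed.

Lemma modulus_eq0 z : (modulus z == 0) = (z == 0).
Proof.
apply/eqP/eqP => [/Normc.eq0_normc //|->].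
by rewrite modulusE Normc.normc0.
Qed.

Lemma modulus_gt0 z : (0 < modulus z) = (z != 0).
Proof. by rewrite lt0r modulus_eq0 modulus_ge0 andbT. Qed.

Lemma modulus0 : modulus (0 : Cplx R) = 0.
Proof. by apply/eqP; rewrite modulus_eq0. Qed.

Lemma modulus1 : modulus (1 : Cplx R) = 1.
Proof. by rewrite modulusE Normc.normc1. Qed.

Lemma modulusM (z w : R[i]) : modulus (z * w : R[i]) = modulus z * modulus w.
Proof. by rewrite !modulusE Normc.normcM. Qed.

Lemma modulusX (z : R[i]) n : modulus (z ^+ n : R[i]) = modulus z ^+ n.
Proof.
by elim: n => [|n IH]; rewrite ?expr0 ?modulus1 // !exprS modulusM IH.
Qed.

Lemma modulusV (z : R[i]) : modulus (z^-1 : R[i]) = (modulus z)^-1.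
Proof. by rewrite !modulusE Normc.normcV. Qed.

Lemma modulusN z : modulus (- z) = modulus z.
Proof. by rewrite !modulusE normcN. Qed.

Lemma modulusD z w : modulus (z + w) <= modulus z + modulus w.
Proof. by rewrite !modulusE; exact: le_normcD. Qed.

Lemma modulusB z w : modulus (z - w) <= modulus z + modulus w.
Proof. by rewrite -(modulusN w); exact: modulusD. Qed.

Lemma modulus_sub z w : modulus z - modulus w <= modulus (z - w).
Proof. by rewrite lerBlDr -{1}(subrK w z); exact: modulusD. Qed.

Lemma modulusBC z w : modulus (z - w) = modulus (w - z).
Proof. by rewrite -modulusN opprB. Qed.

Lemma modulus_conj (z : R[i]) : modulus (z^* : R[i]) = modulus z.
Proof. by rewrite /modulus (@norm_conjC R[i]). Qed.

Lemma modulus_real x : modulus (x%:C%C : Cplx R) = `|x|.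
Proof. by rewrite modulusE /= expr0n /= addr0 sqrtr_sqr. Qed.

Lemma modulus_Re z : `|complex.Re z| <= modulus z.
Proof.
rewrite modulusE; case: z => a b /=; rewrite -sqrtr_sqr.
by apply: ler_wsqrtr; rewrite lerDl sqr_ge0.
Qed.

Lemma modulus_Im z : `|complex.Im z| <= modulus z.
Proof.
rewrite modulusE; case: z => a b /=; rewrite -sqrtr_sqr.
by apply: ler_wsqrtr; rewrite lerDr sqr_ge0.
Qed.

Lemma cvg_modulusP {T : Type} {F : set_system T} {FF : Filter F}
    (g : T -> Cplx R) (l : Cplx R) :
  g @ F --> l <-> forall e, 0 < e -> \forall t \near F, modulus (l - g t) < e.
Proof.
split=> [/cvgrPdist_lt h e e0|h].
  have := h (e%:C)%C; rewrite ltcR => /(_ e0); apply: filterS => t.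
  by rewrite norm_modulus ltcR.
apply/cvgrPdist_lt => -[a b]; rewrite ltcE /= => /andP[/eqP -> a0].
have := h a a0; apply: filterS => t.
by rewrite norm_modulus ltcR.
Qed.

Lemma continuous_modulusP {T : topologicalType} (g : T -> Cplx R) (t : T) :
  {for t, continuous g} <->
  forall e, 0 < e -> \forall s \near t, modulus (g t - g s) < e.
Proof. exact: cvg_modulusP. Qed.

Lemma near_modulusP (z : Cplx R) (P : set (Cplx R)) :
  (\forall w \near z, P w) <->
  exists2 e, 0 < e & forall w, modulus (z - w) < e -> P w.
Proof.
split=> [|[e e0 h]].
  move/nbhs_ballP => [[a b]]; rewrite /= ltcE /= => /andP[/eqP -> a0] h.
  exists a => // w zw; apply: h.
  by rewrite -ball_normE /ball_ /= norm_modulus ltcR.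
apply/nbhs_ballP; exists (e%:C)%C; first by rewrite /= ltcR.
by move=> w; rewrite -ball_normE /ball_ /= norm_modulus ltcR; exact: h.
Qed.

Lemma continuous_Re {T : topologicalType} (g : T -> Cplx R) (t : T) :
  {for t, continuous g} -> {for t, continuous (fun s => complex.Re (g s))}.
Proof.
move=> /continuous_modulusP h; apply/cvgrPdist_lt => e /h.
apply: filterS => s; apply: le_lt_trans.
by rewrite -[_ - _]/(complex.Re (g t) - complex.Re (g s)); apply: le_trans (modulus_Re _); case: (g t) (g s) => ? ? [].
Qed.

Lemma continuous_Im {T : topologicalType} (g : T -> Cplx R) (t : T) :
  {for t, continuous g} -> {for t, continuous (fun s => complex.Im (g s))}.
Proof.
move=> /continuous_modulusP h; apply/cvgrPdist_lt => e /h.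
apply: filterS => s; apply: le_lt_trans.
by apply: le_trans (modulus_Im _); case: (g t) (g s) => ? ? [].
Qed.

Lemma continuous_CP (g : Cplx R -> Cplx R) (z : Cplx R) :
  {for z, continuous g} <-> forall e, 0 < e -> exists2 del, 0 < del &
    forall w, modulus (z - w) < del -> modulus (g z - g w) < e.
Proof.
split=> [/(@continuous_modulusP (Cplx R)) h e /h /near_modulusP[del del0 hd]|h].
  by exists del.
apply/(@continuous_modulusP (Cplx R)) => e /h [del del0 hd].
by apply/near_modulusP; exists del.
Qed.

Lemma continuous_Cexp n : continuous (fun w : Cplx R => ((w : R[i]) ^+ n : Cplx R)).
Proof.
elim: n => [|n IH].
  have -> : (fun w : Cplx R => ((w : R[i]) ^+ 0 : Cplx R)) = cst 1.
    by apply/funext => w; rewrite expr0.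
  move=> w; apply/(@continuous_CP (cst 1)) => e e0; exists 1 => // t _.
  by rewrite subrr modulus0.
have -> : (fun w : Cplx R => ((w : R[i]) ^+ n.+1 : Cplx R)) =
    (fun w : Cplx R => (w : R[i]) * ((w : R[i]) ^+ n) : Cplx R).
  by apply/funext => w; rewrite exprS.
move=> w; apply: (@cvgM R[i] _ _ _ id (fun w : Cplx R => (w : R[i]) ^+ n)).
- exact: (nbhs_filter w).
- exact: cvg_id.
- exact: IH.
Qed.

Lemma continuous_geometric_sum n :
  continuous (fun w : Cplx R => (\sum_(i < n) (w : R[i]) ^+ i : Cplx R)).
Proof.
elim: n => [|n IH].
  have -> : (fun w : Cplx R => (\sum_(i < 0) (w : R[i]) ^+ i : Cplx R)) = cst 0.
    by apply/funext => w; rewrite big_ord0.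
  move=> w; apply/(@continuous_CP (cst 0)) => e e0; exists 1 => // t _.
  by rewrite subrr modulus0.
have -> : (fun w : Cplx R => (\sum_(i < n.+1) (w : R[i]) ^+ i : Cplx R)) =
    (fun w : Cplx R => \sum_(i < n) (w : R[i]) ^+ i + (w : R[i]) ^+ n : Cplx R).
  by apply/funext => w; rewrite big_ord_recr.
move=> w; apply: (@cvgD R[i] (Cplx R) _ _ (nbhs_filter w)); first exact: IH.
exact: continuous_Cexp.
Qed.

(** The quotient of w^d - 1 by w - 1 is the geometric sum, which is close to d >= 2 near 1. So w ->
    w^d expands distances to 1, and 1 is the only d-th root of unity nearby; both consequences serve
    below. *)
Lemma expr_near_one (d : nat) : (1 < d)%N -> exists2 e, 0 < e &
  forall w : R[i], modulus (w - 1 : R[i]) < e ->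
    3 / 2 * modulus (w - 1 : R[i]) <= modulus (w ^+ d - 1 : R[i]).
Proof.
move=> d1.
pose S (w : Cplx R) : Cplx R := \sum_(i < d) (w : R[i]) ^+ i.
have cS : continuous S := @continuous_geometric_sum d.
have [e e0 h] : exists2 e, 0 < e &
    forall w, modulus (1 - w) < e -> modulus (S 1 - S w) < 1 / 2.
  by have /continuous_CP := @cS 1; apply; rewrite divr_gt0.
exists e => // w; rewrite modulusBC => /h hw.
rewrite subrX1 modulusM modulusBC mulrC ler_wpM2l ?modulus_ge0 //.
have S1 : S 1 = (d%:R : R)%:C%C.
  rewrite /S; under eq_bigr do rewrite expr1n.
  by rewrite sumr_const card_ord rmorph_nat.
have := modulus_sub (S 1) (S 1 - S w); rewrite subKr.
rewrite {1}S1 modulus_real ger0_norm ?ler0n //.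
have : 2 <= d%:R :> R by rewrite ler_nat.
rewrite -/(S w); move: hw; clear; lra.
Qed.
End Modulus.

(** * Growth of orbits outside the Boettcher radius *)

Section Growth.
Variables (R : realType) (d : nat) (c : Cplx R).
Hypothesis d1 : (1 < d)%N.
Implicit Types (z w : Cplx R) (x y e M rho : R) (phi : Cplx R -> Cplx R).
Let f := antipoly d c.

Lemma antipolyE z : antipoly d c z = ((z : R[i])^* ^+ d : R[i]) + c.
Proof. by []. Qed.

Lemma modulus_antipoly_ge z : modulus z ^+ d - modulus c <= modulus (f z).
Proof.
rewrite /f antipolyE -(modulus_conj z) -modulusX -(modulusN c).
by rewrite -[X in _ <= modulus (_ + X)]opprK; exact: modulus_sub.
Qed.

Lemma modulus_antipoly_le z : modulus (f z) <= modulus z ^+ d + modulus c.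
Proof. by rewrite /f antipolyE -(modulus_conj z) -modulusX; exact: modulusD. Qed.

Lemma continuous_antipoly : continuous f.
Proof.
move=> z; apply/continuous_CP => e e0.
have /continuous_CP/(_ e e0)[del del0 h] := @continuous_Cexp R d ((z : R[i])^* : R[i]).
exists del => // w zw; have := h ((w : R[i])^* : R[i]).
rewrite -rmorphB (modulus_conj (z - w)) => /(_ zw).
rewrite /f !antipolyE.
by rewrite [in X in _ -> X]opprD addrACA subrr addr0.
Qed.

Lemma continuous_iter_antipoly n : continuous (iter n f).
Proof.
elim: n => [|n IH] z; first exact: cvg_id.
exact: continuous_comp (IH z) (@continuous_antipoly (iter n f z)).
Qed.

Lemma boettcher_radius rho phi : is_boettcher d c rho phi ->
  rho + modulus c <= rho ^+ d.
Proof.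
move=> [rho0 stable _ _ _ _]; rewrite leNgt; apply/negP => hlt.
have d0 : (0 < d)%N := ltnW d1.
have rc0 : 0 < rho + modulus c by rewrite ltr_wpDr ?modulus_ge0.
have [u [u1 cu]] : exists u : R[i], modulus (u : R[i]) = 1 /\ c = - ((modulus c)%:C%C * u).
  have [->|c0] := eqVneq c 0.
    by exists 1; rewrite modulus1 modulus0 rmorph0 mul0r oppr0.
  have mc0 : modulus c != 0 by rewrite modulus_eq0.
  have mc : (modulus c)%:C%C != 0 :> R[i] by rewrite -[0]/((0 : R)%:C%C) (inj_eq (@complexI R)).
  exists (- ((modulus c)%:C%C^-1 * (c : R[i]))); split.
    by rewrite modulusN modulusM modulusV modulus_real ger0_norm ?modulus_ge0 // mulVf.
  by rewrite mulrN opprK mulVKf.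
pose q : R[i] := d.-root ((rho + modulus c)%:C%C * u).
have qd : q ^+ d = (rho + modulus c)%:C%C * u by rewrite rootCK.
have mq : modulus q ^+ d = rho + modulus c.
  by rewrite -modulusX qd modulusM u1 mulr1 modulus_real gtr0_norm.
have hq : rho < modulus (q^* : R[i]).
  rewrite modulus_conj ltNge; apply/negP => h; move: hlt; rewrite -mq ltNge.
  by rewrite lerXn2r // nnegrE ?modulus_ge0 // ltW.
have := stable _ hq; rewrite antipolyE conjCK qd {2}cu -mulrBl -rmorphB addrK.
by rewrite modulusM u1 mulr1 modulus_real gtr0_norm // ltxx.
Qed.

Variables (rho : R) (phi : Cplx R -> Cplx R).
Hypothesis bo : is_boettcher d c rho phi.
Let rho0 : 0 < rho := boettcher_rho bo.

Lemma boettcher_radius_ge1 : 1 <= rho.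
Proof.
have h : rho <= rho ^+ d.
  by apply: le_trans (boettcher_radius bo); rewrite lerDl modulus_ge0.
rewrite leNgt; apply/negP => r1; move: h; rewrite leNgt.
by rewrite ltr_iXnr ?d1.
Qed.

Lemma expr_sub_increasing x y : rho <= x -> x < y -> x ^+ d - x < y ^+ d - y.
Proof.
move=> hx xy; have x1 : 1 <= x := le_trans boettcher_radius_ge1 hx.
have [k dk] : exists k, d = k.+2 by case: d d1 => [|[|k]] // _; exists k.
have E (t : R) : t ^+ d - t = t * (t ^+ k.+1 - 1) by rewrite dk exprS mulrBr mulr1.
rewrite !E; have x0 : 0 <= x by rewrite (le_trans ler01).
have xk : x ^+ k.+1 < y ^+ k.+1 by rewrite ltrXn2r // nnegrE (le_trans x0) // ltW.
apply: le_lt_trans (_ : x * (y ^+ k.+1 - 1) < _).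
  by rewrite ler_wpM2l // lerD2r ltW.
have y0 : 0 < y ^+ k.+1 - 1 by rewrite subr_gt0 (le_lt_trans _ xk) // exprn_ege1.
by rewrite ltr_pM2r.
Qed.

Lemma stable_iter z n : rho < modulus z -> rho < modulus (iter n f z).
Proof.
by move=> hz; elim: n => // n IH; rewrite iterS; exact: (boettcher_stable bo).
Qed.

Lemma antipoly_grows z : rho < modulus z -> modulus z <= modulus (f z).
Proof.
move=> hz; have := modulus_antipoly_ge z; have := boettcher_radius bo.
have := expr_sub_increasing (lexx rho) hz.
by move: (rho ^+ d) (modulus z ^+ d) => a b; lra.
Qed.

(** The gain x^d - x - |c| is positive at x = |z| and increases with x, so every iteration adds at
    least [del] to the modulus. *)
Lemma escape z : rho < modulus z -> forall M, exists n, M < modulus (iter n f z).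
Proof.
move=> hz M; pose del := modulus z ^+ d - modulus z - modulus c.
have del0 : 0 < del.
  have := expr_sub_increasing (lexx rho) hz; have := boettcher_radius bo.
  by rewrite /del; move: (rho ^+ d) (modulus z ^+ d) => a b; lra.
have grow n : modulus z + n%:R * del <= modulus (iter n f z).
  elim: n => [|n IH]; first by rewrite mul0r addr0.
  rewrite iterS; set w := iter n f z in IH *.
  have zw : modulus z <= modulus w.
    by apply: le_trans IH; rewrite lerDl mulr_ge0 // ltW.
  have dw : del <= modulus w ^+ d - modulus w - modulus c.
    rewrite /del lerD2r; move: zw; rewrite le_eqVlt => /orP[/eqP -> //|zw].
    by apply/ltW/expr_sub_increasing => //; exact: ltW.
  have := modulus_antipoly_ge w; rewrite -natr1 mulrDl mul1r.
  by move: IH dw; lra.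
exists (Num.bound (M / del)); apply: lt_le_trans (grow _).
rewrite ltr_wpDl ?modulus_ge0 // -ltr_pdivrMr //.
have [M0|M0] := leP 0 (M / del); first exact: archi_boundP.
by apply: lt_le_trans M0 _; rewrite ler0n.
Qed.

Lemma boettcher_normal e : 0 < e -> exists2 M, rho <= M & forall z, M < modulus z ->
  modulus (phi z - z) <= e * modulus z.
Proof.
move=> e0; have [M hM] := boettcher_norm bo e0.
exists (Num.max M rho); first by rewrite le_max lexx orbT.
move=> z; rewrite gt_max => /andP[/hM hz rz].
have z0 : z != 0 by rewrite -modulus_gt0 (lt_trans rho0).
have -> : phi z - z = ((phi z / z - 1) : R[i]) * (z : R[i]) by rewrite mulrBl mul1r divfK.
by rewrite modulusM ler_wpM2r ?modulus_ge0 // ltW.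
Qed.

Lemma antipoly0E z : antipoly d (0 : Cplx R) z = (z : R[i])^* ^+ d.
Proof. by rewrite /antipoly addr0. Qed.

Lemma modulus_iter_model n z :
  modulus (iter n (antipoly d (0 : Cplx R)) z) = modulus z ^+ (d ^ n).
Proof.
elim: n => [|n IH]; first by rewrite expn0 expr1.
by rewrite iterS antipoly0E modulusX modulus_conj IH -exprM expnSr.
Qed.

Lemma boettcher_conj_iter z n : rho < modulus z ->
  phi (iter n f z) = iter n (antipoly d (0 : Cplx R)) (phi z).
Proof.
move=> hz; elim: n => // n IH; rewrite !iterS -IH.
by apply: (boettcher_conj bo); exact: stable_iter.
Qed.

Lemma first_exit M z : (exists n, M < modulus (iter n f z)) -> modulus z <= M ->
  exists2 n, M < modulus (iter n.+1 f z) & modulus (iter n f z) <= M.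
Proof.
move=> ex hz; pose n := ex_minn ex.
have [hn hmin] : M < modulus (iter n f z) /\ forall m, M < modulus (iter m f z) -> (n <= m)%N.
  by rewrite /n; case: ex_minnP.
case: n hn hmin => [|n] hn hmin; first by move: hn; rewrite ltNge hz.
by exists n => //; rewrite leNgt; apply/negP => /hmin; rewrite ltnn.
Qed.

(** A point that has just left a large disc is still bounded, hence so is [phi] there. Along a ray
    this bounds the potential at the exit time. *)
Lemma exit_bound : exists2 M0, rho <= M0 & forall M, M0 <= M -> exists2 B, 1 <= B &
  forall z, modulus z <= M -> M < modulus (f z) -> modulus (phi (f z)) <= B.
Proof.
have [M0 rM0 hM0] := boettcher_normal (ltr01 : 0 < 1 :> R).
exists M0 => // M hM; exists (2 * (M ^+ d + modulus c) + 1).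
  have M0' : 0 <= M by rewrite (le_trans _ hM) // (le_trans _ rM0) // ltW.
  by rewrite lerDr mulr_ge0 // addr_ge0 ?modulus_ge0 // exprn_ge0.
move=> z zM fz.
have h := hM0 _ (le_lt_trans hM fz); rewrite mul1r in h.
have h1 : modulus (f z) <= M ^+ d + modulus c.
  apply: le_trans (modulus_antipoly_le z) _; rewrite lerD2r lerXn2r // nnegrE ?modulus_ge0 //.
  exact: le_trans (modulus_ge0 _) zM.
have := modulusD (phi (f z) - f z) (f z); rewrite subrK.
by move: h h1; lra.
Qed.
End Growth.

(* Comparing two Boettcher maps: u = phi / phi' satisfies u (f z) = conj (u z) ^ d
   and is close to 1 near infinity, where this relation is expanding. *)
Lemma boettcher_unique (R : realType) (d : nat) (c : Cplx R) rho rho' phi phi' :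
  (1 < d)%N -> is_boettcher d c rho phi -> is_boettcher d c rho' phi' ->
  exists M, [/\ rho <= M, rho' <= M & forall z, M < modulus z -> phi z = phi' z].
Proof.
move=> d1 bo bo'; have [e e0 he] := expr_near_one R d1.
(* With both maps within relative distance [e1] of the identity, |phi' w| >= 3/4 |w|, and the
   quotient is within 2 [e1] / (3/4) <= 2 e / 3 of 1. *)
pose e1 := Num.min (e / 4) (1 / 4).
have e10 : 0 < e1 by rewrite lt_min !divr_gt0.
have e1e : e1 <= e / 4 by rewrite ge_min lexx.
have e14 : e1 <= 1 / 4 by rewrite ge_min lexx orbT.
have [M rM hM] := boettcher_normal bo e10.
have [M' rM' hM'] := boettcher_normal bo' e10.
pose N := Num.max M M'; exists N; split.
- by rewrite le_max rM.
- by rewrite le_max rM' orbT.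
move=> z hz.
have NM : M <= N by rewrite le_max lexx.
have NM' : M' <= N by rewrite le_max lexx orbT.
have rN : rho <= N := le_trans rM NM.
have rN' : rho' <= N := le_trans rM' NM'.
clearbody N.
pose f := antipoly d c.
have inc w : N < modulus w -> N < modulus (f w).
  by move=> hw; apply: lt_le_trans hw (antipoly_grows d1 bo (le_lt_trans rN hw)).
have incn n : N < modulus (iter n f z).
  by elim: n => // n IH; rewrite iterS; exact: inc.
pose u w : R[i] := (phi w : R[i]) / (phi' w : R[i]).
have u_near w : N < modulus w -> modulus (u w - 1 : R[i]) < e /\ (phi' w : R[i]) != 0.
  move=> hw; have w0 : 0 < modulus w by rewrite (lt_trans _ hw) // (lt_le_trans _ rN) // (boettcher_rho bo).
  have h1 := hM _ (le_lt_trans NM hw).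
  have h2 := hM' _ (le_lt_trans NM' hw).
  have h3 : 3 / 4 * modulus w <= modulus (phi' w).
    have := modulus_sub w (w - phi' w); rewrite subKr modulusBC.
    have : e1 * modulus w <= 1 / 4 * modulus w by rewrite ler_wpM2r // ltW.
    by move: h2; clear; lra.
  have p0 : (phi' w : R[i]) != 0.
    by rewrite -(modulus_gt0 (phi' w)); apply: lt_le_trans h3; rewrite mulr_gt0 ?divr_gt0.
  split => //.
  have -> : u w - 1 = ((phi w : R[i]) - (phi' w : R[i])) / (phi' w : R[i]).
    by rewrite /u mulrBl divff.
  rewrite modulusM modulusV ltr_pdivrMr ?(lt_le_trans _ h3) ?mulr_gt0 ?divr_gt0 //.
  have : modulus ((phi w : R[i]) - (phi' w : R[i]) : R[i]) <= modulus (phi w - w) + modulus (phi' w - w).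
    have -> : (phi w : R[i]) - (phi' w : R[i]) = (phi w - w) - (phi' w - w).
      by rewrite opprB addrA subrK.
    exact: modulusB.
  have : e1 * modulus w <= e / 4 * modulus w by rewrite ler_wpM2r // ltW.
  have : 0 < e * modulus w by rewrite mulr_gt0.
  have : e * (3 / 4 * modulus w) <= e * modulus (phi' w) by rewrite ler_pM2l.
  by move: h1 h2; move: (e1 * _) (e * modulus (phi' w)) => a b; clear; lra.
have uf w : N < modulus w -> u (f w) = (u w)^* ^+ d.
  move=> hw; have [h1 h2] : rho < modulus w /\ rho' < modulus w.
    by rewrite (le_lt_trans rN hw) (le_lt_trans rN' hw).
  rewrite /u (boettcher_conj bo h1) (boettcher_conj bo' h2) !antipoly0E.
  by rewrite -expr_div_n -fmorph_div.
have grow n : (3 / 2) ^+ n * modulus (u z - 1 : R[i]) <= modulus (u (iter n f z) - 1 : R[i]).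
  elim: n => [|n IH]; first by rewrite expr0 mul1r.
  rewrite iterS uf // exprS -mulrA.
  have [hn _] := u_near _ (incn n).
  have hc : modulus ((u (iter n f z))^* - 1 : R[i]) = modulus (u (iter n f z) - 1 : R[i]).
    by rewrite -[in RHS]modulus_conj rmorphB rmorph1.
  apply: le_trans (he _ _); last by rewrite hc.
  by rewrite hc ler_pM2l // divr_gt0.
have [_ p0] := u_near _ hz.
suff u1 : u z = 1 by move: u1 => /divr1_eq.
apply/eqP; rewrite -subr_eq0 -(modulus_eq0 (u z - 1 : R[i])).
rewrite eq_le modulus_ge0 andbT leNgt; apply/negP => u0.
have [n hn] : exists n : nat, e / modulus (u z - 1 : R[i]) < (3 / 2) ^+ n.
  have h0 : 0 <= e / modulus (u z - 1 : R[i]) by rewrite divr_ge0 // ltW.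
  move: (e / _) h0 => q h0; exists (2 * Num.bound q)%N.
  apply: lt_le_trans (archi_boundP h0) _.
  move: (Num.bound _) => m; rewrite exprM.
  apply: le_trans (_ : 1 + m%:R * 1 <= _); first by rewrite mulr1 lerDr.
  have : 1 + m%:R <= (3 / 2) ^+ 2 ^+ m :> R.
    elim: m => [|m IH]; first by rewrite expr0 addr0.
    rewrite exprS -natr1; have : 0 <= m%:R :> R by rewrite ler0n.
    by move: IH; rewrite expr2; move: (_ ^+ m) (m%:R) => a b; clear; lra.
  by rewrite mulr1.
have [h _] := u_near _ (incn n).
move: hn; rewrite ltr_pdivrMr // ltNge => /negP; apply.
exact: ltW (le_lt_trans (grow n) h).
Qed.

(** * The model map on radial lines *)

Section Radial.
Variables (R : realType) (d : nat).
Implicit Types (t s r x : R).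

Lemma radialM t s r x : (radial t r : R[i]) * (radial s x : R[i]) = radial (t + s) (r * x).
Proof.
rewrite /radial (mulrDr (2 * pi) t s) cosD sinD; apply/eqP; rewrite eq_complex /=.
by apply/andP; split; apply/eqP; ring.
Qed.

Lemma radial0 r : radial 0 r = (r%:C%C : Cplx R).
Proof. by rewrite /radial mulr0 cos0 sin0 mulr0 mulr1. Qed.

Lemma radialX t r n : (radial t r : R[i]) ^+ n = radial (n%:R * t) (r ^+ n).
Proof.
elim: n => [|n IH]; first by rewrite !expr0 mul0r radial0.
by rewrite !exprS IH radialM -natr1 mulrDl mul1r addrC.
Qed.

Lemma radial_conj t r : (radial t r : R[i])^* = radial (- t) r.
Proof. by rewrite /radial mulrN cosN sinN mulrN. Qed.

Lemma modulus_radial t r : modulus (radial t r) = `|r|.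
Proof.
rewrite modulusE /= -sqrtr_sqr; congr Num.sqrt.
by rewrite !exprMn -mulrDr cos2Dsin2 mulr1.
Qed.

Lemma radial_nat n : radial n%:R 1 = (1 : Cplx R).
Proof.
have h : radial 1 1 = (1 : Cplx R).
  have E : 2 * pi * 1 = pi *+ 2 :> R by rewrite mulr1 mulrC mulr_natr.
  by rewrite /radial E cos2pi sin2pi mulr0 mulr1.
by have := radialX 1 1 n; rewrite mulr1 expr1n => <-; rewrite h expr1n.
Qed.

Lemma radial_int (k : int) : radial k%:~R 1 = (1 : Cplx R).
Proof.
case: k => n; first exact: radial_nat.
by rewrite NegzE mulrNz -radial_conj radial_nat rmorph1.
Qed.

Lemma radialDz t r (k : int) : radial (t + k%:~R) r = radial t r.
Proof. by have := radialM t k%:~R r 1; rewrite mulr1 radial_int mulr1 => <-. Qed.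

Lemma mod1_itv t : 0 <= mod1 t < 1.
Proof.
have /andP[h1 h2] := floor_itv t; rewrite /mod1 subr_ge0 h1 /=.
by rewrite ltrBlDl -intrD1.
Qed.

Lemma mod1E t : exists k : int, mod1 t = t + k%:~R.
Proof. by exists (- Num.floor t); rewrite /mod1 mulrNz. Qed.

Lemma radial_mod1 t r : radial (mod1 t) r = radial t r.
Proof. by have [k ->] := mod1E t; rewrite radialDz. Qed.

Lemma radial_inj t s r : 0 < r -> radial t r = radial s r ->
  exists k : int, t = s + k%:~R.
Proof.
move=> r0 e; have [k hk] := mod1E (t - s).
exists (- k); suff h0 : mod1 (t - s) = 0 by move: hk; rewrite h0 mulrNz; lra.
move: (mod1_itv (t - s)) => /andP[h1 h2].
have h : radial (mod1 (t - s)) 1 = 1 :> Cplx R.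
  rewrite radial_mod1; have := radialM t (- s) r r^-1; rewrite divff ?gt_eqF // => <-.
  by rewrite e radialM subrr divff ?gt_eqF // radial0.
move: h1; rewrite le_eqVlt => /orP[/eqP //|h1]; exfalso.
have sp : 0 < sin (pi * mod1 (t - s)) by apply: sin_pi_gt0; rewrite h1.
move: h => [+ _]; rewrite mul1r.
have -> : 2 * pi * mod1 (t - s) = pi * mod1 (t - s) + pi * mod1 (t - s) by ring.
rewrite cosD => c1; have := cos2Dsin2 (pi * mod1 (t - s)).
move: c1 sp; move: (cos _) (sin _) => a b; rewrite !expr2; nra.
Qed.

Lemma antipoly0_radial t r :
  antipoly d (0 : Cplx R) (radial t r) = radial (- (d%:R * t)) (r ^+ d).
Proof. by rewrite antipoly0E radial_conj radialX mulrN. Qed.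

Lemma iter_model_radial n t r :
  iter n (antipoly d (0 : Cplx R)) (radial t r) = radial ((- d%:R) ^+ n * t) (r ^+ (d ^ n)).
Proof.
elim: n => [|n IH]; first by rewrite expr0 mul1r expn0 expr1.
by rewrite iterS IH antipoly0_radial -exprM -expnSr exprS -mulrA mulNr.
Qed.
End Radial.

(** * Dynamical rays *)

Section UnitRoots.
Variable R : realType.

Lemma finite_set_roots (p : {poly R[i]}) : p != 0 -> finite_set [set x : R[i] | root p x].
Proof.
move=> p0; have [r pE] := closed_field_poly_normal p.
apply: (@sub_finite_set _ _ [set` r]); last exact: finite_seq.
move=> x /=; rewrite pE rootZ ?lead_coef_eq0 //.
by rewrite root_prod_XsubC.
Qed.

Lemma countable_Re_unity_roots :
  countable [set complex.Re z | z in \bigcup_k [set z : R[i] | z ^+ k.+1 = 1]].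
Proof.
apply: sub_countable (card_image_le _ _) _.
apply: bigcup_countable => // k _; apply: finite_set_countable.
have p0 : ('X^(k.+1) - 1 : {poly R[i]}) != 0 by rewrite -size_poly_gt0 size_XnsubC.
have fin := finite_set_roots p0; apply: sub_finite_set fin.
by move=> x /= xk; rewrite rootE !hornerE xk subrr.
Qed.

(* Intermediate value theorem: only countably many values are available. *)
Lemma Re_unity_root_constant (v : R -> R[i]) (a b : R) : a <= b ->
  {within `[a, b], continuous (fun x => complex.Re (v x))} ->
  (forall x, a <= x <= b -> exists k, v x ^+ k.+1 = 1) ->
  v b = 1 -> v a = 1.
Proof.
move=> ab cv hv vb; apply/eqP; apply: contrapT => /negP va.
have m1 x : a <= x <= b -> modulus (v x : R[i]) = 1.
  move=> /hv[k vk]; apply/eqP; rewrite -(@eqrXn2 _ k.+1) ?modulus_ge0 ?ler01 //.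
  by rewrite -modulusX vk modulus1 expr1n.
have aab : a <= a <= b by rewrite lexx.
have va1 : complex.Re (v a) < 1.
  have := modulus_Re (v a); rewrite (m1 _ aab) ler_norml => /andP[_].
  rewrite le_eqVlt => /orP[/eqP e|//]; exfalso.
  have := m1 _ aab; move: e va; rewrite modulusE; case: (v a) => x y /= -> va h.
  have : Num.sqrt (1 ^+ 2 + y ^+ 2) ^+ 2 = 1 by rewrite h expr1n.
  rewrite sqr_sqrtr ?addr_ge0 ?sqr_ge0 // expr1n => h2.
  have /eqP : y ^+ 2 = 0 by move: h2; move: (y ^+ 2) => t; clear; lra.
  rewrite sqrf_eq0 => /eqP y0.
  by move: va; rewrite y0 eqxx.
have sub : `[complex.Re (v a), 1]%classic `<=`
    [set complex.Re z | z in \bigcup_k [set z : R[i] | z ^+ k.+1 = 1]].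
  move=> y; rewrite /= in_itv /= => /andP[y1 y2].
  have [|x xab <-] := @IVT R (fun x => complex.Re (v x)) a b y ab cv.
    by rewrite vb /= ge_min y1 le_max y2 orbT.
  move: xab; rewrite in_itv /= => xab.
  have [k hk] := hv _ xab.
  by exists (v x) => //; exists k.
(* The interval from [complex.Re (v a)] to 1 would be countable, hence null, although it has
   positive length. *)
have := countable_lebesgue_measure0 (sub_countable (subset_card_le sub) countable_Re_unity_roots).
rewrite lebesgue_measure_itv /= lte_fin va1 => /eqP.
by rewrite -EFinB eqe subr_eq0 eq_sym lt_eqF.
Qed.
End UnitRoots.

(** * Injectivity of iterates away from precritical points *)

Section LocalInjectivity.
Variables (R : realType) (d : nat) (c : Cplx R).
Hypothesis d1 : (1 < d)%N.
Let f := antipoly d c.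

(** Points with the same image differ by a d-th root of unity; near w != 0 their quotient is close
    to 1, where 1 is the only such root. *)
Lemma antipoly_locally_injective (w : Cplx R) : w != 0 -> exists2 e, 0 < e &
  forall u v, modulus (w - u) < e -> modulus (w - v) < e -> f u = f v -> u = v.
Proof.
move=> w0; have [e e0 he] := expr_near_one R d1.
have mw : 0 < modulus w by rewrite modulus_gt0.
pose e1 := Num.min 1 e / 4 * modulus w.
have me0 : 0 < Num.min 1 e by rewrite lt_min ltr01.
have e10 : 0 < e1 by rewrite mulr_gt0 // divr_gt0.
exists e1 => // u v wu wv fuv.
have e14 : e1 <= modulus w / 4.
  by rewrite /e1 mulrAC ler_pM2r ?invr_gt0 // ler_piMl ?ge_min ?lexx // ltW.
have mv : 3 / 4 * modulus w < modulus v.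
  have := modulus_sub w (w - v); rewrite subKr.
  by move: wv e14; clear; lra.
have mv0 : 0 < modulus v by rewrite (lt_trans _ mv) // mulr_gt0 // divr_gt0.
have v0 : (v : R[i]) != 0 by rewrite -(modulus_gt0 v).
pose q := (u : R[i]) / (v : R[i]).
have qd : q ^+ d = 1.
  move: fuv; rewrite /f /antipoly => /addIr /(congr1 Num.conj).
  rewrite !rmorphXn /= !conjCK => uv.
  by rewrite /q expr_div_n uv divff // expf_neq0.
have hq : modulus (q - 1 : R[i]) < e.
  have -> : q - 1 = ((u : R[i]) - (v : R[i])) / (v : R[i]) by rewrite /q mulrBl divff.
  rewrite modulusM modulusV ltr_pdivrMr //.
  have : modulus ((u : R[i]) - (v : R[i]) : R[i]) <= modulus (w - v) + modulus (w - u).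
    have E : u - v = (w - v) - (w - u) by rewrite opprB [RHS]addrC addrA subrK.
    by have := modulusB (w - v) (w - u); rewrite -E.
  have e1e : e1 <= (e * modulus w) / 4.
    rewrite mulrAC.
    by rewrite /e1 ler_pM2r // ler_pM2r ?invr_gt0 // ge_min lexx orbT.
  have : 3 / 4 * (e * modulus w) < e * modulus v by rewrite mulrCA ltr_pM2l.
  have : 0 < e * modulus w by rewrite mulr_gt0.
  by move: wu wv e1e; move: (e * modulus v) (e * modulus w) => a b; clear; lra.
have := he _ hq; rewrite qd subrr modulus0 pmulr_rle0 ?divr_gt0 // => hq0.
have : modulus (q - 1 : R[i]) == 0 by rewrite eq_le hq0 modulus_ge0.
by rewrite (modulus_eq0 (q - 1 : R[i])) subr_eq0 => /eqP /divr1_eq.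
Qed.

Lemma iter_locally_injective n (w : Cplx R) : (forall i, iter i f w <> 0) ->
  exists2 e, 0 < e & forall u v, modulus (w - u) < e -> modulus (w - v) < e ->
    iter n f u = iter n f v -> u = v.
Proof.
elim: n w => [|n IH] w hw; first by exists 1.
have [|e e0 he] := IH (f w); first by move=> i; rewrite -iterSr; exact: hw.
have [|e' e'0 he'] := @antipoly_locally_injective w; first by apply/eqP; exact: (hw 0%N).
have /continuous_CP/(_ e e0)[del del0 hd] := @continuous_antipoly R d c w.
exists (Num.min e' del); first by rewrite lt_min e'0.
move=> u v; rewrite !lt_min => /andP[u1 u2] /andP[v1 v2]; rewrite !iterSr => fuv.
by apply: he' => //; apply: he => //; apply: hd.
Qed.
End LocalInjectivity.

(** * Potential and angle along a single ray *)

Section Ray.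
Variables (R : realType) (d : nat) (c : Cplx R).
Hypothesis d1 : (1 < d)%N.
Let f := antipoly d c.
Let g := antipoly d (0 : Cplx R).
Variables (rho : R) (phi : Cplx R -> Cplx R) (t : R) (gamma : R -> Cplx R).
Hypotheses (bo : is_boettcher d c rho phi) (ray : is_full_ray d c rho phi t gamma).
Implicit Types r s : R.

Lemma expn_pos n : (0 < d ^ n)%N.
Proof. by rewrite expn_gt0 (ltnW d1). Qed.

Lemma ray_deep r : 1 < r -> exists n0, forall n, (n0 <= n)%N ->
  rho < modulus (iter n f (gamma r)) /\
  phi (iter n f (gamma r)) = iter n g (radial t r).
Proof.
move=> /(ray_pullback ray)[n0 [h1 h2]]; exists n0 => n hn.
rewrite -(subnK hn) !iterD; split; first exact: (stable_iter bo).
by rewrite (boettcher_conj_iter bo) // h2.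
Qed.

(** Positive roots of moduli are unique, so the modulus can be read back from a deep level to any
    level at which the orbit is already in the domain of [phi]. *)
Lemma ray_potential r k : 1 < r -> rho < modulus (iter k f (gamma r)) ->
  modulus (phi (iter k f (gamma r))) = r ^+ (d ^ k).
Proof.
move=> r1 hk; have [n0 /(_ (n0 + k)%N)] := ray_deep r1.
rewrite leq_addr => /(_ isT)[_]; rewrite iterD (boettcher_conj_iter bo) //.
move=> /(congr1 (@modulus R)); rewrite !modulus_iter_model modulus_radial.
have r0 : 0 <= r by rewrite ltW // (lt_trans _ r1).
rewrite (ger0_norm r0) addnC expnD exprM => /eqP.
by rewrite eqrXn2 ?expn_pos ?modulus_ge0 ?exprn_ge0 // => /eqP.
Qed.

Lemma ray_escapes r : 1 < r -> forall M n, exists2 k, (n <= k)%N &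
  M < modulus (iter k f (gamma r)).
Proof.
move=> r1 M n; have [n0 /(_ (n0 + n)%N)] := ray_deep r1.
rewrite leq_addr => /(_ isT)[h _].
have [j hj] := escape d1 bo h M; rewrite -/f -iterD in hj.
by exists (j + (n0 + n))%N => //; rewrite addnA leq_addl.
Qed.

(** If the n-th iterate were still in the disc, the orbit would leave it later, at a point whose
    potential is bounded by [exit_bound] but is at least r^(d^n). The bound is uniform in r, unlike
    the level in [ray_pullback]. *)
Lemma ray_large M : exists B, forall r n, 1 < r -> B < r ^+ (d ^ n) ->
  M < modulus (iter n f (gamma r)).
Proof.
have [M0 rM0 hM0] := exit_bound bo.
pose M' := Num.max M M0.
have [|B B1 hB] := hM0 M'; first by rewrite le_max lexx orbT.
have MM' : M <= M' by rewrite le_max lexx.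
have rM' : rho <= M' by rewrite le_max rM0 orbT.
clearbody M'.
exists B => r n r1 hr; apply: (le_lt_trans MM'); rewrite ltNge; apply/negP => hle.
have ex : exists j, M' < modulus (iter j f (iter n f (gamma r))).
  have [k nk hk] := ray_escapes r1 M' n.
  by exists (k - n)%N; rewrite -iterD subnK.
have [j h1 h2] := first_exit ex hle.
have := hB _ h2; rewrite -/f -iterS => /(_ h1).
rewrite -iterD ray_potential //; last by rewrite iterD (le_lt_trans rM').
rewrite leNgt => /negP; apply; apply: lt_le_trans hr _.
by rewrite ler_weXn2l ?(ltW r1) // leq_pexp2l ?(ltnW d1) // leq_addl.
Qed.

Lemma boettcher_continuous z : rho < modulus z -> {for z, continuous phi}.
Proof.
move=> hz; have := boettcher_holo bo hz.
by move=> /derivable1_diffP; exact: differentiable_continuous.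
Qed.

(* The point of the model plane is only known up to a root of unity of
   unbounded order, which is constant along the ray by continuity. *)
Lemma ray_phi : exists B, forall r n, 1 < r -> B < r ^+ (d ^ n) ->
  rho < modulus (iter n f (gamma r)) /\
  phi (iter n f (gamma r)) = iter n g (radial t r).
Proof.
have [B hB] := ray_large rho; exists B => r n r1 hr.
split; first exact: hB.
pose D := (d ^ n)%N; pose th := (- d%:R) ^+ n * t.
(* The quotient of the actual value by the expected one: a root of unity for each [s], equal to 1
   near infinity. *)
pose v (s : R) : R[i] := (phi (iter n f (gamma s)) : R[i]) * (radial (- th) (s ^- D) : R[i]).
have rs_ge s : r <= s -> [/\ 1 < s, B < s ^+ D & 0 < s ^+ D].
  move=> rs; have s1 := lt_le_trans r1 rs.
  have s0 : 0 < s by rewrite (lt_trans _ s1).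
  split => //; last by rewrite exprn_gt0.
  apply: lt_le_trans hr _; rewrite lerXn2r // nnegrE ltW //.
  by rewrite (lt_trans _ r1).
have [r0 hr0] := ray_infty ray.
pose b := Num.max r r0 + 1.
have rb : r <= b by rewrite /b (le_trans (_ : r <= Num.max r r0)) ?lerDl // le_max lexx.
have r0b : r0 < b by rewrite /b (le_lt_trans (_ : r0 <= Num.max r r0)) ?ltrDl // le_max lexx orbT.
clearbody b.
have vE s : r <= s -> phi (iter n f (gamma s)) = iter n g (radial t s) <-> v s = 1.
  move=> /rs_ge[s1 _ sD]; rewrite iter_model_radial -/th -/D /v.
  have sD0 : s ^+ D != 0 by rewrite gt_eqF.
  split=> [->|h]; first by rewrite radialM subrr divff // radial0.
  have : (phi (iter n f (gamma s)) : R[i]) * (radial (- th) (s ^- D) : R[i]) *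
         (radial th (s ^+ D) : R[i]) = (radial th (s ^+ D) : R[i]) by rewrite h mul1r.
  by rewrite -mulrA radialM addNr mulVf // radial0 mulr1.
apply/(vE r (lexx r)).
apply: (Re_unity_root_constant rb).
- apply: continuous_in_subspaceT => s; rewrite inE /= in_itv /= => /andP[/rs_ge[s1 sB sD] _].
  have cphi : {for s, continuous (fun s => phi (iter n f (gamma s)))}.
    apply: (continuous_comp (f := fun s => iter n f (gamma s))).
      apply: (continuous_comp (f := gamma)); first exact: (ray_cont ray).
      exact: continuous_iter_antipoly.
    by apply: boettcher_continuous; exact: hB.
  have cr := continuous_Re cphi; have ci := continuous_Im cphi.
  have cp : {for s, continuous (fun s : R => s ^- D)}.
    apply: (continuous_comp (f := fun s : R => s ^+ D)); first exact: exprn_continuous.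
    by apply: inv_continuous; rewrite gt_eqF.
  have -> : (fun x => complex.Re (v x)) = (fun x : R =>
     complex.Re (phi (iter n f (gamma x))) * (x ^- D * cos (2 * pi * - th)) -
     complex.Im (phi (iter n f (gamma x))) * (x ^- D * sin (2 * pi * - th))).
    by apply/funext => x; rewrite /v /radial; case: (phi _).
  apply: cvgB; apply: cvgM => //; apply: cvgM => //; exact: cvg_cst.
- move=> s /andP[rs _]; have [s1 sB sD] := rs_ge _ rs.
  have [n0 hn0] := ray_deep s1.
  have [_] := hn0 (n0 + n)%N (leq_addr _ _); rewrite !iterD.
  rewrite (boettcher_conj_iter bo) ?hB // (iter_model_radial d n) -/th -/D => e.
  exists (d ^ n0).-1; rewrite prednK ?expn_pos //.
  have [e' e2] : exists e' : bool, forall w : R[i],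
      iter n0 g w = (if e' then w else w^*) ^+ (d ^ n0).
    elim: n0 {hn0 e} => [|m [e' IH]]; first by exists true => w; rewrite expr1.
    exists (~~ e') => w; rewrite iterS IH /g antipoly0E rmorphXn -exprM -expnSr.
    by case: e' {IH} => /=; rewrite ?conjCK.
  move: e; rewrite !e2 /v exprMn; set W := phi _; set X := radial th _ => e.
  have -> : (W : R[i]) ^+ (d ^ n0) = (X : R[i]) ^+ (d ^ n0).
    by case: e' e {e2} => // /(congr1 Num.conj); rewrite !rmorphXn /= !conjCK.
  by rewrite -exprMn /X radialM subrr divff ?gt_eqF // radial0 expr1n.
- by apply/(vE b rb); have [h1 <-] := hr0 _ r0b; rewrite (boettcher_conj_iter bo).
Qed.
End Ray.

(** * Comparison of two rays *)

Section TwoRays.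
Variables (R : realType) (d : nat) (c : Cplx R).
Hypothesis d1 : (1 < d)%N.
Let f := antipoly d c.
Let g := antipoly d (0 : Cplx R).
Variables (rho : R) (phi : Cplx R -> Cplx R) (t : R) (gamma : R -> Cplx R).
Hypotheses (bo : is_boettcher d c rho phi) (ray : is_full_ray d c rho phi t gamma).
Variables (rho' : R) (phi' : Cplx R -> Cplx R) (t' : R) (gamma' : R -> Cplx R).
Hypotheses (bo' : is_boettcher d c rho' phi') (ray' : is_full_ray d c rho' phi' t' gamma').
Implicit Types r s : R.

Lemma expr_expn_gt (x : R) : 1 < x -> forall B, exists n0, forall n, (n0 <= n)%N ->
  B < x ^+ (d ^ n).
Proof.
move=> x1 B; have [k hk] : exists k : nat, B < k%:R * (x - 1).
  exists (Num.bound (B / (x - 1))); rewrite -ltr_pdivrMr ?subr_gt0 //.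
  have [M0|M0] := leP 0 (B / (x - 1)); first exact: archi_boundP.
  by apply: lt_le_trans M0 _; rewrite ler0n.
exists k => n kn; apply: lt_le_trans hk _.
have bern m : m%:R * (x - 1) + 1 <= x ^+ m.
  elim: m => [|m IH]; first by rewrite mul0r add0r.
  rewrite exprS -natr1; have : 0 <= m%:R * (x - 1) by rewrite mulr_ge0 // subr_ge0 ltW.
  have : 0 <= (x - 1) * (x ^+ m - 1) by rewrite mulr_ge0 // subr_ge0 ?exprn_ege1 // ltW.
  by move: IH; move: (x ^+ m) (m%:R) => a b; rewrite ?mulrBr ?mulrBl; lra.
apply: le_trans (_ : x ^+ k <= _); last first.
  rewrite ler_weXn2l ?(ltW x1) //; apply: leq_trans kn _.
  exact: ltnW (ltn_expl _ d1).
by apply: le_trans (bern k); rewrite lerDl.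
Qed.

(** The level [N] serves all potentials beyond [s0] at once, which allows one local inverse of the
    N-th iterate to be used on a neighbourhood of a common point. *)
Lemma rays_agree_deep n1 (k : int) : (- d%:R) ^+ n1 * t = (- d%:R) ^+ n1 * t' + k%:~R ->
  forall s0, 1 < s0 -> exists N, forall s, s0 < s ->
    iter N f (gamma s) = iter N f (gamma' s).
Proof.
move=> tt' s0 s01.
have [M [rM rM' hM]] := boettcher_unique d1 bo bo'.
have [B1 hB1] := ray_phi d1 bo ray; have [B2 hB2] := ray_phi d1 bo' ray'.
have [B3 hB3] := ray_large d1 bo ray M; have [B4 hB4] := ray_large d1 bo' ray' M.
have [m1 hm1] := expr_expn_gt s01 B1; have [m2 hm2] := expr_expn_gt s01 B2.
have [m3 hm3] := expr_expn_gt s01 B3; have [m4 hm4] := expr_expn_gt s01 B4.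
pose N := (n1 + (m1 + (m2 + (m3 + m4))))%N.
exists N => s hs; have s1 : 1 < s := lt_trans s01 hs.
have le_s : s0 ^+ (d ^ N) <= s ^+ (d ^ N).
  have p0 : 0 <= s0 by apply: ltW; exact: lt_trans s01.
  have p : 0 <= s by apply: ltW; exact: lt_trans s1.
  by rewrite lerXn2r ?nnegrE // ltW.
have [h1 e1] : rho < modulus (iter N f (gamma s)) /\
    phi (iter N f (gamma s)) = iter N g (radial t s).
  by apply: hB1 => //; apply: lt_le_trans le_s; apply: hm1; rewrite /N; lia.
have [h2 e2] : rho' < modulus (iter N f (gamma' s)) /\
    phi' (iter N f (gamma' s)) = iter N g (radial t' s).
  by apply: hB2 => //; apply: lt_le_trans le_s; apply: hm2; rewrite /N; lia.
have h3 : M < modulus (iter N f (gamma s)).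
  by apply: hB3 => //; apply: lt_le_trans le_s; apply: hm3; rewrite /N; lia.
have h4 : M < modulus (iter N f (gamma' s)).
  by apply: hB4 => //; apply: lt_le_trans le_s; apply: hm4; rewrite /N; lia.
apply: (boettcher_inj bo'); first exact: le_lt_trans h3.
  exact: h2.
rewrite -[LHS]hM // e1 e2 !iter_model_radial.
have [m Nm] : exists m, N = (m + n1)%N by exists (N - n1)%N; rewrite subnK // leq_addr.
have -> : (- d%:R) ^+ N * t = (- d%:R) ^+ N * t' + ((- d%:Z) ^+ m * k)%:~R.
  rewrite Nm exprD -!mulrA tt' mulrDr intrM rmorphXn /= mulrNz.
  by [].
exact: radialDz.
Qed.

(** The set of parameters where the rays coincide is closed by continuity, and open because some
    iterate identifies the rays nearby and is injective off the precritical points, which rays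
    avoid. Connectedness of ]1, +oo[ concludes. *)
Lemma rays_eq_of_meet n1 (k : int) r :
  (- d%:R) ^+ n1 * t = (- d%:R) ^+ n1 * t' + k%:~R ->
  1 < r -> gamma r = gamma' r -> forall s, 1 < s -> gamma s = gamma' s.
Proof.
move=> tt' r1 er.
pose E := [set s | 1 < s /\ gamma s = gamma' s].
pose A := [set s : R | 1 < s].
have EA : E `<=` A by move=> s [].
have conA : connected A.
  apply/connected_intervalP => x y /= x1 _ z /andP[xz _]; exact: lt_le_trans x1 xz.
suff : E = A by move=> EAe s s1; have : A s by []; rewrite -EAe => -[].
apply: conA; first by exists r.
- exists E; last by rewrite setIC; apply/esym/setIidl.
  rewrite openE => s [s1 es].
  pose s0 := (1 + s) / 2.
  have s01 : 1 < s0 by rewrite /s0; move: s1; lra.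
  have s0s : s0 < s by rewrite /s0; move: s1; lra.
  have [N hN] := rays_agree_deep tt' s01.
  have [e e0 inj] := @iter_locally_injective R d c d1 N (gamma s)
    (fun i => @ray_crit _ _ _ _ _ _ _ ray s i s1).
  have /continuous_modulusP/(_ e e0) c1 := ray_cont ray s1.
  have /continuous_modulusP/(_ e e0) c2 := ray_cont ray' s1.
  have n0 : \forall u \near s, s0 < u by exact: lt_nbhsr.
  near=> u; split.
    by apply: lt_trans s01 _; near: u.
  apply: inj; first by near: u.
    by rewrite es; near: u.
  by apply: hN; near: u.
- exists (closure E); first exact: closed_closure.
  apply/seteqP; split => s; first by move=> sE; split; [exact: EA | exact: subset_closure].
  move=> [s1 cs]; split => //; apply/eqP; rewrite -subr_eq0 -modulus_eq0.
  rewrite eq_le modulus_ge0 andbT leNgt; apply/negP => h0.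
  set e := modulus _ in h0.
  have e2 : 0 < e / 2 by rewrite divr_gt0.
  have /continuous_modulusP/(_ _ e2) c1 := ray_cont ray s1.
  have /continuous_modulusP/(_ _ e2) c2 := ray_cont ray' s1.
  have /cs[u [[u1 eu]]] : \forall u \near s,
      modulus (gamma s - gamma u) < e / 2 /\ modulus (gamma' s - gamma' u) < e / 2.
    by apply: filterS2 c1 c2 => u.
  rewrite eu => -[h1 h2].
  have E1 : gamma s - gamma' s = (gamma s - gamma' u) - (gamma' s - gamma' u).
    by rewrite opprB addrA subrK.
  have := modulusB (gamma s - gamma' u) (gamma' s - gamma' u); rewrite -E1 -/e.
  by move: h1 h2; lra.
Unshelve. all: by end_near. Qed.

Lemma radial_eq_of_rays_eq : (forall s, 1 < s -> gamma s = gamma' s) ->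
  exists k : int, t = t' + k%:~R.
Proof.
move=> e; have [M [rM rM' hM]] := boettcher_unique d1 bo bo'.
have [B3 hB3] := ray_large d1 bo ray M.
have [r0 h0] := ray_infty ray; have [r0' h0'] := ray_infty ray'.
have [b [b1 b2 b3 b4]] : exists b, [/\ 1 < b, B3 < b, r0 < b & r0' < b].
  exists (Num.max (Num.max 1 B3) (Num.max r0 r0') + 1).
  by split; rewrite ltr_pwDr // !le_max lexx ?orbT.
have [_ h] := h0 _ b3; have [_ h'] := h0' _ b4.
apply: (@radial_inj _ _ _ b); first exact: lt_trans b1.
rewrite -h -h' -(e _ b1) hM //.
by apply: (hB3 b 0%N) => //; rewrite expr1.
Qed.

(** At a common point the potentials agree, but the angles only after multiplication by (-d)^n. This
    suffices for the rays to coincide everywhere, and near infinity the angles themselves can be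
    compared. *)
Lemma rays_meet r r' : 1 < r -> 1 < r' -> gamma r = gamma' r' ->
  exists k : int, t = t' + k%:~R.
Proof.
move=> r1 r1' e; have [M [rM rM' hM]] := boettcher_unique d1 bo bo'.
have [n1 h1] := ray_deep bo ray r1; have [n2 h2] := ray_deep bo' ray' r1'.
have [B3 hB3] := ray_large d1 bo ray M; have [m3 hm3] := expr_expn_gt r1 B3.
pose n := (n1 + (n2 + m3))%N.
have [_ e1] : rho < modulus (iter n f (gamma r)) /\
  phi (iter n f (gamma r)) = iter n g (radial t r) by apply: h1; rewrite /n; lia.
have [_ e2] : rho' < modulus (iter n f (gamma' r')) /\
  phi' (iter n f (gamma' r')) = iter n g (radial t' r') by apply: h2; rewrite /n; lia.
have hL : M < modulus (iter n f (gamma r)).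
  by apply: hB3 => //; apply: hm3; rewrite /n; lia.
move: e1 e2; rewrite -e -hM // => -> e3.
have r0 : 0 < r by rewrite (lt_trans _ r1).
have r0' : 0 < r' by rewrite (lt_trans _ r1').
have rr' : r = r'.
  have := congr1 (@modulus R) e3; rewrite !modulus_iter_model !modulus_radial.
  rewrite !gtr0_norm // => /eqP; rewrite eqrXn2 ?(expn_pos d1) ?ltW // => /eqP //.
move: e3; rewrite -rr' !iter_model_radial => /radial_inj[|k hk]; first by rewrite exprn_gt0.
by apply: radial_eq_of_rays_eq; apply: (rays_eq_of_meet hk r1); rewrite rr' in e *.
Qed.

Lemma rays_eq_of_angle (k : int) : t = t' + k%:~R -> forall s, 1 < s -> gamma s = gamma' s.
Proof.
move=> tk; have [M [rM rM' hM]] := boettcher_unique d1 bo bo'.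
have [B3 hB3] := ray_large d1 bo ray M; have [B4 hB4] := ray_large d1 bo' ray' M.
have [r0 h0] := ray_infty ray; have [r0' h0'] := ray_infty ray'.
have [b [[b1 b2 b3] b4 b5]] : exists b, [/\ [/\ 1 < b, B3 < b & r0 < b], r0' < b & B4 < b].
  exists (Num.max (Num.max 1 B3) (Num.max (Num.max r0 r0') B4) + 1).
  by do ?split; rewrite ltr_pwDr // !le_max lexx ?orbT.
have [hr h] := h0 _ b3; have [hr' h'] := h0' _ b4.
have h3 : M < modulus (gamma b) by apply: (hB3 b 0%N) => //; rewrite expr1.
apply: (@rays_eq_of_meet 0%N k b) => //; first by rewrite !expr0 !mul1r.
apply: (boettcher_inj bo') => //; first exact: le_lt_trans h3.
by rewrite -[LHS]hM // h h' tk radialDz.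
Qed.
End TwoRays.

(** * Rays completed by their landing points *)

Section LandingCurve.
Variables (R : realType) (d : nat) (c : Cplx R).
Hypothesis d1 : (1 < d)%N.
Let f := antipoly d c.
Variables (rho : R) (phi : Cplx R -> Cplx R) (t : R) (gamma : R -> Cplx R).
Hypotheses (bo : is_boettcher d c rho phi) (ray : is_full_ray d c rho phi t gamma).
Variable z : Cplx R.
Hypothesis land : gamma r @[r --> 1^'+] --> z.
Implicit Types r s e x : R.

Lemma ray_near_radial e : 0 < e -> exists2 r1, 1 <= r1 &
  forall r, r1 < r -> modulus (gamma r - radial t r) <= e * r.
Proof.
move=> e0; pose e1 := Num.min (e / 2) (1 / 2).
have e10 : 0 < e1 by rewrite lt_min !divr_gt0.
have e1e : e1 <= e / 2 by rewrite ge_min lexx.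
have e12 : e1 <= 1 / 2 by rewrite ge_min lexx orbT.
have [M rM hM] := boettcher_normal bo e10.
have [B hB] := ray_large d1 bo ray M; have [r0 h0] := ray_infty ray.
exists (Num.max 1 (Num.max B r0)); first by rewrite le_max lexx.
move=> r; rewrite !gt_max => /and3P[r1 rB rr0].
have [hr hp] := h0 _ rr0.
have hL : M < modulus (gamma r) by apply: (hB r 0%N) => //; rewrite expr1.
have := hM _ hL; rewrite hp modulusBC => h.
have rp : 0 < r by apply: lt_trans r1.
have h1 : modulus (gamma r) <= 2 * r.
  have := modulus_sub (gamma r) (radial t r); rewrite modulus_radial gtr0_norm //.
  have : e1 * modulus (gamma r) <= 1 / 2 * modulus (gamma r).
    by rewrite ler_wpM2r // modulus_ge0.
  by move: h; lra.
apply: (le_trans h); apply: le_trans (_ : e / 2 * (2 * r) <= _); last by lra.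
by apply: ler_pM => //; [exact: ltW | exact: modulus_ge0].
Qed.

(* The ray reparametrised by x = r - 1 and completed by its landing point. *)
Definition landing_curve x : Cplx R := if x <= 0 then z else gamma (1 + x).

Lemma landing_curve_continuous x : {for x, continuous landing_curve}.
Proof.
apply/continuous_modulusP => e e0; rewrite /landing_curve.
have cs : {for x, continuous (fun u : R => 1 + u)}.
  by apply: cvgD; [exact: cvg_cst | exact: cvg_id].
have [x0|x0|x0] := ltgtP x 0.
- have n0 : \forall u \near x, u < 0 by exact: lt_nbhsl.
  by apply: filterS n0 => u u0; rewrite ltW // subrr modulus0.
- have n0 : \forall u \near x, 0 < u by exact: lt_nbhsr.
  have x1 : 1 < 1 + x by rewrite ltrDl.
  have /continuous_modulusP/(_ e e0) := ray_cont ray x1.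
  move=> /cs; apply: filterS2 n0 => u u0 /= h.
  by rewrite leNgt u0.
- have /cvg_modulusP/(_ e e0) := land; rewrite near_withinE => h.
  have {}h : \forall r \near 1 + x, 1 < r -> modulus (z - gamma r) < e by rewrite x0 addr0.
  have h2 : \forall u \near x, 1 < 1 + u -> modulus (z - gamma (1 + u)) < e := cs _ h.
  apply: filterS h2 => u hu.
  by case: (leP u 0) => u0; [rewrite subrr modulus0 | apply: hu; rewrite ltrDl].
Qed.

Definition plane_coordinates (w : Cplx R) : R * R := (complex.Re w, complex.Im w).

Lemma landing_curve_continuous2 : continuous2 (fun x => plane_coordinates (landing_curve x)).
Proof.
split => x /=.
  exact: continuous_Re (@landing_curve_continuous x).
exact: continuous_Im (@landing_curve_continuous x).
Qed.

Lemma landing_curve_asymptotic :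
  asymptotic_ray (fun x => plane_coordinates (landing_curve x)) (unit_vector t).
Proof.
move=> e e0; have [r1 r11 hr1] := ray_near_radial e0.
have r0 : 0 <= r1 by apply: le_trans r11.
have bnd (h : R -> R) : continuous h -> exists2 C, 0 <= C & forall x, 0 <= x <= r1 -> `|h x| <= C.
  move=> ch; have ca : continuous (fun x : R => `|h x|).
    by move=> x; apply: (continuous_comp (f := h)); [exact: ch | exact: norm_continuous].
  have [u _ hu] := EVT_max r0 (continuous_subspaceT ca).
  by exists `|h u| => // x hx; apply: hu; rewrite in_itv.
have [c1 c2] := landing_curve_continuous2.
have lin (a : R) : continuous (fun x : R => x * a).
  by move=> x; apply: cvgM; [exact: cvg_id | exact: cvg_cst].
have [|C1 C10 h1] := bnd (fun x => (plane_coordinates (landing_curve x)).1 - x * (unit_vector t).1).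
  by move=> x; apply: cvgB; [exact: c1 | exact: lin].
have [|C2 C20 h2] := bnd (fun x => (plane_coordinates (landing_curve x)).2 - x * (unit_vector t).2).
  by move=> x; apply: cvgB; [exact: c2 | exact: lin].
exists (C1 + C2 + e + 1); first by rewrite !addr_ge0 // ltW.
move=> x x0; have [xr|xr] := leP x r1.
  have hx : 0 <= x <= r1 by rewrite x0.
  have ex : 0 <= e * x by rewrite mulr_ge0 // ltW.
  by split; [apply: le_trans (h1 _ hx) _ | apply: le_trans (h2 _ hx) _]; move: ex e0; lra.
have xp : 0 < x by apply: le_lt_trans xr.
have lE : landing_curve x = gamma (1 + x) by rewrite /landing_curve leNgt xp.
have hg := hr1 (1 + x) (lt_trans xr (ltr_pwDl ltr01 (lexx x))).
have key : modulus (gamma (1 + x) - radial t x) <= e * x + (e + 1).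
  have -> : gamma (1 + x) - radial t x = (gamma (1 + x) - radial t (1 + x)) + radial t 1.
    have -> : radial t (1 + x) = radial t 1 + radial t x.
      by rewrite /radial; apply/eqP; rewrite eq_complex /=; apply/andP; split; apply/eqP; ring.
    by rewrite opprD addrA addrAC subrK.
  apply: le_trans (modulusD _ _) _; rewrite modulus_radial normr1.
  by move: hg; rewrite mulrDr mulr1; lra.
split; (apply: le_trans (_ : e * x + (e + 1) <= _); last by move: C10 C20; lra);
  apply: le_trans key; rewrite lE.
  by apply: le_trans (modulus_Re _); rewrite /radial; case: (gamma _).
by apply: le_trans (modulus_Im _); rewrite /radial; case: (gamma _).
Qed.

Lemma ray_not_filled r : 1 < r -> ~ filled_julia d c (gamma r).
Proof.
move=> r1 [M hM]; have [k _] := ray_escapes d1 bo ray r1 M 0.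
by rewrite ltNge hM.
Qed.
End LandingCurve.

Lemma plane_coordinates_inj (R : realType) : injective (@plane_coordinates R).
Proof. by move=> [a b] [a' b'] [-> ->]. Qed.

(** A curve ending at z cannot meet one ending at w: points of rays escape while z and w have
    bounded orbits, z and w differ, and rays with distinct angles modulo 1 are disjoint. Alternating
    directions would force a meeting. *)
Theorem landing_rays_unlinked (R : realType) (d : nat) (c z w : Cplx R) (t1 s1 t2 s2 : R) :
  (1 < d)%N -> filled_julia d c z -> filled_julia d c w -> z <> w ->
  ray_lands d c t1 z -> ray_lands d c t2 z ->
  ray_lands d c s1 w -> ray_lands d c s2 w ->
  t1 < s1 -> s1 < t2 -> t2 < s2 -> s2 < t1 + 1 -> False.
Proof.
move=> d1 Kz Kw zw [_ [r1 [p1 [g1 [bo1 ray1 l1]]]]] [_ [r2 [p2 [g2 [bo2 ray2 l2]]]]].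
move=> [_ [r3 [p3 [g3 [bo3 ray3 l3]]]]] [_ [r4 [p4 [g4 [bo4 ray4 l4]]]]] h1 h2 h3 h4.
have meet rh ph t g rh' ph' s g' : is_boettcher d c rh ph -> is_full_ray d c rh ph t g ->
    is_boettcher d c rh' ph' -> is_full_ray d c rh' ph' s g' ->
    t < s < t + 1 \/ s < t < s + 1 -> forall x y, 0 <= x -> 0 <= y ->
    plane_coordinates (landing_curve g z x) <> plane_coordinates (landing_curve g' w y).
  move=> bo ray bo' ray' hts x y x0 y0 /plane_coordinates_inj; rewrite /landing_curve.
  case: leP => hx; case: leP => hy //.
  - by move=> e; apply: (@ray_not_filled _ _ _ d1 _ _ _ _ bo' ray' (1 + y)); rewrite ?ltrDl // -e.
  - by move=> e; apply: (@ray_not_filled _ _ _ d1 _ _ _ _ bo ray (1 + x)); rewrite ?ltrDl // e.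
  - move=> /(rays_meet d1 bo ray bo' ray'); rewrite !ltrDl => /(_ hx hy)[k hk].
    have [k0|k0|k0] := ltgtP k 0.
    + have : k%:~R <= (-1)%:~R :> R by rewrite ler_int; clear -k0; lia.
      by move: hts; rewrite hk intrN; clear=> -[] /andP[]; lra.
    + have : 1%:~R <= k%:~R :> R by rewrite ler_int; clear -k0; lia.
      by move: hts; rewrite hk; clear=> -[] /andP[]; lra.
    + by move: hts; rewrite hk k0; clear=> -[] /andP[]; lra.
have [||||||||x [y [x0 y0 H]]] := @alternating_rays_meet R
  (fun x => plane_coordinates (landing_curve g1 z x))
  (fun x => plane_coordinates (landing_curve g2 z x))
  (fun x => plane_coordinates (landing_curve g3 w x))
  (fun x => plane_coordinates (landing_curve g4 w x))
  (plane_coordinates z) (plane_coordinates w) t1 s1 t2 s2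
  (landing_curve_continuous2 ray1 l1) (landing_curve_continuous2 ray2 l2)
  (landing_curve_continuous2 ray3 l3) (landing_curve_continuous2 ray4 l4)
  h1 h2 h3 h4.
- exact: (landing_curve_asymptotic d1 bo1 ray1 l1).
- exact: (landing_curve_asymptotic d1 bo2 ray2 l2).
- exact: (landing_curve_asymptotic d1 bo3 ray3 l3).
- exact: (landing_curve_asymptotic d1 bo4 ray4 l4).
- by rewrite /landing_curve lexx.
- by rewrite /landing_curve lexx.
- by rewrite /landing_curve lexx.
- by rewrite /landing_curve lexx.
have o1 : t1 < s1 < t1 + 1 by rewrite h1 (lt_trans h2) // (lt_trans h3).
have o2 : t1 < s2 < t1 + 1 by rewrite h4 andbT (lt_trans h1) // (lt_trans h2).
have o3 : s1 < t2 < s1 + 1.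
  by rewrite h2 (lt_trans h3) // (lt_trans h4) // ltrD2r.
have o4 : t2 < s2 < t2 + 1.
  by rewrite h3 (lt_trans h4) // ltrD2r (lt_trans h1).
case: H.
- exact: (meet _ _ _ _ _ _ _ _ bo1 ray1 bo3 ray3 (or_introl o1) x y x0 y0).
- exact: (meet _ _ _ _ _ _ _ _ bo1 ray1 bo4 ray4 (or_introl o2) x y x0 y0).
- exact: (meet _ _ _ _ _ _ _ _ bo2 ray2 bo3 ray3 (or_intror o3) x y x0 y0).
- exact: (meet _ _ _ _ _ _ _ _ bo2 ray2 bo4 ray4 (or_introl o4) x y x0 y0).
Qed.

Lemma half_bound_absurd (R : realType) (x y q : R) : x < q / 2 -> y < q / 2 -> q <= x + y -> False.
Proof. lra. Qed.

(** * Images of rays under the map and under rotations *)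

Section Symmetries.
Variables (R : realType) (d : nat) (c : Cplx R).
Hypothesis d1 : (1 < d)%N.
Let f := antipoly d c.
Let g := antipoly d (0 : Cplx R).
Implicit Types (t r e : R) (z w : Cplx R).

Lemma ray_lands_shift t z (k : int) : ray_lands d c t z -> ray_lands d c (t + k%:~R) z.
Proof.
move=> [Jz [rho [phi [gamma [bo ray land]]]]]; split; first exact: Jz.
exists rho, phi, gamma; split; [exact: bo | | exact: land].
case: ray => rc [r0 ri] rp rcr; split; [exact: rc | | | exact: rcr].
  by exists r0 => r /ri; rewrite radialDz.
by move=> r /rp[n h]; exists n; rewrite radialDz.
Qed.

Lemma ray_lands_mod1 t z : ray_lands d c (mod1 t) z <-> ray_lands d c t z.
Proof.
have [k ->] := mod1E t; split; last exact: ray_lands_shift.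
by move=> /(ray_lands_shift (- k)); rewrite -addrA -intrD subrr addr0.
Qed.

Lemma ray_lands_unique t z w : ray_lands d c t z -> ray_lands d c t w -> z = w.
Proof.
move=> [_ [rh1 [p1 [g1 [bo1 ray1 l1]]]]] [_ [rh2 [p2 [g2 [bo2 ray2 l2]]]]].
have e : forall s, 1 < s -> g1 s = g2 s.
  by apply: (rays_eq_of_angle d1 bo1 ray1 bo2 ray2 (k := 0)); rewrite addr0.
apply/eqP; rewrite -subr_eq0 -modulus_eq0 eq_le modulus_ge0 andbT leNgt; apply/negP => h0.
set q := modulus _ in h0.
have q2 : 0 < q / 2 by rewrite divr_gt0.
have /cvg_modulusP/(_ _ q2) c1 := l1; have /cvg_modulusP/(_ _ q2) c2 := l2.
have n1 : \forall r \near (1 : R)^'+, 1 < r by exact: nbhs_right_gt.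
have [r [h1 [h2 r1]]] : exists r, modulus (z - g1 r) < q / 2 /\
    modulus (w - g2 r) < q / 2 /\ 1 < r.
  apply: (@filter_ex _ (1 : R)^'+ _).
  by apply: filterS3 c1 c2 n1 => r ? ? ?.
apply: half_bound_absurd h1 h2 _; rewrite -(e r r1).
by have := modulusB (z - g1 r) (w - g1 r); rewrite opprB addrA subrK.
Qed.

Lemma filled_julia_image z : filled_julia d c z <-> filled_julia d c (f z).
Proof.
split=> -[M hM]; first by exists M => n; rewrite -iterSr.
exists (Num.max M (modulus z)) => -[|n]; first by rewrite le_max lexx orbT.
by rewrite iterSr le_max hM.
Qed.

Lemma closure_image (A B : set (Cplx R)) (h : Cplx R -> Cplx R) z :
  {for z, continuous h} -> (forall w, A w -> B (h w)) -> closure A z -> closure B (h z).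
Proof.
move=> ch AB cz U /ch /cz[w [Aw Uw]]; exists (h w); split => //; exact: AB.
Qed.

Lemma julia_image_of (h : Cplx R -> Cplx R) z : {for z, continuous h} ->
  (forall w, filled_julia d c w <-> filled_julia d c (h w)) ->
  julia d c z -> julia d c (h z).
Proof.
move=> ch hK [k1 k2]; split.
  by apply: closure_image k1 => // w /hK.
apply: closure_image k2; first exact: ch.
by move=> w nK hw; apply: nK; apply/hK.
Qed.

Lemma julia_antipoly z : julia d c z -> julia d c (f z).
Proof.
apply: julia_image_of; first exact: continuous_antipoly.
exact: filled_julia_image.
Qed.

(** The map raises potentials to the power d, so the image ray, parametrised by its own potential r,
    is f of the old ray at the d-th root of r. *)
Definition real_root r : R := expR (ln r / d%:R).

Lemma real_rootK r : 0 < r -> real_root r ^+ d = r.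
Proof.
move=> r0; rewrite /real_root -expRM_natl mulrC divfK ?lnK //.
by rewrite pnatr_eq0 -lt0n ltnW.
Qed.

Lemma real_root_gt1 r : 1 < r -> 1 < real_root r.
Proof. by move=> r1; rewrite /real_root expR_gt1 divr_gt0 ?ln_gt0 // ltr0n ltnW. Qed.

Lemma continuous_real_root r : 0 < r -> {for r, continuous real_root}.
Proof.
move=> r0; apply: (continuous_comp (f := fun r => ln r / d%:R)).
  by apply: cvgM; [exact: continuous_ln | exact: cvg_cst].
exact: continuous_expR.
Qed.

Lemma ray_lands_antipoly t z : ray_lands d c t z -> ray_lands d c (- (d%:R * t)) (f z).
Proof.
move=> [Jz [rho [phi [gamma [bo ray land]]]]]; split; first exact: julia_antipoly.
have pos r : 1 < r -> 0 < r by move=> r1; apply: lt_trans r1.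
exists rho, phi, (fun r => f (gamma (real_root r))); split; first exact: bo.
  split.
  - move=> r r1; apply: (continuous_comp (f := fun r => gamma (real_root r))).
      apply: (continuous_comp (f := real_root)).
        exact/continuous_real_root/pos.
      exact/(ray_cont ray)/real_root_gt1.
    exact: continuous_antipoly.
  - have [r0 h0] := ray_infty ray; exists (Num.max 1 (`|r0| ^+ d)) => r.
    rewrite gt_max => /andP[r1 rr0].
    have rr : r0 < real_root r.
      apply: le_lt_trans (ler_norm _) _.
      have h : `|r0| ^+ d < real_root r ^+ d by rewrite real_rootK //; exact: pos.
      rewrite ltNge; apply/negP => hle; move: h; rewrite ltNge => /negP; apply.
      by apply: lerXn2r hle; rewrite nnegrE ?normr_ge0 ?expR_ge0.
    have [h1 h2] := h0 _ rr; split; first exact: (boettcher_stable bo).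
    by rewrite (boettcher_conj bo) // h2 antipoly0_radial real_rootK // pos.
  - move=> r r1; have [n0 /(_ n0.+1 (leqnSn _))] := ray_deep bo ray (real_root_gt1 r1).
    rewrite !iterSr antipoly0_radial real_rootK ?pos // => h.
    by exists n0.
  - by move=> r n r1; rewrite -iterSr; exact/(ray_crit ray)/real_root_gt1.
apply: (@cvg_comp _ _ _ (fun r => gamma (real_root r)) f _ (nbhs z)); last exact: continuous_antipoly.
apply: (@cvg_comp _ _ _ real_root gamma _ 1^'+); last exact: land.
have cr : real_root r @[r --> 1^'+] --> (1 : R).
  apply: cvg_at_right_filter.
  have rr1 : real_root 1 = 1 by rewrite /real_root ln1 mul0r expR0.
  by rewrite -[X in _ --> X]rr1; exact: continuous_real_root.
move=> U hU'; have hU : \forall x \near (1 : R), 1 < x -> U x := hU'.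
have n1 : \forall r \near (1 : R)^'+, 1 < r by exact: nbhs_right_gt.
have hr : \forall r \near (1 : R)^'+, 1 < real_root r -> U (real_root r) := cr _ hU.
by apply: filterS2 n1 hr => r r1 h; apply: h; exact: real_root_gt1.
Qed.

Lemma ray_lands_angle_map t z : ray_lands d c t z -> ray_lands d c (angle_map d t) (f z).
Proof. by move=> h; apply/ray_lands_mod1; exact: ray_lands_antipoly. Qed.

Section Rotation.
Variable j : nat.
Let a : R := j%:R / d%:R.
Let om : R[i] := radial a 1.
Definition rotation z : Cplx R := om * (z : R[i]).

Lemma modulus_rotation z : modulus (rotation z) = modulus z.
Proof. by rewrite /rotation modulusM modulus_radial normr1 mul1r. Qed.

Lemma rotationB z w : rotation z - rotation w = rotation (z - w).
Proof. by rewrite /rotation -mulrBr. Qed.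

Lemma continuous_rotation : continuous rotation.
Proof.
move=> z; apply/continuous_CP => e e0; exists e => // w zw.
by rewrite rotationB modulus_rotation.
Qed.

Lemma rotation_expr : om ^+ d = 1.
Proof.
have dn : d%:R != 0 :> R by rewrite pnatr_eq0 -lt0n ltnW.
by rewrite /om radialX expr1n /a mulrC divfK // radial_nat.
Qed.

Lemma antipoly_rotation (c' : Cplx R) z : antipoly d c' (rotation z) = antipoly d c' z.
Proof.
by rewrite /antipoly /rotation rmorphM exprMn -(rmorphXn (Num.conj)) /= rotation_expr rmorph1 mul1r.
Qed.

Lemma rotation_radial t r : rotation (radial t r) = radial (t + a) r.
Proof. by rewrite /rotation /om radialM mul1r addrC. Qed.

(** Both sides have the same image under the model map, as f does not see the rotation; so their
    quotient is a d-th root of unity. Both are asymptotic to the rotated z, so that root is 1. *)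
Lemma boettcher_rotation rho phi : is_boettcher d c rho phi ->
  exists2 M, rho <= M & forall z, M < modulus z -> phi (rotation z) = rotation (phi z).
Proof.
move=> bo; have [e e0 he] := expr_near_one R d1.
pose e1 := Num.min (e / 4) (1 / 4).
have e10 : 0 < e1 by rewrite lt_min !divr_gt0.
have e1e : e1 <= e / 4 by rewrite ge_min lexx.
have e14 : e1 <= 1 / 4 by rewrite ge_min lexx orbT.
have [M rM hM] := boettcher_normal bo e10.
exists M => // z hz.
have hz' : M < modulus (rotation z) by rewrite modulus_rotation.
have h1 := hM _ hz; have h2 := hM _ hz'; rewrite modulus_rotation in h2.
have z0 : 0 < modulus z by rewrite (lt_trans _ hz) // (lt_le_trans _ rM) // (boettcher_rho bo).
pose p : R[i] := phi (rotation z); pose q : R[i] := rotation (phi z).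
have h3 : 3 / 4 * modulus z <= modulus (q : R[i]).
  rewrite modulus_rotation; have := modulus_sub z (z - phi z); rewrite subKr modulusBC.
  have : e1 * modulus z <= 1 / 4 * modulus z by rewrite ler_wpM2r // ltW.
  by move: h1; lra.
have q0 : q != 0.
  by rewrite -(modulus_gt0 q); apply: lt_le_trans h3; rewrite mulr_gt0 ?divr_gt0.
have pq : modulus (p - q : R[i]) <= 2 * (e1 * modulus z).
  have E : phi (rotation z) - rotation (phi z) =
      (phi (rotation z) - rotation z) - (rotation (phi z - z)).
    by rewrite -rotationB opprB addrA subrK.
  have := modulusB (phi (rotation z) - rotation z) (rotation (phi z - z)).
  by rewrite -E modulus_rotation -[phi _ - _]/(p - q); move: h1 h2; lra.
have hq : modulus (p / q - 1 : R[i]) < e.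
  have -> : p / q - 1 = (p - q) / q by rewrite mulrBl divff.
  rewrite modulusM modulusV ltr_pdivrMr ?modulus_gt0 //.
  have : e1 * modulus z <= (e * modulus z) / 4.
    by rewrite mulrAC ler_wpM2r // ltW.
  have : 0 < e * modulus z by rewrite mulr_gt0.
  have : 3 / 4 * (e * modulus z) <= e * modulus (q : R[i]) by rewrite mulrCA ler_pM2l.
  by move: pq; move: (e1 * _) (e * modulus z) (e * modulus _) => a1 a2 a3; lra.
have [rz rz'] : rho < modulus z /\ rho < modulus (rotation z).
  by rewrite (le_lt_trans rM hz) (le_lt_trans rM hz').
have qd : (p / q) ^+ d = 1.
  have : antipoly d (0 : Cplx R) p = antipoly d (0 : Cplx R) q.
    rewrite -(boettcher_conj bo rz') antipoly_rotation /q antipoly_rotation.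
    by rewrite -(boettcher_conj bo rz).
  rewrite !antipoly0E => /(congr1 Num.conj); rewrite !rmorphXn /= !conjCK => h.
  by rewrite expr_div_n h divff // expf_neq0.
have := he _ hq; rewrite qd subrr modulus0 pmulr_rle0 ?divr_gt0 // => hq0.
have : modulus (p / q - 1 : R[i]) == 0 by rewrite eq_le hq0 modulus_ge0.
by rewrite (modulus_eq0 (p / q - 1 : R[i])) subr_eq0 => /eqP /divr1_eq.
Qed.

Lemma filled_julia_rotation z : filled_julia d c z <-> filled_julia d c (rotation z).
Proof.
by rewrite filled_julia_image [X in _ <-> X]filled_julia_image /f antipoly_rotation.
Qed.

Lemma ray_lands_rotation t z : ray_lands d c t z -> ray_lands d c (t + a) (rotation z).
Proof.
move=> [Jz [rho [phi [gamma [bo ray land]]]]]; split.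
  apply: julia_image_of Jz; [exact: continuous_rotation | exact: filled_julia_rotation].
have [M rM hM] := boettcher_rotation bo; have [B hB] := ray_large d1 bo ray M.
exists rho, phi, (fun r => rotation (gamma r)); split; first exact: bo; last first.
  by apply: (@cvg_comp _ _ _ gamma rotation _ (nbhs z)); [exact: land | exact: continuous_rotation].
split.
- move=> r r1; apply: (continuous_comp (f := gamma)); first exact: (ray_cont ray).
  exact: continuous_rotation.
- have [r0 h0] := ray_infty ray; exists (Num.max 1 (Num.max B r0)) => r.
  rewrite !gt_max => /and3P[r1 rB rr0]; have [h1 h2] := h0 _ rr0.
  rewrite modulus_rotation hM ?h2 ?rotation_radial //.
  by apply: (hB r 0%N); rewrite ?expr1.
- move=> r r1; have [n0 /(_ n0.+1 (leqnSn _))] := ray_deep bo ray r1 => h.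
  (* At least one iteration is needed, since it is the first application of the map that removes the
     rotation. *)
  exists n0.+1; rewrite -rotation_radial !iterSr !antipoly_rotation -!iterSr.
  exact: h.
- move=> r [|n] r1; last by rewrite iterSr antipoly_rotation -iterSr; exact: (ray_crit ray).
  move=> /= h; apply: (@ray_crit _ _ _ _ _ _ _ ray r 0%N r1) => /=.
  by apply/eqP; rewrite -modulus_eq0 -modulus_rotation h modulus0.
Qed.

Lemma rotation_eq z : z != 0 -> rotation z = z -> exists k : int, a = k%:~R.
Proof.
move=> z0 h; have om1 : om = 1.
  by apply: (mulIf (x := (z : R[i]))); rewrite // mul1r.
have [|k hk] := @radial_inj R a 0 1 ltr01; first by rewrite radial0; exact: om1.
by exists k; rewrite hk add0r.
Qed.
End Rotation.

(** Meant for the last p - 1 steps along a critical cycle; the first step supplies the contraction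
    |u|^d. *)
Lemma iter_pointwise_lipschitz n w : exists L del, [/\ 0 <= L, 0 < del &
  forall u, modulus (u - w) < del ->
    modulus (iter n f u - iter n f w) <= L * modulus (u - w)].
Proof.
elim: n w => [|n IH] w; first by exists 1, 1; split => // u _; rewrite mul1r.
pose K := d%:R * (modulus w + 1) ^+ d.-1.
have w1 : 1 <= modulus w + 1 by rewrite lerDr modulus_ge0.
have K0 : 0 <= K by rewrite mulr_ge0 // exprn_ge0 // (le_trans ler01).
have fK u : modulus (u - w) < 1 -> modulus (f u - f w) <= K * modulus (u - w).
  move=> uw; have u1 : modulus u <= modulus w + 1.
    by have := modulus_sub u w; move: uw; lra.
  have -> : f u - f w = ((u : R[i]) ^+ d - (w : R[i]) ^+ d)^*.
    by rewrite /f /antipoly opprD addrACA subrr addr0 rmorphB !rmorphXn.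
  rewrite modulus_conj subrXX modulusM mulrC ler_wpM2r ?modulus_ge0 //.
  have bnd (s : seq 'I_d) : modulus (\sum_(i <- s) (u : R[i]) ^+ (d.-1 - i) * (w : R[i]) ^+ i : R[i])
      <= (size s)%:R * (modulus w + 1) ^+ d.-1.
    elim: s => [|i s IHs]; first by rewrite big_nil mul0r modulus0.
    rewrite big_cons; apply: le_trans (modulusD _ _) _.
    rewrite -[(size (_ :: _))%:R]natr1 mulrDl mul1r [X in _ <= X]addrC.
    apply: lerD; last exact: IHs.
    rewrite modulusM !modulusX.
    have id : (i <= d.-1)%N by rewrite -ltnS prednK ?ltn_ord // ltnW.
    rewrite -[X in _ <= _ ^+ X](subnK id) exprD.
    apply: ler_pM; rewrite ?exprn_ge0 ?modulus_ge0 //.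
      by apply: lerXn2r; rewrite ?nnegrE ?modulus_ge0 // (le_trans ler01).
    by apply: lerXn2r; rewrite ?nnegrE ?modulus_ge0 ?(le_trans ler01) // lerDl.
  have := bnd (index_enum 'I_d).
  have -> : size (index_enum 'I_d) = d by rewrite -[RHS]size_enum_ord enumT.
  exact.
have [L [del [L0 del0 hL]]] := IH (f w).
have Kp : 0 < K + 1 by rewrite ltr_wpDl.
exists (L * K), (Num.min 1 (del / (K + 1))); split.
- exact: mulr_ge0.
- by rewrite lt_min ltr01 divr_gt0.
move=> u; rewrite lt_min => /andP[u1 ud]; rewrite !iterSr.
have fu := fK u u1.
have fd : modulus (f u - f w) < del.
  apply: le_lt_trans fu _; move: ud; rewrite ltr_pdivlMr // mulrDr mulr1 mulrC.
  by apply: le_lt_trans; rewrite lerDl modulus_ge0.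
apply: le_trans (hL _ fd) _; rewrite -mulrA ler_wpM2l //.
Qed.

Lemma iter_bounded n : exists2 B, 0 <= B & forall i u, (i <= n)%N -> modulus u <= 1 ->
  modulus (iter i f u) <= B.
Proof.
elim: n => [|n [B B0 hB]]; first by exists 1 => // i u; rewrite leqn0 => /eqP -> .
exists (B + (B ^+ d + modulus c)); first by rewrite !addr_ge0 ?exprn_ge0 ?modulus_ge0.
move=> i u; rewrite leq_eqVlt => /orP[/eqP ->|]; last first.
  rewrite ltnS => hi u1; apply: le_trans (hB i u hi u1) _.
  by rewrite lerDl addr_ge0 ?exprn_ge0 ?modulus_ge0.
move=> u1; rewrite iterS; apply: le_trans (modulus_antipoly_le _ _ _) _.
rewrite -[X in X <= _]add0r; apply: lerD => //; rewrite lerD2r.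
by apply: lerXn2r; rewrite ?nnegrE ?modulus_ge0 // hB.
Qed.

(* A periodic critical point is superattracting. *)
Lemma critical_periodic_not_julia p : (0 < p)%N -> iter p f 0 = 0 -> ~ julia d c 0.
Proof.
move=> p0 fp [_ cl]; have [L [del [L0 del0 hL]]] := iter_pointwise_lipschitz p.-1 (f 0).
have Lp : 0 < L + 1 by rewrite ltr_wpDl.
(* For |u| < e: [e <= 1] gives |u|^d <= e |u|, [e <= del] keeps f u where the Lipschitz bound holds,
   and [e * (L + 1) <= 1] absorbs the Lipschitz constant. *)
pose e := Num.min (Num.min 1 del) (L + 1)^-1.
have e0 : 0 < e by rewrite !lt_min ltr01 del0 invr_gt0.
have e1 : e <= 1 by rewrite !ge_min lexx.
have ed : e <= del by rewrite !ge_min lexx orbT.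
have eL : e * (L + 1) <= 1 by rewrite -ler_pdivlMr // mul1r ge_min lexx orbT.
clearbody e.
have step u : modulus u < e -> modulus (iter p f u) <= modulus u.
  move=> ue; have u1 : modulus u <= 1 by rewrite ltW // (lt_le_trans ue).
  have E : modulus (f u - f 0) = modulus u ^+ d.
    have -> : f u - f 0 = (u : R[i])^* ^+ d.
      by rewrite /f /antipoly opprD addrACA subrr addr0 rmorph0 expr0n gtn_eqF ?subr0 // ltnW.
    by rewrite modulusX modulus_conj.
  have ud : modulus u ^+ d <= e * modulus u.
    have [k ->] : exists k, d = k.+2 by case: d d1 => [|[|k]] // _; exists k.
    rewrite exprSr ler_wpM2r ?modulus_ge0 // exprSr.
    apply: le_trans (_ : 1 * modulus u <= _); last by rewrite mul1r ltW.
    by rewrite ler_wpM2r ?modulus_ge0 // exprn_ile1 ?modulus_ge0.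
  have hd : modulus (f u - f 0) < del.
    rewrite E; apply: le_lt_trans ud _; apply: le_lt_trans (lt_le_trans ue ed).
    by rewrite ler_piMl ?modulus_ge0.
  have := hL _ hd; rewrite -!iterSr prednK // fp subr0 E => h.
  apply: le_trans h _; apply: le_trans (_ : (e * (L + 1)) * modulus u <= _); last first.
    by rewrite ler_piMl ?modulus_ge0.
  apply: le_trans (_ : (L + 1) * (e * modulus u) <= _); last by rewrite mulrA (mulrC (L + 1)).
  apply: ler_pM => //; first by rewrite exprn_ge0 ?modulus_ge0.
  by rewrite lerDl.
have nU : \forall u \near (0 : Cplx R), modulus u < e.
  by apply/near_modulusP; exists e => // u; rewrite sub0r modulusN.
have [u [nK ue]] := cl _ nU; apply: nK.
have small q : modulus (iter (q * p) f u) < e.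
  elim: q => [|q IH]; first by [].
  by rewrite mulSn iterD; apply: le_lt_trans (step _ IH) IH.
have [B _ hB] := iter_bounded p; exists B => n.
rewrite (divn_eq n p) addnC iterD; apply: hB; first by rewrite ltnW // ltn_mod.
by rewrite ltW // (lt_le_trans (small _)).
Qed.

End Symmetries.

(** * Arcs of the circle and formal orbit portraits *)

Section ArcLength.
Variable R : realType.
Implicit Types (a b c x y : R).

(* Length of the counterclockwise arc from a to b. *)
Definition arclen a b : R := mod1 (b - a).

Lemma mod1_uniq x y (k : int) : 0 <= y < 1 -> x = y + k%:~R -> mod1 x = y.
Proof.
move=> /andP[y0 y1] xy; have [k' e] := mod1E x; have /andP[h0 h1] := mod1_itv x.
have E : mod1 x - y = (k + k')%:~R by rewrite e xy intrD; lra.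
have [k0|k0|k0] := ltgtP (k + k') 0.
- have : (k + k')%:~R <= (-1)%:~R :> R by rewrite ler_int; lia.
  by rewrite -E intrN; lra.
- have : 1%:~R <= (k + k')%:~R :> R by rewrite ler_int; lia.
  by rewrite -E; lra.
- by apply/eqP; rewrite -subr_eq0 E k0.
Qed.

Lemma mod1_eqP x y : mod1 x = mod1 y <-> exists k : int, x = y + k%:~R.
Proof.
split=> [e|[k e]].
  have [k1 e1] := mod1E x; have [k2 e2] := mod1E y.
  by exists (k2 - k1); rewrite intrD intrN; move: e1 e2; rewrite e; lra.
have [k2 e2] := mod1E y; apply: (@mod1_uniq _ _ (k - k2)); first exact: mod1_itv.
by rewrite e2 e intrD intrN; lra.
Qed.

Lemma mod1_id x : 0 <= x < 1 -> mod1 x = x.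
Proof. by move=> h; apply: (@mod1_uniq _ _ 0) => //; rewrite addr0. Qed.

Lemma arclen_itv a b : 0 <= arclen a b < 1.
Proof. exact: mod1_itv. Qed.

Lemma arclen_ge0 a b : 0 <= arclen a b.
Proof. by case/andP: (arclen_itv a b). Qed.

Lemma arclen_lt1 a b : arclen a b < 1.
Proof. by case/andP: (arclen_itv a b). Qed.

Lemma arclen_mod1 a b : arclen (mod1 a) (mod1 b) = arclen a b.
Proof.
apply/mod1_eqP; have [k1 e1] := mod1E a; have [k2 e2] := mod1E b.
by exists (k2 - k1); rewrite e1 e2 intrD intrN; lra.
Qed.

Lemma arclenDr a b x : arclen (a + x) (b + x) = arclen a b.
Proof. by rewrite /arclen opprD addrACA subrr addr0. Qed.

Lemma arclen_from a b c : arclen b c = mod1 (arclen a c - arclen a b).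
Proof.
apply/mod1_eqP; have [k1 e1] := mod1E (c - a); have [k2 e2] := mod1E (b - a).
by exists (k2 - k1); rewrite /arclen e1 e2 intrD intrN; lra.
Qed.

Lemma arclen_sub a b c : arclen a b <= arclen a c -> arclen b c = arclen a c - arclen a b.
Proof.
move=> h; rewrite (arclen_from a); apply: mod1_id; rewrite subr_ge0 h /=.
by have := arclen_ge0 a b; have := arclen_lt1 a c; lra.
Qed.

Lemma arclen_sub1 a b c : arclen a c < arclen a b -> arclen b c = arclen a c - arclen a b + 1.
Proof.
move=> h; rewrite (arclen_from a); apply: (@mod1_uniq _ _ (-1)); last by rewrite intrN; lra.
by have := arclen_ge0 a c; have := arclen_lt1 a b; lra.
Qed.

Lemma arclenxx a : arclen a a = 0.
Proof. by rewrite /arclen subrr mod1_id // lexx ltr01. Qed.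

Lemma arclen_eq0 a b : 0 <= a < 1 -> 0 <= b < 1 -> arclen a b = 0 -> a = b.
Proof.
move=> ha hb; have [k e] := mod1E (b - a); rewrite /arclen e => h.
by rewrite -(mod1_id ha) -(mod1_id hb); apply/mod1_eqP; exists k; move: h; lra.
Qed.

Lemma arclen_gt0 a b : 0 <= a < 1 -> 0 <= b < 1 -> a <> b -> 0 < arclen a b.
Proof. by move=> ha hb ab; rewrite lt0r arclen_ge0 andbT; apply/eqP => /arclen_eq0 h; apply/ab/h. Qed.

Lemma arclenC a b : 0 < arclen a b -> arclen b a = 1 - arclen a b.
Proof. by move=> h; rewrite (@arclen_sub1 a b a) ?arclenxx //; lra. Qed.

Lemma arclenDl a b x : 0 <= x -> arclen a b + x < 1 -> arclen a (b + x) = arclen a b + x.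
Proof.
move=> x0 h; have [k e] := mod1E (b - a); rewrite /arclen.
apply: (@mod1_uniq _ _ (- k)); last by rewrite e intrN; lra.
by rewrite -/(arclen a b) h andbT addr_ge0 // arclen_ge0.
Qed.

Lemma arclen_shift a x : 0 <= x < 1 -> arclen a (a + x) = x.
Proof. by move=> h; rewrite /arclen addrC addKr mod1_id. Qed.

(** The same relation as [cyclic] on [0, 1[ ([cyclicE]), but measured from its first point, hence
    independent of where the circle is cut. *)
Definition cyc a b c : bool := 0 < arclen a b < arclen a c.

Lemma cyc_rot a b c : cyc a b c -> cyc b c a.
Proof.
move=> /andP[h1 h2]; rewrite /cyc (arclenC h1) (arclen_sub (ltW h2)).
by have := arclen_lt1 a c; lra.
Qed.

Lemma cyc_arclen a b c : cyc a b c -> arclen b c = arclen a c - arclen a b.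
Proof. by move=> /andP[_ /ltW/arclen_sub]. Qed.

Lemma cyc_asym a b c : cyc a b c -> cyc a c b -> False.
Proof. by move=> /andP[_ h] /andP[_]; rewrite ltNge (ltW h). Qed.

Lemma cyc_total a b c : 0 <= a < 1 -> 0 <= b < 1 -> 0 <= c < 1 ->
  a <> b -> b <> c -> a <> c -> cyc a b c \/ cyc a c b.
Proof.
move=> ha hb hc ab bc ac; rewrite /cyc !arclen_gt0 //=.
case: (ltgtP (arclen a b) (arclen a c)) => h; [by left | by right | exfalso].
apply: bc; apply: arclen_eq0 => //; by rewrite (@arclen_sub a b c) ?h ?lexx ?subrr.
Qed.

Lemma arclen_le a b : 0 <= a < 1 -> 0 <= b < 1 ->
  arclen a b = if a <= b then b - a else b - a + 1.
Proof.
move=> /andP[a0 a1] /andP[b0 b1]; rewrite /arclen; case: leP => h.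
  by apply: mod1_id; lra.
by apply: (@mod1_uniq _ _ (-1)); rewrite ?intrN; lra.
Qed.

Lemma cyclicE a b c : 0 <= a < 1 -> 0 <= b < 1 -> 0 <= c < 1 ->
  cyclic a b c = cyc a b c.
Proof.
move=> ha hb hc; rewrite /cyclic /cyc !arclen_le //.
move: ha hb hc => /andP[a0 a1] /andP[b0 b1] /andP[c0 c1].
apply/idP/idP.
  by case: (leP a b) => ab; case: (leP a c) => ac /or3P[] /andP[? ?]; lra.
case: (leP a b) => ab; case: (leP a c) => ac /andP[? ?]; apply/or3P.
- by constructor 1; lra.
- by constructor 3; lra.
- by exfalso; lra.
- by constructor 2; lra.
Qed.

Lemma argmin_finite (T : Type) (A : set T) (h : T -> R) : finite_set A -> A !=set0 ->
  exists2 a, A a & forall y : T, A y -> h a <= h y.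
Proof.
move=> fA A0; have fi := finite_image h fA; have i0 : h @` A !=set0 by case: A0 => a; exists (h a), a.
have [s sE] := (finite_seqP _).1 fi.
have [m ms hm] : exists2 m, m \in s & forall y, y \in s -> m <= y.
  have : s != [::] by case: i0 => y; rewrite sE /=; case: (s).
  elim: (s) => [//|y [|y' s'] IH] _.
    by exists y; rewrite ?mem_head // => x; rewrite inE => /eqP ->.
  have [//|m ms hm] := IH; have [ym|my] := leP y m.
    exists y; rewrite ?mem_head // => x; rewrite inE => /orP[/eqP -> //|/hm].
    exact: le_trans.
  exists m; first by rewrite inE ms orbT.
  by move=> x; rewrite inE => /orP[/eqP ->|/hm //]; exact: ltW.
have : [set` s] m by [].
rewrite -sE => -[a Aa am]; exists a => // y Ay; rewrite am; apply: hm.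
by have : (h @` A) (h y) by [exists y]; rewrite sE.
Qed.

Lemma argmax_finite (T : Type) (A : set T) (h : T -> R) : finite_set A -> A !=set0 ->
  exists2 a, A a & forall y : T, A y -> h y <= h a.
Proof.
move=> fA A0; have [a Aa ha] := argmin_finite (fun x : T => - h x) fA A0.
by exists a => // y /ha; rewrite lerN2.
Qed.

(** Cut the circle at a point c0 of C. The closed arc from the first to the last point of B contains
    B, and a point of C inside it would alternate with c0; so C lies in the complementary open
    arc. *)
Lemma finite_sets_unlinked (B C : set R) :
  (forall x, B x -> 0 <= x < 1) -> (forall x, C x -> 0 <= x < 1) ->
  finite_set B -> B !=set0 -> C !=set0 ->
  (forall b c, B b -> C c -> arclen b c <> 0) ->
  (forall b1 b2 c1 c2, B b1 -> B b2 -> C c1 -> C c2 ->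
     arclen b1 c1 < arclen b1 b2 -> arclen b1 b2 < arclen b1 c2 -> False) ->
  unlinked B C.
Proof.
move=> B01 C01 fB B0 [c0 Cc0] dBC nl.
have [b' Bb' hb'] := argmin_finite (arclen c0) fB B0.
have [b Bb hb] := argmax_finite (arclen c0) fB B0.
exists (@mod1 R @` `[c0 + arclen c0 b', c0 + arclen c0 b]), (@mod1 R @` `]c0 + arclen c0 b, c0 + arclen c0 b' + 1[).
have lift y : 0 <= y < 1 -> exists k : int, c0 + arclen c0 y = y + k%:~R.
  by move=> _; have [k e] := mod1E (y - c0); exists k; rewrite /arclen e; lra.
split.
- by exists `[c0 + arclen c0 b', c0 + arclen c0 b]%classic; split => //; exact: interval_is_interval.
- by exists `]c0 + arclen c0 b, c0 + arclen c0 b' + 1[%classic; split => //; exact: interval_is_interval.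
- apply/seteqP; split => // x [[u]]; rewrite /= in_itv /= => /andP[u1 u2] <-.
  move=> [v]; rewrite in_itv /= => /andP[v1 v2] /mod1_eqP[k e].
  have [k0|k0|k0] := ltgtP k 0.
  + have : k%:~R <= (-1)%:~R :> R by rewrite ler_int; lia.
    by rewrite intrN; lra.
  + have : 1%:~R <= k%:~R :> R by rewrite ler_int; lia.
    by lra.
  + by move: e; rewrite k0; lra.
- move=> x Bx; exists (c0 + arclen c0 x); first by rewrite /= in_itv /= !lerD2l hb' ?hb.
  by have [k ->] := lift _ (B01 _ Bx); apply: mod1_uniq (B01 _ Bx) _; reflexivity.
- move=> x Cx; have x01 := C01 _ Cx; have [k e] := lift _ x01.
  have hx0 := arclen_ge0 c0 x; have hx1 := arclen_lt1 c0 x.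
  have [h|h] := ltP (arclen c0 b) (arclen c0 x).
    exists (c0 + arclen c0 x); last by rewrite e; apply: mod1_uniq x01 _; reflexivity.
    by rewrite /= in_itv /= ltrD2l h /=; have := arclen_ge0 c0 b'; lra.
  have [h'|h'] := ltP (arclen c0 x) (arclen c0 b').
    exists (c0 + arclen c0 x + 1).
      by rewrite /= in_itv /=; have := arclen_lt1 c0 b; lra.
    by rewrite e; apply: (@mod1_uniq _ _ (k + 1)) => //; rewrite intrD addrA.
  exfalso; have n1 := dBC _ _ Bb' Cx; have n2 := dBC _ _ Bb Cx.
  have e1 := arclen_sub h'; have e2 := arclen_sub (hb' _ Bb).
  have n3 : arclen c0 x != arclen c0 b.
    apply/eqP => E; apply: n2; by rewrite (@arclen_sub c0 b x) ?E ?lexx ?subrr.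
  have hlt : arclen c0 x < arclen c0 b by rewrite lt_neqAle n3.
  have n4 : arclen c0 b' <> 0.
    move=> E; apply: (dBC _ _ Bb' Cc0); rewrite (@arclen_sub c0 b' c0) ?E ?arclenxx ?subrr ?lexx //.
  have p4 : 0 < arclen c0 b' by rewrite lt0r arclen_ge0 andbT; apply/eqP.
  apply: (nl b' b x c0 Bb' Bb Cx Cc0); first by rewrite e1 e2; lra.
  by rewrite e2 (arclenC p4); have := arclen_lt1 c0 b; lra.
Qed.
End ArcLength.

(** Increments of a bounded increasing sequence tend to 0. Once they are below 1/D, the recursion
    modulo 1 multiplies them exactly by D >= 2, so they grow. *)
Lemma expanding_sequence_not_increasing (R : realType) (D : R) (x : nat -> R) :
  2 <= D -> (forall k, 0 <= x k <= 1) -> (forall k, x k < x k.+1) ->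
  (forall k, exists m : int, x k.+1 = D * x k + m%:~R) -> False.
Proof.
move=> D2 x01 inc hD.
have D0 : 0 < D by lra.
have ndx : nondecreasing_seq x by apply/nondecreasing_seqP => n; exact: ltW.
have ubx : has_ubound (range x).
  by exists 1 => _ [n _ <-]; case/andP: (x01 n).
have cx := nondecreasing_is_cvgn ndx ubx.
pose del k := x k.+1 - x k.
have del0 k : 0 < del k by rewrite subr_gt0.
have cdel : del n @[n --> \oo] --> (0 : R).
  rewrite -(subrr (limn x)); apply: cvgB; last exact: cx.
  by rewrite (cvg_shiftS x); exact: cx.
have [K hK] : exists K, forall k, (K <= k)%N -> del k < D^-1.
  have Di : 0 < D^-1 by rewrite invr_gt0.
  move/cvgrPdist_lt/(_ _ Di): cdel => [K _ hK]; exists K => k /hK.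
  by rewrite sub0r normrN gtr0_norm.
have step k : (K <= k)%N -> del k.+1 = D * del k.
  move=> Kk; have [m1 e1] := hD k; have [m2 e2] := hD k.+1.
  have E : del k.+1 - D * del k = (m2 - m1)%:~R.
    by rewrite /del mulrBr intrD intrN; move: e1 e2; lra.
  have b1 : 0 < D * del k < 1.
    by rewrite mulr_gt0 //= -ltr_pdivlMl // mulr1 hK.
  have b2 : 0 < del k.+1 < 1.
    rewrite del0 /=; apply: lt_le_trans (hK _ (leqW Kk)) _.
    by rewrite invf_le1 //; lra.
  have [m0|m0|m0] := ltgtP (m2 - m1) 0.
  - have : (m2 - m1)%:~R <= (-1)%:~R :> R by rewrite ler_int; lia.
    by rewrite -E intrN; lra.
  - have : 1%:~R <= (m2 - m1)%:~R :> R by rewrite ler_int; lia.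
    by rewrite -E; lra.
  - by move: E; rewrite m0; lra.
have grow j : j.+1%:R * del K <= del (K + j)%N.
  elim: j => [|j IH]; first by rewrite mul1r addn0.
  rewrite addnS step ?leq_addr //.
  have : 2 * del (K + j)%N <= D * del (K + j)%N by rewrite ler_pM2r.
  have : del K <= j.+1%:R * del K by rewrite ler_peMl ?(ltW (del0 K)) // ler1n.
  by rewrite -[j.+2%:R]natr1 mulrDl mul1r; lra.
have := grow (Num.bound (1 / del K)); have := hK _ (leq_addr (Num.bound (1 / del K)) K).
have := @archi_boundP _ (1 / del K) (divr_ge0 ler01 (ltW (del0 K))).
rewrite ltr_pdivrMr //; set N := Num.bound _.
have : D^-1 <= 1 by rewrite invf_le1 //; lra.
have : 0 < del K by [].
by rewrite -natr1 mulrDl mul1r; lra.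
Qed.

Lemma val_iter_ordS p (i : 'I_p) n : (iter n (@ordS p) i : nat) = ((i + n) %% p)%N.
Proof.
elim: n => [|n IH]; first by rewrite addn0 modn_small.
by rewrite iterS /= IH -addn1 modnDml addn1 addnS.
Qed.

Lemma iter_ordS_fixed p (i : 'I_p) n : (iter n (@ordS p) i == i) = (p %| n)%N.
Proof.
rewrite -(inj_eq val_inj) /= val_iter_ordS -{2}(modn_small (ltn_ord i)).
by rewrite -{2}(addn0 i) eqn_modDl mod0n.
Qed.

Lemma iter_ordS_reach p (i k : 'I_p) : exists n, iter n (@ordS p) i = k.
Proof.
exists (k + (p - i))%N; apply: ord_inj; rewrite val_iter_ordS.
have ip := ltnW (ltn_ord i).
by rewrite addnCA subnKC // modnDr modn_small.
Qed.

(** * Formal portraits: spread and cyclic order of the angles *)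

Section Portrait.
Variables (R : realType) (d p : nat) (A : 'I_p -> set R).
Hypothesis d1 : (1 < d)%N.
Let F := @angle_map R d.
Let e : R := d%:R^-1.
Hypothesis A01 : forall i t, A i t -> 0 <= t < 1.
Hypothesis AF : forall i t, A i t -> A (ordS i) (F t).
Hypothesis Adisj : forall i j t, A i t -> A j t -> i = j.
(* dis and unl: the rays at the angles t + j/d, t in A i, and those at the angles
   in A m have distinct landing points, so they are disjoint and unlinked. *)
Hypothesis dis : forall i m (j : nat) t s, (j < d)%N -> (m != i) || (j != 0)%N ->
  A i t -> A m s -> arclen (t + j%:R / d%:R) s <> 0.
Hypothesis unl : forall i m (j : nat) t1 t2 s1 s2, (j < d)%N -> (m != i) || (j != 0)%N ->
  A i t1 -> A i t2 -> A m s1 -> A m s2 ->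
  arclen (t1 + j%:R / d%:R) s1 < arclen t1 t2 -> arclen t1 t2 < arclen (t1 + j%:R / d%:R) s2 -> False.
Implicit Types (i j m : 'I_p) (t s a b x y : R).

Lemma dR_gt0 : 0 < d%:R :> R.
Proof. by rewrite ltr0n ltnW. Qed.

Lemma e_gt0 : 0 < e.
Proof. by rewrite invr_gt0 dR_gt0. Qed.

Lemma e_le_half : e <= 1 / 2.
Proof.
by rewrite div1r lef_pV2 ?posrE ?dR_gt0 // ler_nat.
Qed.

Lemma de1 : d%:R * e = 1.
Proof. by rewrite divff // gt_eqF // dR_gt0. Qed.

Lemma dis1 i t s : A i t -> A i s -> arclen (t + e) s <> 0.
Proof.
move=> At As; have := @dis i i 1 t s d1 _ At As.
by rewrite orbT div1r; apply.
Qed.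

Lemma unl1 i t1 t2 s1 s2 : A i t1 -> A i t2 -> A i s1 -> A i s2 ->
  arclen (t1 + e) s1 < arclen t1 t2 -> arclen t1 t2 < arclen (t1 + e) s2 -> False.
Proof.
move=> h1 h2 h3 h4; have := @unl i i 1 t1 t2 s1 s2 d1 _ h1 h2 h3 h4.
by rewrite orbT div1r; apply.
Qed.

Lemma arclen_shift_e i a b : A i a -> A i b ->
  (e < arclen a b /\ arclen (a + e) b = arclen a b - e) \/
  (arclen a b < e /\ arclen (a + e) b = arclen a b - e + 1).
Proof.
move=> Aa Ab; have := dis1 Aa Ab; have he : arclen a (a + e) = e.
  by apply: arclen_shift; rewrite ltW ?e_gt0 //=; have := e_le_half; lra.
have [h|h] := leP e (arclen a b).
  rewrite (@arclen_sub R a) ?he // => h0; left; split => //.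
  by rewrite lt_neqAle h andbT; apply/eqP => E; apply: h0; rewrite E subrr.
by move=> _; right; split => //; rewrite (@arclen_sub1 R a) ?he.
Qed.

(** If both arcs between a and b were longer than 1/d, then b would lie on one side and a on the
    other side of the pair {a + e, b + e}, linking it with {a, b}. *)
Lemma pair_spread i a b : A i a -> A i b -> a <> b -> arclen a b < e \/ arclen b a < e.
Proof.
move=> Aa Ab ab; have u0 := arclen_gt0 (A01 Aa) (A01 Ab) ab.
have [[h1 h2]|[h1 _]] := arclen_shift_e Aa Ab; last by left.
have [[h3 h4]|[h3 _]] := arclen_shift_e Ab Aa; last by right.
have [[h5 h6]|[h5 h6]] := arclen_shift_e Aa Aa.
  by move: h5; rewrite arclenxx ltNge (ltW e_gt0).
exfalso; apply: (@unl1 i a b b a) => //; first by rewrite h2; have := e_gt0; lra.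
by rewrite h6 arclenxx; move: h3; rewrite (arclenC u0); lra.
Qed.

Lemma triple_spread i a b c : A i a -> A i b -> A i c -> cyc a b c ->
  [\/ arclen a c < e, arclen b a < e | arclen c b < e].
Proof.
move=> Aa Ab Ac abc; move: (abc) => /andP[u0 uv].
have bc := cyc_arclen abc.
have [[h1 h2]|[h1 h2]] := arclen_shift_e Aa Ab.
  have ab : a <> b by move=> E; move: u0; rewrite E arclenxx ltxx.
  by have [h|h] := pair_spread Aa Ab ab; [move: h; rewrite ltNge (ltW h1) | constructor 2].
have [[h3 h4]|[h3 h4]] := arclen_shift_e Aa Ac; last by constructor 1.
have [[h5 h6]|[h5 h6]] := arclen_shift_e Ac Ab; last by constructor 3.
exfalso; apply: (@unl1 i a c c b) => //; first by rewrite h4; have := e_gt0; lra.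
rewrite h2; move: h5; rewrite arclenC bc; lra.
Qed.

Lemma arclen_map a b : arclen (F b) (F a) = mod1 (d%:R * arclen a b).
Proof.
rewrite /F /angle_map arclen_mod1 /arclen; apply/mod1_eqP.
have [k ->] := mod1E (b - a); exists (- (d%:Z * k)).
by rewrite intrN intrM /=; lra.
Qed.

Lemma arclen_map_small a b : arclen a b < e -> arclen (F b) (F a) = d%:R * arclen a b.
Proof.
move=> h; rewrite arclen_map mod1_id // mulr_ge0 ?ler0n ?arclen_ge0 //=.
by rewrite -[X in _ < X]de1 ltr_pM2l ?dR_gt0.
Qed.

Lemma F_inj i a b : A i a -> A i b -> F a = F b -> a = b.
Proof.
move=> Aa Ab E; apply: contrapT => ab.
have ba : b <> a by move=> E'; apply: ab.
have := arclen_gt0 (A01 Aa) (A01 Ab) ab; have := arclen_gt0 (A01 Ab) (A01 Aa) ba.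
have := dR_gt0; case: (pair_spread Aa Ab ab) => /arclen_map_small; rewrite E arclenxx => h.
  by move=> d0 _ u0; have := mulr_gt0 d0 u0; rewrite -h ltxx.
by move=> d0 u0 _; have := mulr_gt0 d0 u0; rewrite -h ltxx.
Qed.

Lemma F_rev i a b c : A i a -> A i b -> A i c -> cyc a b c -> cyc (F c) (F b) (F a).
Proof.
have small a' b' c' : arclen a' c' < e -> cyc a' b' c' -> cyc (F c') (F b') (F a').
  move=> h abc; move: (abc) => /andP[u0 uv]; have bc := cyc_arclen abc.
  have h2 : arclen b' c' < e by rewrite bc; lra.
  rewrite /cyc (arclen_map_small h) (arclen_map_small h2) bc; apply/andP; split.
    by rewrite mulr_gt0 ?dR_gt0 // subr_gt0.
  by rewrite ltr_pM2l ?dR_gt0 // gtrBl.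
move=> Aa Ab Ac abc; case: (triple_spread Aa Ab Ac abc) => h.
- exact: small.
- by have := small _ _ _ h (cyc_rot abc) => /cyc_rot.
- by have := small _ _ _ h (cyc_rot (cyc_rot abc)) => /cyc_rot/cyc_rot.
Qed.

Lemma A_iter n i t : A i t -> A (iter n (@ordS p) i) (iter n F t).
Proof. by move=> h; elim: n => // n IH; exact: AF. Qed.

Lemma iter_inj n i a b : A i a -> A i b -> iter n F a = iter n F b -> a = b.
Proof.
move=> Aa Ab; elim: n => // n IH E; apply: IH.
exact: F_inj (A_iter n Aa) (A_iter n Ab) E.
Qed.

Lemma iter_cyc n i a b c : A i a -> A i b -> A i c -> cyc a b c ->
  if odd n then cyc (iter n F c) (iter n F b) (iter n F a)
  else cyc (iter n F a) (iter n F b) (iter n F c).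
Proof.
move=> Aa Ab Ac abc; elim: n => // n; rewrite oddS.
have An := @A_iter n i.
by case: (odd n) => /= h; apply: F_rev h; apply: An.
Qed.

Lemma iter_arclen n a b :
  arclen (iter n F a) (iter n F b) = mod1 ((- d%:R) ^+ n * arclen a b).
Proof.
elim: n => [|n IH]; first by rewrite expr0 mul1r mod1_id ?arclen_itv.
have [k hk] := mod1E ((- d%:R) ^+ n * arclen a b); rewrite -IH in hk.
rewrite !iterS; move: (iter n F a) (iter n F b) hk => a' b' hk.
rewrite /F /angle_map arclen_mod1 /arclen; apply/mod1_eqP.
have [k' hk'] := mod1E (b' - a'); rewrite /arclen hk' in hk.
exists (d%:Z * (k' - k)); rewrite intrM intrD intrN exprS /=.
have -> : b' = (- d%:R) ^+ n * mod1 (b - a) + k%:~R - k'%:~R + a' by rewrite -hk; lra.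
rewrite pmulrn; ring.
Qed.

Lemma natrX_ge2 n : (0 < n)%N -> 2 <= d%:R ^+ n :> R.
Proof.
case: n => // n _; rewrite exprS -[2](mulr1); apply: ler_pM => //; first by rewrite ler_nat.
by apply: exprn_ege1; rewrite ler1n ltnW.
Qed.

(* F^n expands lengths, so a point that it moves cannot move monotonically around
   the circle forever; but an order preserving injection with a fixed point does
   just that. *)
Lemma fixed_spreads n i t0 t : (0 < n)%N -> ~~ odd n -> iter n (@ordS p) i = i ->
  A i t0 -> iter n F t0 = t0 -> A i t -> iter n F t = t.
Proof.
move=> n0 nodd hi At0 ht0 At; pose G := iter n F.
have AG k : A i (iter k G t).
  by elim: k => // k IH; rewrite iterS -[X in A X]hi; exact: A_iter.
pose x k := arclen t0 (iter k G t).
have D2 := natrX_ge2 n0; pose D : R := d%:R ^+ n.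
have xD k : exists m : int, x k.+1 = D * x k + m%:~R.
  rewrite /x iterS -[in arclen t0 _]ht0 /G iter_arclen.
  have -> : (- d%:R) ^+ n = D :> R by rewrite exprNn -signr_odd (negbTE nodd) expr0 mul1r.
  exact: mod1E.
have x01 k : 0 <= x k <= 1 by rewrite arclen_ge0 ltW // arclen_lt1.
have [e0|/eqP xt] := eqVneq t t0; first by rewrite e0.
have ne k : iter k G t <> t0.
  elim: k => // k IH; rewrite iterS => E; apply: IH.
  by apply: (iter_inj (n := n) (AG k) At0); rewrite ht0.
have x0 k : 0 < x k by apply: arclen_gt0; [exact: A01 At0 | exact: A01 (AG k) | move=> E; apply: (ne k)].
have cycG a b : A i a -> A i b -> cyc t0 a b -> cyc t0 (G a) (G b).
  move=> Aa Ab h; have := iter_cyc n At0 Aa Ab h.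
  by rewrite (negbTE nodd) ht0.
have cx k l : cyc t0 (iter k G t) (iter l G t) = (x k < x l) by rewrite /cyc x0.
have step k : (x k < x k.+1 -> x k.+1 < x k.+2) /\ (x k.+1 < x k -> x k.+2 < x k.+1).
  by split; rewrite -!cx; apply: cycG.
have [h|h|h] := ltgtP (x 0%N) (x 1%N).
- exfalso; apply: (@expanding_sequence_not_increasing R D x D2 x01 _ xD) => k.
  by elim: k => // k /(proj1 (step k)).
- exfalso; apply: (@expanding_sequence_not_increasing R D (fun k => 1 - x k) D2).
  + by move=> k; case/andP: (x01 k) => ? ?; apply/andP; split; lra.
  + by move=> k; rewrite ltrD2l ltrN2; elim: k => // k /(proj2 (step k)).
  + move=> k; have [m ->] := xD k; exists (1 - m - (d ^ n)%:Z).
    by rewrite !intrD !intrN -[(d ^ n)%:Z%:~R]/((d ^ n)%:R) natrX -/D; lra.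
- apply/esym; apply: arclen_eq0; [exact: A01 At | exact: A01 (AG 1%N) |].
  by rewrite (@arclen_sub R t0) -/(x 0%N) -/(x 1%N) h ?lexx ?subrr.
Qed.

Lemma iter_cycle i t n : (0 < n)%N -> A i t -> iter n F t = t -> (p %| n)%N.
Proof.
move=> n0 At E; rewrite -(iter_ordS_fixed i); apply/eqP/esym.
by apply: (Adisj At); rewrite -[t in A _ t]E; exact: A_iter.
Qed.

Lemma iter_mul k n t : iter n F t = t -> iter (k * n) F t = t.
Proof. by move=> h; elim: k => // k IH; rewrite mulSn iterD IH. Qed.

Lemma iter_comm n k t : iter n F (iter k F t) = iter k F (iter n F t).
Proof. by rewrite -!iterD addnC. Qed.

Lemma fixed_everywhere i m n t s : (0 < n)%N -> ~~ odd n -> A i t -> A m s ->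
  iter n F t = t -> iter n F s = s.
Proof.
move=> n0 nodd At As ht; have [l hl] := iter_ordS_reach i m.
have Al := A_iter l At; rewrite hl in Al.
apply: (fixed_spreads n0 nodd _ Al _ As); last by rewrite iter_comm ht.
by apply/eqP; rewrite iter_ordS_fixed; exact: iter_cycle n0 At ht.
Qed.

(** * Periodicity, finiteness and unlinked translates *)

Hypothesis Arat : exists i (q : rat), A i (mod1 (ratr q)).

(** The orbit of a rational angle stays among the fractions in [0, 1[ with denominator [N], so it
    repeats. The angle itself is so far only known to be preperiodic; the periodic one found may
    belong to another [A i]. *)
Lemma periodic_angle_exists : exists i t n, [/\ A i t, (0 < n)%N & iter n F t = t].
Proof.
have [i [q Aq]] := Arat; set t : R := mod1 _ in Aq.
pose N := `|denq q|%N.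
have N0 : (0 < N)%N by rewrite absz_gt0 denq_neq0.
have NR0 : 0 < N%:R :> R by rewrite ltr0n.
have NE : N%:R = (denq q)%:~R :> R by rewrite pmulrn /N gez0_abs ?denq_ge0.
have int n : exists z : int, N%:R * iter n F t = z%:~R.
  elim: n => [|n [z hz]].
    have [k hk] := mod1E (ratr q : R); exists (numq q + denq q * k).
    rewrite /= /t hk mulrDr NE intrD intrM; congr (_ + _).
    rewrite /ratr mulrCA divff ?mulr1 //.
    by rewrite -NE gt_eqF.
  have [k hk] := mod1E (- (d%:R * iter n F t)).
  exists (- (d%:Z * z) + N%:Z * k); rewrite iterS /F /angle_map hk.
  by rewrite intrD intrN !intrM -hz /=; ring.
have A01n n : 0 <= iter n F t < 1 by exact: A01 (A_iter n Aq).
have /existsNP[a /existsNP[b hab]] :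
    ~ forall a b : nat, (a < b)%N -> iter a F t <> iter b F t.
  move=> h; pose f n := `|Num.floor (N%:R * iter n F t)|%N.
  have fE n : (f n)%:R = N%:R * iter n F t.
    have [z hz] := int n; rewrite /f hz intrKfloor pmulrn gez0_abs //.
    rewrite -(ler0z R) -hz mulr_ge0 ?ler0n //; by case/andP: (A01n n).
  have := @pigeonhole N.+1 N f; rewrite ltnn => hp; apply/notF/hp.
    move=> a b _ _ /(congr1 (fun n : nat => n%:R : R)); rewrite !fE.
    move=> /(mulfI (lt0r_neq0 NR0)) E.
    by case: (ltngtP a b) => // ab; [case: (h _ _ ab) | case: (h _ _ ab)].
  move=> _ [n _ <-]; rewrite /= -(ltr_nat R) fE gtr_pMr //.
  by case/andP: (A01n n).
move/not_implyP: hab => [ab /contrapT E].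
exists (iter a (@ordS p) i), (iter a F t), (b - a)%N; split.
- exact: A_iter.
- by rewrite subn_gt0.
- by rewrite -iterD subnK ?(ltnW ab).
Qed.

Lemma common_even_period : exists n, [/\ (0 < n)%N, ~~ odd n &
  forall i t, A i t -> iter n F t = t].
Proof.
have [i [t [n [At n0 E]]]] := periodic_angle_exists.
exists (2 * n)%N; split; [by rewrite muln_gt0 | by rewrite oddM |].
move=> m s As; apply: (@fixed_everywhere i m _ t s) => //.
- by rewrite muln_gt0.
- by rewrite oddM.
- exact: iter_mul.
Qed.

Lemma p_gt0 : (0 < p)%N.
Proof. by have [i _] := Arat; apply: leq_ltn_trans (ltn_ord i). Qed.

Lemma A_nonempty i : A i !=set0.
Proof.
have [m [q Aq]] := Arat; have [l hl] := iter_ordS_reach m i.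
by exists (iter l F (mod1 (ratr q))); rewrite -hl; exact: A_iter.
Qed.

(** An even iterate F^n is multiplication by d^n modulo 1, so an angle that it fixes is a multiple
    of 1/(d^n - 1). Finiteness and rationality follow together. *)
Lemma common_denominator : exists2 N, (0 < N)%N & forall i t, A i t ->
  exists2 k, (k < N)%N & t = k%:R / N%:R.
Proof.
have [n [n0 nodd hn]] := common_even_period.
have dn : (1 < d ^ n)%N by rewrite -(expn0 d) ltn_exp2l.
exists (d ^ n).-1; first by rewrite -ltnS prednK // ltnW.
move=> i t At; have /andP[t0 t1] := A01 At.
have F0 k : iter k F 0 = 0.
  by elim: k => // k IH; rewrite iterS IH /F /angle_map mulr0 oppr0 mod1_id // lexx ltr01.
have := iter_arclen n 0 t; rewrite F0 (hn _ _ At) /arclen !subr0 mod1_id ?t0 //.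
rewrite exprNn -signr_odd (negbTE nodd) expr0 mul1r -natrX => E.
have [k hk] := mod1E ((d ^ n)%:R * t); rewrite -E in hk.
have NR0 : 0 < (d ^ n).-1%:R :> R by rewrite ltr0n -ltnS prednK // ltnW.
have hN : (d ^ n).-1%:R * t = (- k)%:~R.
  have : (d ^ n)%:R = (d ^ n).-1%:R + 1 :> R by rewrite natr1 prednK // ltnW.
  by rewrite intrN; move: hk => /[swap] ->; rewrite mulrDl mul1r; lra.
have k0 : 0 <= - k by rewrite -(ler0z R) -hN mulr_ge0 // ltW.
have kE : (- k)%:~R = `|k|%N%:R :> R by rewrite -abszN pmulrn gez0_abs.
have tE : t = `|k|%N%:R / (d ^ n).-1%:R by rewrite -kE -hN mulrC mulKf ?gt_eqF.
by exists `|k|%N => //; rewrite -(ltr_nat R) -kE -hN gtr_pMr.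
Qed.

Lemma A_finite i : finite_set (A i).
Proof.
have [N N0 hN] := common_denominator.
apply: (@sub_finite_set _ _ ((fun k : nat => k%:R / N%:R : R) @` `I_N)).
  by move=> t /hN[k kN ->]; exists k.
by apply: finite_image; exact: finite_II.
Qed.

Lemma A_rational i t : A i t -> exists q : rat, t = ratr q.
Proof.
have [N N0 hN] := common_denominator; move=> /hN[k _ ->].
by exists (k%:R / N%:R); rewrite fmorph_div !rmorph_nat.
Qed.

Lemma A_periodic i t : A i t -> exists n, has_period d t n.
Proof.
move=> At; have [n [n0 _ hn]] := common_even_period.
have ex : exists n, (0 < n)%N && (iter n F t == t).
  by exists n; rewrite n0; apply/eqP; exact: hn At.
case: (ex_minnP ex) => m /andP[m0 /eqP hm] hmin; exists m; split => //.
move=> k /andP[k0 km] hk; have := hmin k; rewrite k0 -/F hk eqxx => /(_ isT).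
by rewrite leqNgt km.
Qed.

Lemma A_bij i : set_bij (A i) (A (ordS i)) F.
Proof.
have [n [n0 _ hn]] := common_even_period.
split.
- by move=> t At; exact: AF.
- by move=> a b /set_mem Aa /set_mem Ab; exact: F_inj Aa Ab.
- move=> s As; exists (iter n.-1 F s); last first.
    by rewrite -iterS prednK // (hn _ _ As).
  have := A_iter n.-1 As; rewrite -iterSr prednK //.
  have -> : iter n (@ordS p) i = i; last by [].
  have [t At] := A_nonempty i.
  by apply/eqP; rewrite iter_ordS_fixed; apply: iter_cycle n0 At (hn _ _ At).
Qed.

Lemma F_rev_cyclic i : reverses_cyclic_order F (A i).
Proof.
move=> a b c Aa Ab Ac; have a01 := A01 Aa; have b01 := A01 Ab; have c01 := A01 Ac.
have fa01 := A01 (AF Aa); have fb01 := A01 (AF Ab); have fc01 := A01 (AF Ac).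
by rewrite !cyclicE //; exact: F_rev Aa Ab Ac.
Qed.

(** Seen from x = a0 + e, let a' be the first and a the last angle. If their distance exceeded e,
    then a' + e would lie strictly between them, and the translated pair {a0, a'} + e would separate
    a' from a. *)
Lemma A_in_arc i : exists s l : R, 0 <= l < e /\ A i `<=` circle_arc s l.
Proof.
have [a0 Aa0] := A_nonempty i; pose x := a0 + e.
have [a' Aa' ha'] := argmin_finite (arclen x) (A_finite i) (A_nonempty i).
have [a Aa ha] := argmax_finite (arclen x) (A_finite i) (A_nonempty i).
have la : arclen a' a = arclen x a - arclen x a' by apply: arclen_sub; exact: ha.
exists a', (arclen a' a); split.
  rewrite arclen_ge0 /= ltNge; apply/negP => le.
  have e1 : arclen x (a' + e) = arclen x a' + e.
    by apply: arclenDl; [rewrite ltW // e_gt0 | have := arclen_lt1 x a; lra].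
  have e2 : arclen x (a' + e) = arclen a0 a' by rewrite /x arclenDr.
  have n1 : arclen a' a != e.
    apply/eqP => E; apply: (dis1 Aa' Aa); rewrite (@arclen_sub R x) e1; lra.
  have le' : e < arclen a' a by rewrite lt_neqAle eq_sym n1.
  apply: (@unl1 i a0 a' a' a) => //; rewrite -/x -e2 e1; first by rewrite ltrDl e_gt0.
  by lra.
move=> y Ay; exists (a' + (arclen x y - arclen x a')).
  rewrite /= in_itv /= la lerDl lerD2l lerD2r ha // subr_ge0 ha' //.
have [k1 h1] := mod1E (y - x); have [k2 h2] := mod1E (a' - x).
by apply: (@mod1_uniq _ _ _ (k1 - k2)); rewrite ?A01 // /arclen ?h1 ?h2 ?intrD ?intrN; [exact: A01 Ay | lra].
Qed.

Lemma arclen_translate (j k : nat) : (j < d)%N -> (k < d)%N ->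
  exists l : nat, [/\ (l < d)%N, (l == 0%N) = (j == k) &
   forall t s, arclen (mod1 (t + j%:R / d%:R)) (mod1 (s + k%:R / d%:R)) = arclen (t + l%:R / d%:R) s].
Proof.
move=> jd kd; have d0 : d%:R != 0 :> R by rewrite gt_eqF // dR_gt0.
have [kj|jk] := leqP k j.
  exists (j - k)%N; split.
  - by apply: leq_ltn_trans jd; exact: leq_subr.
  - by rewrite subn_eq0; apply/idP/eqP; lia.
  move=> t s; rewrite arclen_mod1 -(arclenDr _ _ (- (k%:R / d%:R))) addrK natrB // mulrBl.
  by rewrite addrA.
exists (j + d - k)%N; split.
- lia.
- by apply/idP/eqP; lia.
move=> t s; rewrite arclen_mod1 -(arclenDr _ _ (- (k%:R / d%:R))) addrK.
apply/mod1_eqP; exists 1; rewrite natrB; last by lia.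
rewrite natrD mulrBl mulrDl divff //; lra.
Qed.

Lemma translates_unlinked i m (j k : nat) : (j < d)%N -> (k < d)%N -> (m != i) || (j != k) ->
  unlinked (translate (j%:R / d%:R) (A i)) (translate (k%:R / d%:R) (A m)).
Proof.
move=> jd kd mj; have [l [ld l0 arclenE]] := arclen_translate jd kd.
have tl h (n : nat) x : translate (n%:R / d%:R) (A h) x -> 0 <= x < 1.
  by move=> [t _ <-]; exact: mod1_itv.
apply: finite_sets_unlinked; [exact: tl | exact: tl | | | |  |].
- by apply: finite_image; exact: A_finite.
- by have [t At] := A_nonempty i; exists (mod1 (t + j%:R / d%:R)); exists t.
- by have [t At] := A_nonempty m; exists (mod1 (t + k%:R / d%:R)); exists t.
- by move=> _ _ [t At <-] [s As <-]; rewrite arclenE; apply: dis At As => //; rewrite l0.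
move=> _ _ _ _ [t1 At1 <-] [t2 At2 <-] [s1 As1 <-] [s2 As2 <-].
have -> : arclen (mod1 (t1 + j%:R / d%:R)) (mod1 (t2 + j%:R / d%:R)) = arclen t1 t2.
  by rewrite arclen_mod1 arclenDr.
by rewrite !arclenE; apply: (unl ld _ At1 At2 As1 As2); rewrite l0.
Qed.

Lemma even_periods : ~~ odd p -> exists r : nat, (1 <= r)%N /\
  forall i t, A i t -> has_period d t (r * p).
Proof.
move=> podd; have [i0 _] := Arat; have [t At] := A_nonempty i0.
have [n [n0 hn hmin]] := A_periodic At.
have even k m s : (0 < k)%N -> A m s -> iter k F s = s -> ~~ odd k.
  move=> k0 As hk; have /dvdnP[q ->] := iter_cycle k0 As hk.
  by rewrite oddM (negbTE podd) andbF.
have pn := iter_cycle n0 At hn.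
exists (n %/ p)%N; rewrite divn_gt0 ?p_gt0 // dvdn_leq // divnK //; split => // m s As.
split => //; first exact: fixed_everywhere n0 (even _ _ _ n0 At hn) At As hn.
move=> k /andP[k0 kn] hk; apply: (hmin k); first by rewrite k0.
exact: fixed_everywhere k0 (even _ _ _ k0 As hk) As At hk.
Qed.

(* The open arc from a to b is a component of the complement of A i. *)
Definition adj i a b := [/\ A i a, A i b, a <> b & forall y, A i y -> ~~ cyc a y b].

Lemma cyc_neq a b c : cyc a b c -> [/\ a <> b, b <> c & a <> c].
Proof.
move=> /andP[h1 h2]; split => E.
- by move: h1; rewrite E arclenxx ltxx.
- by move: h2; rewrite E ltxx.
- by move: h2; rewrite E arclenxx ltNge arclen_ge0.
Qed.

Lemma adj_next i a b : A i a -> A i b -> b <> a -> exists c, adj i a c.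
Proof.
move=> Aa Ab ba; pose B := A i `\ a.
have fB : finite_set B by apply: (@sub_finite_set _ _ (A i)); [move=> x [] | exact: A_finite].
have [|c [Ac ca] hc] := argmin_finite (arclen a) fB; first by exists b.
exists c; split => //; first by move=> E; apply: ca.
move=> y Ay; apply/negP => acy; have [ay _ _] := cyc_neq acy.
have : arclen a c <= arclen a y by apply: hc; split => // E; apply: ay.
by move: acy => /andP[_]; rewrite ltNge => /negP.
Qed.

Lemma adj_gt0 i a b : adj i a b -> 0 < arclen a b.
Proof. by move=> [Aa Ab ab _]; apply: arclen_gt0 => //; apply: A01; eassumption. Qed.

Lemma adj_le i a b y : adj i a b -> A i y -> y <> a -> arclen a b <= arclen a y.
Proof.
move=> [Aa Ab ab h] Ay ya; move: (h y Ay); rewrite /cyc negb_and -!leNgt.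
have -> : (arclen a y <= 0) = false; last by [].
apply/negbTE; rewrite -ltNge; apply: arclen_gt0; [exact: A01 Aa | exact: A01 Ay |].
by move=> E; apply: ya.
Qed.

Lemma adj_next_uniq i a b b' : adj i a b -> adj i a b' -> b = b'.
Proof.
move=> h h'; have [Aa Ab ab _] := h; have [_ Ab' ab' _] := h'.
have h1 := adj_le h Ab' (fun E => ab' (esym E)).
have h2 := adj_le h' Ab (fun E => ab (esym E)).
apply: arclen_eq0; [exact: A01 Ab | exact: A01 Ab' |].
by rewrite (@arclen_sub R a) //; lra.
Qed.

Lemma adj_prev_uniq i a a' b : adj i a b -> adj i a' b -> a = a'.
Proof.
move=> [Aa Ab ab h] [Aa' _ a'b h']; apply: contrapT => aa'.
have [c|c] := cyc_total (A01 Aa) (A01 Aa') (A01 Ab) aa' a'b ab.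
  by move: (h _ Aa'); rewrite c.
by move: (h' _ Aa); rewrite (cyc_rot (cyc_rot c)).
Qed.

Lemma adj_F i a b : adj i a b -> adj (ordS i) (F b) (F a).
Proof.
move=> [Aa Ab ab h]; split; [exact: AF | exact: AF | |].
  by move=> E; apply: ab; exact: F_inj Aa Ab (esym E).
have [_ _ surj] := A_bij i.
move=> _ /surj[y Ay <-]; apply/negP => c; have [n1 n2 _] := cyc_neq c.
have ay : a <> y by move=> E; apply: n2; rewrite E.
have yb : y <> b by move=> E; apply: n1; rewrite E.
have [c'|c'] := cyc_total (A01 Aa) (A01 Ay) (A01 Ab) ay yb ab.
  by move: (h _ Ay); rewrite c'.
exact: cyc_asym c (cyc_rot (F_rev Aa Ab Ay c')).
Qed.

Lemma adj_pre i x y : adj (ordS i) x y -> exists a b, [/\ adj i a b, x = F b & y = F a].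
Proof.
move=> [Ax Ay xy h]; have [_ _ surj] := A_bij i.
have [b Ab bx] := surj _ Ax; have [a Aa ay] := surj _ Ay.
exists a, b; split => //; split => //; first by move=> E; apply: xy; rewrite -bx -ay E.
move=> z Az; apply/negP => /(F_rev Aa Az Ab) c.
by move: (h _ (AF Az)); rewrite -bx -ay c.
Qed.

(** The endpoints are exchanged at each step because F reverses orientation; the pair again
    describes a counterclockwise arc. *)
Definition turn n (ab : R * R) : R * R :=
  if odd n then (iter n F ab.2, iter n F ab.1) else (iter n F ab.1, iter n F ab.2).

Lemma turnS n ab : turn n.+1 ab = (F (turn n ab).2, F (turn n ab).1).
Proof. by rewrite /turn oddS; case: (odd n). Qed.

Lemma adj_turn n i a b : adj i a b ->
  adj (iter n (@ordS p) i) (turn n (a, b)).1 (turn n (a, b)).2.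
Proof. by move=> h; elim: n => // n IH; rewrite turnS; exact: adj_F. Qed.

Lemma iter_p_A i t : A i t -> A i (iter p F t).
Proof.
move=> /(A_iter p); suff -> : iter p (@ordS p) i = i by [].
by apply/eqP; rewrite iter_ordS_fixed.
Qed.

(* A reflection of a finite cyclic order fixes a point or exchanges two adjacent
   ones: look at the shortest arc from x to its image. *)
Lemma iter_2p : odd p -> forall i t, A i t -> iter (2 * p) F t = t.
Proof.
move=> podd; have [i0 _] := Arat; set h := iter p F.
suff [t0 At0 ht0] : exists2 t0, A i0 t0 & iter (2 * p) F t0 = t0.
  move=> i t At; apply: (@fixed_everywhere i0 i _ t0) => //.
    by rewrite muln_gt0 p_gt0.
  by rewrite oddM.
have hh t : h (h t) = t -> iter (2 * p) F t = t by rewrite mul2n -addnn iterD.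
have [x Ax hx] := argmin_finite (fun x => arclen x (h x)) (A_finite i0) (A_nonempty i0).
exists x => //; apply: hh.
have Ahx := iter_p_A Ax.
have [E|/eqP ne] := eqVneq (h x) x; first by rewrite E.
have [x' xx'] := adj_next Ax Ahx ne; have [_ Ax' nx' _] := xx'.
have ipi : iter p (@ordS p) i0 = i0 by apply/eqP; rewrite iter_ordS_fixed.
have hadj : adj i0 (h x') (h x).
  by have := adj_turn p xx'; rewrite ipi /turn podd.
have [E|/eqP ne'] := eqVneq x' (h x).
  by rewrite -E; apply: (@adj_prev_uniq i0 _ _ x') => //; rewrite {2}E.
have Ahx' := iter_p_A Ax'.
have [E|/eqP ne''] := eqVneq (h x') x'.
  exfalso; have := hx _ Ax'; rewrite E arclenxx; have := arclen_gt0 (A01 Ax) (A01 Ahx) (fun E => ne (esym E)).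
  by rewrite ltNge => /negP.
have ne3 : h x' <> h x.
  by move=> E; apply: nx'; exact/esym/(iter_inj Ax' Ax E).
have [_ _ _ hno] := hadj.
have [c|c] := cyc_total (A01 Ahx') (A01 Ax') (A01 Ahx) ne'' ne' ne3.
  by move: (hno _ Ax'); rewrite c.
(* Now h x' lies between x' and h x, and x' between x and h x: the arc from x' to its image is
   shorter than the minimal one. *)
have {}c := cyc_rot (cyc_rot c).
have lx := adj_le xx' Ahx ne.
have l2 : arclen x' (h x) < arclen x (h x) by rewrite (@arclen_sub R x) // gtrBl (adj_gt0 xx').
have := hx _ Ax'; rewrite leNgt => /negP; case.
by apply: lt_trans l2; move: c => /andP[].
Qed.

(** The critical arc is unique: by [pair_spread] the complement of an arc of length at least 1/d is
    shorter than 1/d, and it contains all other components. *)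
Lemma big_arc_uniq i a b a' b' : adj i a b -> adj i a' b' ->
  e <= arclen a b -> e <= arclen a' b' -> a = a'.
Proof.
move=> h h' eab ea'b'; have [Aa Ab ab _] := h; have [Aa' Ab' ab' no'] := h'.
apply: contrapT => aa'.
have u0 := adj_gt0 h; have u0' := adj_gt0 h'.
have lba : arclen b a < e by case: (pair_spread Aa Ab ab) => //; lra.
rewrite (arclenC u0) in lba.
have ua' := adj_le h Aa' (fun E => aa' (esym E)).
have a'a : arclen a' a = 1 - arclen a a' by apply: arclenC; lra.
have [E|/eqP ne] := eqVneq b' a; first by move: ea'b'; rewrite E a'a; lra.
have ub' := adj_le h Ab' ne; have lb' := arclen_lt1 a b'.
have [l|l] := leP (arclen a a') (arclen a b').
  by move: ea'b'; rewrite (arclen_sub l); lra.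
have : cyc a' a b' by rewrite /cyc a'a (arclen_sub1 l); have := arclen_lt1 a a'; lra.
by move: (no' _ Aa) => /negP.
Qed.

(* Arcs that are images of the critical arc: they contain the critical value. *)
Definition value_arc i x y := exists k a b,
  [/\ adj k a b, e <= arclen a b, ordS k = i & (x, y) = (F b, F a)].

Lemma value_arc_uniq i x y x' y' : value_arc i x y -> value_arc i x' y' -> x = x' /\ y = y'.
Proof.
move=> [k [a [b [h l <- [-> ->]]]]] [k' [a' [b' [h' l' kk' [-> ->]]]]].
have k'k : k' = k by apply: (@ordS_inj p).
rewrite k'k in h'; have E := big_arc_uniq h h' l l'; rewrite -E in h' *.
by rewrite (adj_next_uniq h h').
Qed.

Lemma ordS_pre i : exists k, ordS k = i.
Proof.
exists (iter p.-1 (@ordS p) i); rewrite -iterS prednK ?p_gt0 //.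
by apply/eqP; rewrite iter_ordS_fixed.
Qed.

Lemma shortest_arc i a b : adj i a b ->
  exists m x y, adj m x y /\ forall k x' y', adj k x' y' -> arclen x y <= arclen x' y'.
Proof.
move=> hab; have [N N0 hN] := common_denominator.
pose S := [set q : 'I_p * (R * R) | adj q.1 q.2.1 q.2.2].
have fS : finite_set S.
  pose U := (fun k : nat => k%:R / N%:R : R) @` `I_N.
  have fU : finite_set U by apply: finite_image; exact: finite_II.
  apply: (@sub_finite_set _ _ ([set: 'I_p] `*` (U `*` U))).
    move=> [k [x y]] [/= Ax Ay _ _]; split => //; split.
      by have [j jN ->] := hN _ _ Ax; exists j.
    by have [j jN ->] := hN _ _ Ay; exists j.
  by apply: finite_setX; [exact: finite_finset | exact: finite_setX].
have [|[m [x y]] /= hm hmin] := argmin_finite (fun q : 'I_p * (R * R) => arclen q.2.1 q.2.2) fS.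
  by exists (i, (a, b)).
by exists m, x, y; split => // k x' y' h; exact: (hmin (k, (x', y'))).
Qed.

(** Pulling back through an arc shorter than 1/d divides the length by d. As no length is below the
    minimum [mu], the backward walk stops, at the image of a critical arc; forward lengths only grew
    on the way. *)
Lemma trace_value_arc i x y : adj i x y -> exists k u v n,
  [/\ adj k u v, value_arc k u v, arclen u v <= arclen x y & (x, y) = turn n (u, v)].
Proof.
move=> hxy; have [m0 [a0 [b0 [h0 hmin]]]] := shortest_arc hxy.
set mu := arclen a0 b0 in hmin; have mu0 : 0 < mu := adj_gt0 h0.
have claim N : forall i x y, adj i x y -> arclen x y < d%:R ^+ N * mu -> exists k u v n,
    [/\ adj k u v, value_arc k u v, arclen u v <= arclen x y & (x, y) = turn n (u, v)].
  elim: N => [|N IH] {hxy x y}i x y hxy.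
    by rewrite expr0 mul1r ltNge (hmin _ _ _ hxy).
  have [k ki] := ordS_pre i; rewrite -ki in hxy.
  have [a [b [hab xE yE]]] := adj_pre hxy.
  have [l|l] := leP e (arclen a b).
    move=> _; exists (ordS k), x, y, 0%N; split => //.
    by exists k, a, b; rewrite xE yE.
  rewrite xE yE (arclen_map_small l) exprS -mulrA ltr_pM2l ?dR_gt0 //.
  move=> /(IH _ _ _ hab)[k' [u [v [n [h1 h2 h3 h4]]]]].
  exists k', u, v, n.+1; split => //; last by rewrite turnS -h4.
  apply: le_trans h3 _; rewrite ler_peMl ?arclen_ge0 //.
  by rewrite ler1n ltnW.
have [N hN] : exists N, arclen x y < d%:R ^+ N * mu.
  have d1R : 1 < d%:R :> R by rewrite ltr1n.
  have [n0 hn0] := expr_expn_gt d1 d1R (mu^-1).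
  exists (d ^ n0)%N; apply: lt_trans (arclen_lt1 _ _) _.
  by rewrite -ltr_pdivrMr // mul1r; exact: hn0.
exact: claim hxy hN.
Qed.

(** x is the last angle of A i before some s0 in A j. An angle of A j beyond the next angle y would
    alternate with s0 across x and y. *)
Lemma containing_arc i j t t' : i != j -> A i t -> A i t' -> t' <> t ->
  exists x y, adj i x y /\ forall s, A j s -> arclen x s < arclen x y.
Proof.
move=> ij At At' tt'; have [s0 As0] := A_nonempty j.
have [x Ax hx] := argmin_finite (fun x => arclen x s0) (A_finite i) (A_nonempty i).
have [y xy] : exists y, adj i x y.
  have [E|/eqP ne] := eqVneq x t; first by apply: adj_next At' _; rewrite E.
  by apply: adj_next At _ => // E; apply: ne.
have [_ Ay _ _] := xy; have lxy := adj_gt0 xy.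
have l0 : arclen x s0 < arclen x y.
  rewrite ltNge; apply/negP => l; have := hx _ Ay.
  by rewrite (arclen_sub l); lra.
exists x, y; split => // s As; rewrite ltNge; apply/negP => l.
have [E|/eqP ne] := eqVneq (arclen x s) (arclen x y).
  suff ys : y = s by move: Ay; rewrite ys => Ay; move: ij; rewrite (Adisj Ay As) eqxx.
  apply: arclen_eq0; [exact: A01 Ay | exact: A01 As |].
  by rewrite (arclen_sub l) E subrr.
apply: (@unl i j 0 x y s0 s) => //.
- exact: ltnW.
- by rewrite eq_sym ij.
- by rewrite mul0r addr0.
- by rewrite mul0r addr0 lt_neqAle l andbT eq_sym; apply/eqP.
Qed.

(** All components of A i lie inside the component of A j that contains A i, except the one that
    contains A j. The exception starts at x0. *)
Lemma contained_arc i j x0 y0 y1 y2 x y : i != j ->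
  adj i x0 y0 -> (forall s, A j s -> arclen x0 s < arclen x0 y0) ->
  adj j y1 y2 -> (forall s, A i s -> arclen y1 s < arclen y1 y2) ->
  adj i x y -> x <> x0 -> arclen x y < arclen y1 y2.
Proof.
move=> ij h0 c0 h1 c1 h xx0; have [Ax Ay xy no] := h; have [Ay1 _ _ _] := h1.
have [Ax0 _ _ _] := h0.
have lx := c1 _ Ax; have ly := c1 _ Ay.
have [l|l] := leP (arclen y1 x) (arclen y1 y).
  by rewrite (arclen_sub l); have := arclen_ge0 y1 x; lra.
exfalso.
have p1 : 0 < arclen y1 x by apply: le_lt_trans l; exact: arclen_ge0.
have p2 : 0 < arclen y1 y.
  apply: arclen_gt0; [exact: A01 Ay1 | exact: A01 Ay |] => E.
  by move: ij; rewrite E in Ay1; rewrite (Adisj Ay Ay1) eqxx.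
have l1 := adj_le h0 Ax xx0; have l2 := c0 _ Ay1.
have p3 : 0 < arclen x0 x by apply: lt_le_trans l1; exact: adj_gt0 h0.
have : cyc x x0 y.
  rewrite /cyc (arclenC p3) (arclen_sub1 l).
  have E1 := arclenC p1; rewrite (@arclen_sub1 R x0) in E1; last by lra.
  have := arclen_lt1 x0 x; have := arclen_ge0 x0 y1; lra.
by move: (no _ Ax0) => /negP.
Qed.

Lemma arclen_between a b c : arclen b c < arclen a c -> arclen a b = arclen a c - arclen b c.
Proof.
move=> h; have [k1 e1] := mod1E (c - a); have [k2 e2] := mod1E (c - b).
apply: (@mod1_uniq _ _ _ (k2 - k1)).
  by have := arclen_ge0 b c; have := arclen_lt1 a c; lra.
by rewrite /arclen e1 e2 intrD intrN; lra.
Qed.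

(** The full preimage of the image of a short arc consists of its d translates. The translate to use
    is given by the integer part of d times the distance from t to a. *)
Lemma preimage_arc j a b t : arclen b a < e -> 0 <= t < 1 -> arclen (F a) (F t) < arclen (F a) (F b) ->
  exists l : nat, (l < d)%N /\ arclen (t + l%:R / d%:R) a < arclen b a.
Proof.
move=> lba t01; rewrite (arclen_map_small lba) arclen_map /mod1.
set u := arclen t a; set k := Num.floor _ => h.
have u0 : 0 <= u by exact: arclen_ge0.
have u1 : u < 1 by exact: arclen_lt1.
have dR := dR_gt0.
have /andP[f1 f2] := floor_itv (d%:R * u); rewrite -/k in f1 f2.
have k0 : 0 <= k.
  by rewrite /k floor_ge0 mulr_ge0 // ltW.
have kE : k%:~R = `|k|%N%:R :> R by rewrite pmulrn gez0_abs.
have kd : (`|k| < d)%N.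
  by rewrite -(ltr_nat R) -kE; apply: le_lt_trans f1 _; rewrite gtr_pMr.
exists `|k|%N; split => //.
have kdu : `|k|%N%:R / d%:R <= u by rewrite ler_pdivrMr // -kE mulrC.
have sh : arclen t (t + `|k|%N%:R / d%:R) = `|k|%N%:R / d%:R.
  by apply: arclen_shift; rewrite divr_ge0 ?ler0n //= ltr_pdivrMr // mul1r ltr_nat.
rewrite (@arclen_sub R t) sh -/u // -(ltr_pM2l dR) mulrBr mulrCA divff ?gt_eqF // mulr1 -kE.
exact: h.
Qed.

(** Some translate of beta falls into the arc from b to a. Unlinkedness brings the same translate of
    alpha there too, and as all arcs are shorter than half the circle, the translated arc runs
    inside the larger one and not around it. *)
Lemma nested_arc i j alpha beta a b : i != j -> adj j b a -> arclen b a < e ->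
  (forall s, A (ordS i) s -> arclen (F a) s < arclen (F a) (F b)) ->
  adj i beta alpha -> arclen beta alpha < e -> arclen beta alpha < arclen b a.
Proof.
move=> ij hba lba c hbe lbe; have [Ab Aa _ _] := hba; have [Abe Aal nba _] := hbe.
have [l [ld lB]] := preimage_arc j lba (A01 Abe) (c _ (AF Abe)).
set B := beta + _ in lB; pose C := alpha + l%:R / d%:R.
have BC : arclen B C = arclen beta alpha by rewrite /B /C arclenDr.
have ji : (j != i) || (l != 0%N) by rewrite eq_sym ij.
have bB := arclen_between lB.
have pbB : 0 < arclen b B by rewrite bB subr_gt0.
have Bb := arclenC pbB.
have lC : arclen C a < arclen b a.
  rewrite ltNge; apply/negP => lC.
  have h1 : arclen B a < arclen B C.
    rewrite ltNge le_eqVlt; apply/negP => /orP[/eqP E|E].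
      by apply: (dis ld ji Aal Aa); rewrite -/C (@arclen_sub R B) ?E ?subrr.
    by move: lC; rewrite (@arclen_sub R B C a) ?(ltW E) //; have := arclen_ge0 B C; lra.
  have h2 : arclen B C < arclen B b.
    rewrite ltNge le_eqVlt; apply/negP => /orP[/eqP E|E].
      have := dis ld ji Aal Ab; rewrite -/C => D; apply: D.
      by rewrite (@arclen_sub R B) ?E ?subrr.
    have bC : arclen b C = arclen B C - arclen B b by apply: arclen_sub; exact: ltW.
    have lba1 := arclen_lt1 B C.
    by move: lC; rewrite (@arclen_sub R b C a) bC Bb bB; have := arclen_ge0 B a; lra.
  by apply: (unl ld ji Abe Aal Aa Ab); rewrite -/B -BC.
have [h|h|h] := ltgtP (arclen C a) (arclen B a).
- by rewrite -BC (arclen_between h); have := arclen_ge0 C a; lra.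
- have CB := arclen_between h; have pCB : 0 < arclen C B by rewrite CB subr_gt0.
  by move: lbe; rewrite -BC (arclenC pCB) CB; have := e_le_half; have := arclen_ge0 B a; lra.
exfalso; apply: nba; apply: arclen_eq0; [exact: A01 Abe | exact: A01 Aal |].
rewrite -BC; have [k1 e1] := mod1E (a - B); have [k2 e2] := mod1E (a - C).
apply: (@mod1_uniq _ _ _ (k2 - k1)); first by rewrite lexx ltr01.
by move: h; rewrite /arclen e1 e2 intrD intrN; lra.
Qed.

(* If neither arc is a critical value arc, both pull back to short arcs, each of
   which would be strictly shorter than the other one. *)
Lemma nested_arcs_absurd i j x0 y0 y1 y2 : i != j ->
  adj (ordS i) x0 y0 -> (forall s, A (ordS j) s -> arclen x0 s < arclen x0 y0) ->
  adj (ordS j) y1 y2 -> (forall s, A (ordS i) s -> arclen y1 s < arclen y1 y2) ->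
  ~ value_arc (ordS i) x0 y0 -> ~ value_arc (ordS j) y1 y2 -> False.
Proof.
move=> ij h0 c0 h1 c1 nv0 nv1.
have [a [b [hab xE yE]]] := adj_pre h0; have [a' [b' [hab' xE' yE']]] := adj_pre h1.
have l : arclen a b < e.
  by rewrite ltNge; apply/negP => l; apply: nv0; exists i, a, b; rewrite xE yE.
have l' : arclen a' b' < e.
  by rewrite ltNge; apply/negP => l'; apply: nv1; exists j, a', b'; rewrite xE' yE'.
rewrite xE yE in c0; rewrite xE' yE' in c1.
have := nested_arc ij hab' l' c1 hab l.
by rewrite ltNge ltW // (nested_arc _ hab l c0 hab' l') // eq_sym.
Qed.

(** * Odd period: at most three angles *)

Section Odd.
Hypothesis podd : odd p.
Hypothesis two : forall i t, A i t -> exists2 s, A i s & s <> t.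
Variables (m : 'I_p) (a b : R).
Hypotheses (hab : adj m a b) (shortest : forall k x y, adj k x y -> arclen a b <= arclen x y).
Let h := iter p F.

(** Otherwise its preimage arc would be shorter by the factor d. *)
Lemma shortest_is_value : value_arc m a b.
Proof.
have [k km] := ordS_pre m; move: hab; rewrite -km => hab'.
have [a' [b' [hab'' xE yE]]] := adj_pre hab'.
have [l|l] := leP e (arclen a' b'); first by exists k, a', b'; rewrite xE yE.
exfalso; have := shortest hab''; rewrite xE yE (arclen_map_small l).
have := adj_gt0 hab''; have : 2 <= d%:R :> R by rewrite ler_nat.
by move: (d%:R : R) (arclen a' b') => D u; nra.
Qed.

(* An arc of A m outside the h-orbit of the shortest one comes from the critical
   value arc of some A k with k != m. That arc contains A m, and A k lies inside
   the arc we started from, which hence exceeds all the other ones. *)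
Lemma dominant_arc x y x' y' : adj m x y -> x <> a -> x <> h b ->
  adj m x' y' -> x' <> x -> arclen x' y' < arclen x y.
Proof.
move=> hxy xa xhb hxy' xx'; have [k [u [v [n [huv val luv E]]]]] := trace_value_arc hxy.
have [km|km] := eqVneq k m.
  exfalso; rewrite km in huv val.
  have [ua vb] := value_arc_uniq val shortest_is_value.
  have [Ax _ _ _] := hxy; have [Aa Ab _ _] := hab.
  rewrite ua vb in E; have xE : x = (turn n (a, b)).1 := congr1 fst E.
  have pn : (p %| n)%N.
    rewrite -(iter_ordS_fixed m); apply/eqP; apply: Adisj Ax.
    by have [+ _ _ _] := adj_turn n hab; rewrite -xE.
  (* As h is an involution, the parity of q decides between the only two arcs in the h-orbit of the
     shortest one; they start at a and at h b. *)
  move/dvdnP: pn => [q nE]; move: xE; rewrite nE /turn oddM podd andbT /=.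
  have H2 s l : A m s -> iter (l * 2 * p) F s = s.
    by move=> As; rewrite -mulnA; apply: iter_mul; exact: iter_2p podd _ _ As.
  case: ifP => qodd; rewrite -(odd_double_half q) qodd -muln2.
    by rewrite /= mulnDl mul1n iterD (H2 b) // => xE; apply: xhb.
  by rewrite /= add0n (H2 a).
have mk : m != k by rewrite eq_sym.
have [Aa Ab ab _] := hab; have [Au Av uv _] := huv.
have [x0 [y0 [h0 c0]]] := containing_arc mk Aa Ab (fun E => ab (esym E)).
have [y1 [y2 [h1 c1]]] := containing_arc km Au Av (fun E => uv (esym E)).
(* If the shortest arc contained A k, all components of A k but one would be shorter still. *)
have x0a : x0 <> a.
  move=> x0a; rewrite x0a in h0 c0.
  have y0b := adj_next_uniq h0 hab; rewrite y0b in h0 c0.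
  have [Ay1 _ _ _] := h1; have [w Aw wy] := two Ay1.
  have [w' hw] := adj_next Aw Ay1 (fun yw => wy (esym yw)).
  have := contained_arc km h1 c1 h0 c0 hw wy.
  by rewrite ltNge (shortest hw).
have nv0 : ~ value_arc m x0 y0.
  by move=> /value_arc_uniq/(_ shortest_is_value)[].
(* Otherwise neither of the two containing arcs is a critical value arc, which [nested_arcs_absurd]
   excludes. *)
have y1u : y1 = u.
  apply: contrapT => y1u; have nv1 : ~ value_arc k y1 y2.
    by move=> /value_arc_uniq/(_ val)[].
  have [m' mE] := ordS_pre m; have [k' kE] := ordS_pre k.
  rewrite -mE -kE in mk h0 c0 h1 c1 nv0 nv1.
  apply: (nested_arcs_absurd _ h0 c0 h1 c1 nv0 nv1).
  by apply: contra mk => /eqP ->.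
rewrite y1u in h1 c1; have y2v := adj_next_uniq h1 huv; rewrite y2v in h1 c1.
(* Any component of A m other than the one containing A k is shorter than the arc from u to v,
   against [luv]. *)
have xx0 : x = x0.
  apply: contrapT => xx0; have := contained_arc mk h0 c0 h1 c1 hxy xx0.
  by rewrite ltNge luv.
have := contained_arc mk h0 c0 h1 c1 hxy'; rewrite -xx0 => /(_ xx') H.
exact: lt_le_trans H luv.
Qed.

(** Of two angles other than a and h b, each would begin an arc longer than the one begun by the
    other. *)
Lemma at_most_three : exists c, A m `<=` [set` [:: a; h b; c]].
Proof.
have [[c [Ac ca chb]]|no] := pselect (exists c, [/\ A m c, c <> a & c <> h b]); last first.
  exists a => t At /=; rewrite !inE; apply: contrapT => /negP.
  rewrite !negb_or => /and3P[/eqP ta /eqP tb _]; apply: no; by exists t.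
exists c => t At /=; rewrite !inE; apply: contrapT => /negP.
rewrite !negb_or => /and3P[/eqP ta /eqP tb /eqP tc].
have [c' hc] := adj_next Ac At tc; have [t' ht] := adj_next At Ac (fun E => tc (esym E)).
have := dominant_arc hc ca chb ht tc.
by rewrite ltNge ltW // (dominant_arc ht ta tb hc) // => E; apply: tc.
Qed.
End Odd.

Lemma card_le_seq (B : set R) n (s : seq R) : B #= `I_n -> B `<=` [set` s] -> (n <= size s)%N.
Proof.
rewrite card_eq_sym => /card_set_bijP[f [f1 f2 _]] Bs.
apply: (@pigeonhole n (size s) (fun k => index (f k) s)).
  move=> x y hx hy E; apply: f2 => //.
  have fx : f x \in s by apply: Bs; apply: f1; exact: set_mem hx.
  have fy : f y \in s by apply: Bs; apply: f1; exact: set_mem hy.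
  by rewrite -(nth_index 0 fx) -(nth_index 0 fy) E.
move=> _ [x hx <-]; rewrite /= index_mem; apply: Bs; exact: f1.
Qed.

Lemma card_another (B : set R) n (s : seq R) : B #= `I_n -> (size s < n)%N ->
  exists2 t, B t & t \notin s.
Proof.
move=> Bn sn; apply: contrapT => no.
have : (n <= size s)%N.
  by apply: (card_le_seq Bn) => t Bt /=; apply: contrapT => /negP ts; apply: no; exists t.
by rewrite leqNgt sn.
Qed.

Lemma card_two (B : set R) x y z : B #= `I_2 -> B x -> B y -> B z -> x <> y ->
  z = x \/ z = y.
Proof.
rewrite card_eq_sym => /card_set_bijP[f [_ _ f3]] /f3[i + <-] /f3[j + <-] /f3[k + <-].
by case: i => [|[|]] // _; case: j => [|[|]] // _; case: k => [|[|]] // _; auto.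
Qed.

Lemma card_three (B : set R) x y z w : B #= `I_3 -> B x -> B y -> B z -> B w ->
  x <> y -> y <> z -> x <> z -> [\/ w = x, w = y | w = z].
Proof.
rewrite card_eq_sym => /card_set_bijP[f [_ _ f3]].
move=> /f3[i /= hi <-] /f3[j /= hj <-] /f3[k /= hk <-] /f3[l /= hl <-] xy yz xz.
have ij : i <> j by move=> ij; apply: xy; rewrite ij.
have jk : j <> k by move=> jk; apply: yz; rewrite jk.
have ik : i <> k by move=> ik; apply: xz; rewrite ik.
have [->|[->|->]] : l = i \/ l = j \/ l = k by clear -hi hj hk hl ij jk ik; lia.
- by constructor 1.
- by constructor 2.
- by constructor 3.
Qed.

Lemma period_p i t : A i t -> iter p F t = t -> has_period d t p.
Proof.
move=> At ht; split => //; first exact: p_gt0.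
move=> k /andP[k0 kp] hk; have := iter_cycle k0 At hk.
by move=> /(dvdn_leq k0); rewrite leqNgt kp.
Qed.

Lemma period_2p i t : odd p -> A i t -> iter p F t <> t -> has_period d t (2 * p).
Proof.
move=> podd At ht; split; [by rewrite muln_gt0 p_gt0 | exact: iter_2p podd _ _ At |].
move=> k /andP[k0 kp] hk; have /dvdnP[q kE] := iter_cycle k0 At hk.
move: kp k0 hk; rewrite kE ltn_pmul2r ?p_gt0 //; case: q {kE} => [|[|]] // _ _.
by rewrite mul1n.
Qed.

Lemma card_A n i j : A i #= `I_n -> A j #= `I_n.
Proof.
have [l <-] := iter_ordS_reach i j; elim: l => // l IH /IH h; rewrite iterS.
apply: card_eq_trans h; rewrite card_eq_sym; apply/card_set_bijP; exists F.
exact: A_bij.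
Qed.

Lemma odd_periods : odd p -> ~ trivial_portrait A ->
  [\/ forall j, A j #= `I_2 /\ forall t, A j t -> has_period d t p,
      forall j, A j #= `I_2 /\ forall t, A j t -> has_period d t (2 * p)
    | forall j, A j #= `I_3 /\
       exists t0, [/\ A j t0, has_period d t0 p &
         forall t, A j t -> t <> t0 -> has_period d t (2 * p)]].
Proof.
move=> podd nt; have [i0 _] := Arat; have [n An0] := (finite_setP _).1 (A_finite i0).
have An j : A j #= `I_n by exact: card_A An0.
have n0 : n <> 0%N.
  move=> E; have [t At] := A_nonempty i0; move: (An i0); rewrite E II0.
  by rewrite card_eq0 => /eqP A0; rewrite A0 in At.
have n1 : n <> 1%N by move=> E; apply: nt => j; rewrite -E.
have n2 : (1 < n)%N by case: (n) n0 n1 => [|[|]].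
have two i t : A i t -> exists2 s, A i s & s <> t.
  move=> At; have [|s As st] := @card_another _ _ [:: t] (An i); first exact: n2.
  by exists s => // E; move: st; rewrite E mem_head.
have [t0 At0] := A_nonempty i0; have [s0 As0 st0] := two _ _ At0.
have [b0 hb0] := adj_next At0 As0 st0.
have [m [a [b [hab hmin]]]] := shortest_arc hb0.
have [c hc] := at_most_three podd two hab hmin.
have n3 : (n <= 3)%N := card_le_seq (An m) hc.
have hA i t : A i t -> A i (iter p F t) by exact: iter_p_A.
have hinj i s t : A i s -> A i t -> iter p F s = iter p F t -> s = t by exact: iter_inj.
have hh i t : A i t -> iter p F (iter p F t) = t.
  by move=> At; rewrite -iterD addnn -mul2n; exact: iter_2p podd _ _ At.
have [n_2|n_3] : n = 2 \/ n = 3 by move: n2 n3; clear; lia.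
  rewrite n_2 in An.
  have [[i [t [At ht]]]|nofix] := pselect (exists i t, A i t /\ iter p F t = t).
    constructor 1 => j; split => // s As; apply: (period_p As).
    have [l hl] := iter_ordS_reach i j.
    have Al := A_iter l At; rewrite hl in Al; set t' := iter l F t in Al.
    have ht' : iter p F t' = t' by rewrite /t' iter_comm ht.
    have [E|/eqP ne] := eqVneq s t'; first by rewrite E.
    have [E|//] := card_two (An j) Al As (hA _ _ As) (fun E => ne (esym E)).
    by exfalso; apply: ne; apply: (hinj _ _ _ As Al); rewrite ht'.
  constructor 2 => j; split => // s As; apply: (period_2p podd As) => E.
  by apply: nofix; exists j, s; split.
rewrite n_3 in An; constructor 3 => j; split => //.
have third x y : A j x -> A j y -> exists z, [/\ A j z, z <> x & z <> y].
  move=> Ax Ay; have [//|z Az] := @card_another _ _ [:: x; y] (An j).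
  by rewrite !inE negb_or => /andP[/eqP ? /eqP ?]; exists z.
have fixthird x y z : A j x -> A j y -> A j z -> x <> y -> y <> z -> x <> z ->
    iter p F x = y \/ (iter p F x = x /\ iter p F y = y) -> iter p F z = z.
  move=> Ax Ay Az xy yz xz H.
  have [E|E|//] := card_three (An j) Ax Ay Az (hA _ _ Az) xy yz xz; exfalso.
    case: H => [H|[H _]].
      by apply: yz; rewrite -H -E (hh j).
    by apply: xz; apply: (hinj _ _ _ Ax Az); rewrite H E.
  case: H => [H|[_ H]].
    by apply: xz; apply: (hinj _ _ _ Ax Az); rewrite H E.
  by apply: yz; apply: (hinj _ _ _ Ay Az); rewrite H E.
have [t Ajt ht] : exists2 t, A j t & iter p F t = t.
  (* An involution of three points that exchanges two of them fixes the third. *)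
  have [x Ax] := A_nonempty j; have [E|/eqP ne] := eqVneq (iter p F x) x; first by exists x.
  have [z [Az zx zy]] := third _ _ Ax (hA _ _ Ax).
  exists z => //; apply: (fixthird x (iter p F x) z) => //.
  - exact: hA.
  - by move=> E; apply: ne.
  - by move=> E; apply: zy.
  - by move=> E; apply: zx.
  - by left.
exists t; split => //; first exact: period_p Ajt ht.
(* Two fixed angles would force the third to be fixed, but a map reversing the cyclic order cannot
   fix three points. *)
move=> s As st; apply: (period_2p podd As) => hs.
have [w [Aw wt ws]] := third _ _ Ajt As.
have ts : t <> s by move=> E; apply: st.
have sw : s <> w by move=> E; apply: ws.
have tw : t <> w by move=> E; apply: wt.
have hw : iter p F w = w by apply: (fixthird t s w) => //; right.
have rev x y z : A j x -> A j y -> A j z -> iter p F x = x -> iter p F y = y ->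
    iter p F z = z -> cyc x y z -> False.
  move=> Ax Ay Az ex ey ez xyz; have := iter_cyc p Ax Ay Az xyz.
  rewrite podd ex ey ez => /cyc_rot/cyc_rot; exact: cyc_asym.
have [C|C] := cyc_total (A01 Ajt) (A01 As) (A01 Aw) ts sw tw.
  exact: rev C.
exact: rev C.
Qed.

Theorem portrait_combinatorics : ~ trivial_portrait A ->
  (forall j, [/\ finite_set (A j), A j !=set0 &
     forall t, A j t -> exists q : rat, t = ratr q]) /\
  (forall j, set_bij (A j) (A (ordS j)) (angle_map d) /\
     reverses_cyclic_order (angle_map d) (A j)) /\
  (forall j, exists s l : R, 0 <= l < d%:R^-1 /\ A j `<=` circle_arc s l) /\
  (forall i : 'I_p,
     (forall j k : 'I_d, j != k ->
        unlinked (translate (j%:R / d%:R) (A i))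
                 (translate (k%:R / d%:R) (A i))) /\
     (forall (j : 'I_d) (m : 'I_p), m != i ->
        unlinked (translate (j%:R / d%:R) (A i)) (A m))) /\
  (forall j t, A j t -> exists n, has_period d t n) /\
  (~~ odd p -> exists r : nat, (1 <= r)%N /\
     forall j t, A j t -> has_period d t (r * p)) /\
  (odd p ->
     [\/         forall j, A j #= `I_2 /\ forall t, A j t -> has_period d t p,
         forall j, A j #= `I_2 /\ forall t, A j t -> has_period d t (2 * p)
       |         forall j, A j #= `I_3 /\
           exists t0, [/\ A j t0, has_period d t0 p &
             forall t, A j t -> t <> t0 -> has_period d t (2 * p)]]).
Proof.
move=> nt; split; [|split; [|split; [|split; [|split; [|split]]]]].
- by move=> j; split; [exact: A_finite | exact: A_nonempty | exact: A_rational].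
- by move=> j; split; [exact: A_bij | exact: F_rev_cyclic].
- exact: A_in_arc.
- move=> i; split=> [j k jk | j m mi].
    by apply: translates_unlinked; rewrite ?ltn_ord // jk orbT.
  have := @translates_unlinked i m j 0 (ltn_ord j) (ltnW d1).
  rewrite mi => /(_ isT)[I [J [cI cJ IJ AI AJ]]]; exists I, J; split => // t At.
  by apply: AJ; exists t => //; rewrite mul0r addr0 mod1_id //; exact: A01 At.
- exact: A_periodic.
- exact: even_periods.
- by move=> podd; exact: odd_periods.
Qed.
End Portrait.

(** * The orbit portrait as a formal portrait *)

Section OrbitPortrait.
Variables (R : realType) (d : nat) (c : Cplx R) (p : nat) (z : 'I_p -> Cplx R).
Hypothesis d1 : (1 < d)%N.
Hypothesis hz : periodic_orbit d c z.
Let f := antipoly d c.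
Let A := orbit_portrait d c z.

Lemma iter_orbit n j : iter n f (z j) = z (iter n (@ordS p) j).
Proof. by case: hz => _ _ hf; elim: n => // n IH; rewrite !iterS IH; exact: hf. Qed.

Lemma orbit_filled j : filled_julia d c (z j).
Proof.
exists (\sum_(k < p) modulus (z k)) => n; rewrite -/f iter_orbit.
rewrite (bigD1 (iter n (@ordS p) j)) //= lerDl.
by apply: sumr_ge0 => k _; exact: modulus_ge0.
Qed.

(** A landing point lies in the Julia set, and with it the whole orbit by forward invariance; a
    periodic critical point does not. *)
Lemma orbit_neq0 j t k : ray_lands d c t (z j) -> z k <> 0.
Proof.
move=> [Jz _] zk0; have [p0 _ _] := hz.
have J n : julia d c (z (iter n (@ordS p) j)).
  rewrite -iter_orbit; elim: n => [|n IH]; first exact: Jz.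
  by rewrite iterS; exact: julia_antipoly IH.
have [n hn] := iter_ordS_reach j k; have := J n; rewrite hn zk0.
apply: (critical_periodic_not_julia d1 p0); rewrite -zk0 -/f iter_orbit; congr z.
by apply/eqP; rewrite iter_ordS_fixed.
Qed.

Lemma portrait_itv i t : A i t -> 0 <= t < 1.
Proof. by case. Qed.

Lemma portrait_map i t : A i t -> A (ordS i) (angle_map d t).
Proof.
case: hz => _ _ hf [_ h]; split; first exact: mod1_itv.
by rewrite -hf; exact: ray_lands_angle_map.
Qed.

Lemma portrait_disjoint i j t : A i t -> A j t -> i = j.
Proof. by case: hz => _ inj _ [_ h1] [_ h2]; exact: inj (ray_lands_unique d1 h1 h2). Qed.

(** The map absorbs the rotation, so equality would give z_i and z_m the same image, hence i = m on
    a cycle. A rotation fixing z_i != 0 is trivial, which leaves j = 0. *)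
Lemma rotation_orbit_neq i m (j : nat) t : (j < d)%N -> (m != i) || (j != 0)%N ->
  A i t -> rotation d j (z i) <> z m.
Proof.
move=> jd mj [_ hi] E; have [_ inj hf] := hz.
have im : i = m.
  apply: (@ordS_inj p); apply: inj; rewrite -!hf -E antipoly_rotation //.
move: mj; rewrite -im eqxx /= -lt0n => j0; rewrite -im in E.
have zi0 : z i != 0 by apply/eqP; exact: orbit_neq0 hi.
have [k hk] := rotation_eq zi0 E.
have dR : 0 < d%:R :> R by rewrite ltr0n ltnW.
have h0 : 0 < k%:~R :> R by rewrite -hk divr_gt0 // ltr0n.
have h1 : k%:~R < 1%:~R :> R by rewrite -hk ltr_pdivrMr // mul1r ltr_nat.
by move: h0 h1; rewrite ltr0z ltr_int; lia.
Qed.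

(** Replaces t by its representative in [x, x + 1[, which turns statements on arc lengths from x
    into inequalities between real angles. *)
Lemma ray_lands_arclen x t w : ray_lands d c t w -> ray_lands d c (x + arclen x t) w.
Proof.
move=> h; have [k e] := mod1E (t - x); rewrite /arclen e.
have -> : x + (t - x + k%:~R) = t + k%:~R by rewrite addrA addrCA subrr addr0.
exact: ray_lands_shift.
Qed.

Lemma portrait_rotation_disjoint i m (j : nat) t s : (j < d)%N -> (m != i) || (j != 0)%N ->
  A i t -> A m s -> arclen (t + j%:R / d%:R) s <> 0.
Proof.
move=> jd mj At [_ hs] E; apply: (rotation_orbit_neq jd mj At); have [_ ht] := At.
have := ray_lands_arclen (t + j%:R / d%:R) hs; rewrite E addr0.
exact: (ray_lands_unique d1 (ray_lands_rotation d1 j ht)).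
Qed.

Lemma portrait_unlinked i m (j : nat) t1 t2 s1 s2 : (j < d)%N -> (m != i) || (j != 0)%N ->
  A i t1 -> A i t2 -> A m s1 -> A m s2 ->
  arclen (t1 + j%:R / d%:R) s1 < arclen t1 t2 -> arclen t1 t2 < arclen (t1 + j%:R / d%:R) s2 -> False.
Proof.
move=> jd mj At1 At2 As1 As2; set x := t1 + _ => l1 l2.
have n1 := portrait_rotation_disjoint jd mj At1 As1.
have [_ h1] := At1; have [_ h2] := At2; have [_ k1] := As1; have [_ k2] := As2.
have r2 := ray_lands_arclen x (ray_lands_rotation d1 j h2).
rewrite /x arclenDr -/x in r2.
apply: (landing_rays_unlinked d1 _ (orbit_filled m) (rotation_orbit_neq jd mj At1)
  (ray_lands_rotation d1 j h1) r2 (ray_lands_arclen x k1) (ray_lands_arclen x k2)).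
- by apply: (proj1 (filled_julia_rotation c d1 j (z i))); exact: orbit_filled.
- by rewrite -/x ltrDl lt0r arclen_ge0 andbT; apply/eqP.
- by rewrite ltrD2l.
- by rewrite ltrD2l.
- by rewrite -/x ltrD2l arclen_lt1.
Qed.
End OrbitPortrait.

Theorem theorem2p6 (R : realType) (d : nat) (hd : (2 <= d)%N) (c : Cplx R)
    (p : nat) (z : 'I_p -> Cplx R) (hz : periodic_orbit d c z)
    (hrat : exists (j : 'I_p) (q : rat), ray_lands d c (ratr q) (z j))
    (A : 'I_p -> set R) (hA : A = orbit_portrait d c z)
    (hnt : ~ trivial_portrait A) :
  (* (1) *)
  (forall j, [/\ finite_set (A j), A j !=set0 &
     forall t, A j t -> exists q : rat, t = ratr q]) /\
  (* (2) *)
  (forall j, set_bij (A j) (A (ordS j)) (angle_map d) /\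
     reverses_cyclic_order (angle_map d) (A j)) /\
  (* (3) *)
  (forall j, exists s l : R, 0 <= l < d%:R^-1 /\ A j `<=` circle_arc s l) /\
  (* (4) *)
  (forall i : 'I_p,
     (forall j k : 'I_d, j != k ->
        unlinked (translate (j%:R / d%:R) (A i))
                 (translate (k%:R / d%:R) (A i))) /\
     (forall (j : 'I_d) (m : 'I_p), m != i ->
        unlinked (translate (j%:R / d%:R) (A i)) (A m))) /\
  (* (5) *)
  (forall j t, A j t -> exists n, has_period d t n) /\
  (~~ odd p -> exists r : nat, (1 <= r)%N /\
     forall j t, A j t -> has_period d t (r * p)) /\
  (odd p ->
     [\/ (* (i) *)
         forall j, A j #= `I_2 /\ forall t, A j t -> has_period d t p,
         (* (ii) *)
         forall j, A j #= `I_2 /\ forall t, A j t -> has_period d t (2 * p)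
       | (* (iii) *)
         forall j, A j #= `I_3 /\
           exists t0, [/\ A j t0, has_period d t0 p &
             forall t, A j t -> t <> t0 -> has_period d t (2 * p)]]).
Proof.
rewrite hA in hnt *; move=> {A hA}.
apply: portrait_combinatorics hnt.
- exact: hd.
- exact: portrait_itv.
- exact: portrait_map hd hz.
- exact: portrait_disjoint hd hz.
- exact: portrait_rotation_disjoint hd hz.
- exact: portrait_unlinked hd hz.
- have [j [q hq]] := hrat; exists j, q; split; first exact: mod1_itv.
  by apply/ray_lands_mod1.
Qed.
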